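(* Fix a cut-off level $r>M_H$, and let $(\eta_r,\varepsilon_{0,r})$ be an admissible pair. Then, for each $\varepsilon\in(0,\varepsilon_{0,r}]$, there exists a global Lipschitz map $h_\varepsilon:X_\theta\to X_a$ whose Lipschitz constant is bounded uniformly for $\varepsilon\in(0,\varepsilon_{0,r}]$, and which satisfies the following properties. (i) The set $S_\varepsilon:=\{(h_\varepsilon(\theta),\theta):\theta\in X_\theta\}\subset X_a\times X_\theta$ is an invariant manifold for the original system $\partial_ta=\varepsilon^{-1}\mathcal G(\theta,a)$, $\partial_t\theta=\mathcal F(\theta,a)$, namely the Lyapunov–Perron selected slow manifold, that is, the one with $h_\varepsilon(\theta_0)=h_0(\theta_0)+\xi^{\theta_0}_{\varepsilon,r}(0)$ for all $\theta_0\in X_\theta$. (ii) The graph of the slow manifold is $O(\varepsilon)$-close to the graph of the critical manifold: $\|h_\varepsilon(\theta)-h_0(\theta)\|_{X_a}\le C_r\,\varepsilon$ for all $\theta\in X_\theta$; in particular, one may take $C_r=C_1(r)$. (iii) The graph map $h_\varepsilon:X_\theta\to X_a$ is $C^1$. Moreover, after possibly decreasing $\varepsilon_{0,r}$, there is a constant $C_{D,r}>0$, independent of $\varepsilon\in(0,\varepsilon_{0,r}]$, such that $$\sup_{\theta\in X_\theta}\|Dh_\varepsilon(\theta)-Dh_0(\theta)\|_{\mathcal B(X_\theta,X_a)}\le C_{D,r}\,\varepsilon.$$ Consequently $S_\varepsilon$ is a $C^1$-manifold. (iv) Let $(a,\theta)$ be a solution on $[0,T]$ of the original system (without cut-off),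 with initial data $(a_0,\theta_0)$. Then there exists $\mu_r>0$ such that $$\|a(t)-h_\varepsilon(\theta(t))\|_{X_a}\le e^{-\mu_rt/\varepsilon}\|a_0-h_\varepsilon(\theta_0)\|_{X_a},\qquad t\in[0,T].$$ Moreover, let $(\bar a,\bar\theta)$ denote the solution on $S_\varepsilon$ with $\bar\theta(0)=\theta(0)$, $\bar a(0)=h_\varepsilon(\theta(0))$. Then, for every $\rho>0$ and $T>0$, there exists a constant $C_{r,T,\rho}>0$, independent of $\varepsilon\in(0,\varepsilon_{0,r}]$ and of the particular solution with $\|a_0\|_{X_a}\le\rho$, such that $$\sup_{0\le t\le T}\|\theta(t)-\bar\theta(t)\|_{X_\theta}\le C_{r,T,\rho}\,\varepsilon\,\|a_0-h_\varepsilon(\theta_0)\|_{X_a}$$ and $$\|a(t)-\bar a(t)\|_{X_a}\le e^{-\mu_rt/\varepsilon}\|a_0-h_\varepsilon(\theta_0)\|_{X_a}+C_{r,T,\rho}\,\varepsilon\,\|a_0-h_\varepsilon(\theta_0)\|_{X_a},\qquad t\in[0,T].$$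
   Context: Spaces: $X_\theta=L^\infty([0,1])$, $X_a=L^\infty([0,1]^2)$ (real-valued, essential supremum norms), product spaces with the sum norm; $\mathcal B(E,Y)$ denotes bounded linear operators with operator norm. $C_b^k$ denotes $C^k$ functions bounded together with all partial derivatives up to order $k$. Standing assumptions: $\Gamma\in C_b^1(\mathbb R)$ is $2\pi$-periodic, $H\in C_b^2(\mathbb R^2)$ is $2\pi$-periodic in each argument, $\omega\in X_\theta$, $a_0\in X_a$, $\theta_0\in X_\theta$. Fast–slow system: $\mathcal G(\theta,a)(x,y)=-a(x,y)+H(\theta(x),\theta(y))$, $\mathcal F(\theta,a)(x)=\omega(x)+\int_0^1a(x,y)\Gamma(\theta(y)-\theta(x))\,dy$; the original system is $\partial_ta=\varepsilon^{-1}\mathcal G(\theta,a)$, $\partial_t\theta=\mathcal F(\theta,a)$, $a(0)=a_0$, $\theta(0)=\theta_0$. A set is invariant if every solution with initial value in the set remains in it. The critical manifold is the graph $a=h_0(\theta)$, where $h_0(\theta)(x,y)=H(\theta(x),\theta(y))$, with $(Dh_0(\theta)\varphi)(x,y)=\partial_1H(\theta(x),\theta(y))\varphi(x)+\partial_2H(\theta(x),\theta(y))\varphi(y)$. Constants: $M_\omega=\|\omega\|_\infty$, $M_H=\|H\|_\infty$, $M_\Gamma=\|\Gamma\|_\infty$, $L_\Gamma=\|\Gamma'\|_\infty$, $M_{DH}=\max_q\|\partial_qH\|_\infty$, $M_{D^2H}=\max_{q,\ell}\|\partial^2_{q\ell}H\|_\infty$; $C_2(r)=M_\omega+2rM_\Gamma$,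 $C_1(r)=2M_{DH}C_2(r)$, $C_3(r)=2M_{DH}M_\Gamma+4M_{D^2H}C_2(r)+2M_{DH}(2M_\Gamma M_{DH}+4rL_\Gamma)$, $C_4(r)=M_\Gamma+2M_\Gamma M_{DH}+4rL_\Gamma$. Cut-off: fix an odd $\chi\in C_b^\infty(\mathbb R)$ with $\chi(z)=z$ for $|z|\le1$, $|\chi|\le2$, $|\chi'|\le1$, $\chi$ constant for large $z$ (and for large $-z$); $\sigma_r(z)=r\chi(z/r)$. Set $\mathcal F_r(\theta,a)(x)=\omega(x)+\int_0^1\sigma_r(a(x,y))\Gamma(\theta(y)-\theta(x))\,dy$ and $B_r(\xi,\theta)=\mathcal F_r(\theta,h_0(\theta)+\xi)$. Weighted spaces: for $\eta<0$ and $Y\in\{X_a,X_\theta\}$, $C_{\eta,Y}=\{u\in C((-\infty,0];Y):\|u\|_{C_{\eta,Y}}=\sup_{t\le0}e^{-\eta t}\|u(t)\|_Y<\infty\}$, and $\mathcal X_\eta=C_{\eta,X_a}\times C_{\eta,X_\theta}$ with the sum norm. For $\theta_0\in X_\theta$ the Lyapunov–Perron operator on $\mathcal X_\eta$ is $\mathcal L_{\varepsilon,\theta_0,r}=(\mathcal L^{(1)},\mathcal L^{(2)})$, $$\mathcal L^{(1)}(\xi,\theta)(t)=-\int_{-\infty}^te^{-(t-s)/\varepsilon}Dh_0(\theta(s))B_r(\xi(s),\theta(s))\,ds,\qquad\mathcal L^{(2)}(\xi,\theta)(t)=\theta_0+\int_0^tB_r(\xi(s),\theta(s))\,ds.$$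 Admissible pair: $\eta_r<0$, $\varepsilon_{0,r}>0$ with $C_4(r)/|\eta_r|<1/2$, $C_1(r)\varepsilon_{0,r}<r-M_H$, $1+\varepsilon\eta_r\ge1/2$ for all $0<\varepsilon\le\varepsilon_{0,r}$, and $q_*:=\sup_{0<\varepsilon\le\varepsilon_{0,r}}\bigl(C_3(r)\tfrac{\varepsilon}{1+\varepsilon\eta_r}+\tfrac{C_4(r)}{|\eta_r|}\bigr)<1$. For such a pair and $\varepsilon\in(0,\varepsilon_{0,r}]$, $\mathcal L_{\varepsilon,\theta_0,r}$ has a unique fixed point $(\xi^{\theta_0}_{\varepsilon,r},\theta^{\theta_0}_{\varepsilon,r})\in\mathcal X_{\eta_r}$ for every $\theta_0\in X_\theta$. *)

(* Defs.v *)
From HB Require Import structures.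
From mathcomp Require Import all_boot all_order all_algebra.
From mathcomp Require Import all_classical all_reals all_analysis.
From mathcomp Require Import ess_sup_inf measurable_realfun.

Set Implicit Arguments.
Unset Strict Implicit.
Unset Printing Implicit Defensive.

Import Order.TTheory GRing.Theory Num.Theory.
Import numFieldNormedType.Exports.

Local Open Scope classical_set_scope.
Local Open Scope quotient_scope.
Local Open Scope ring_scope.

Section Linf.
Context d (T : measurableType d) (R : realType).
Variable mu : {measure set T -> \bar R}.
Implicit Types f g : T -> R.

Definition Linf : Type := LspaceType mu (leey 1).

(** A class coerces to one of its representatives. *)
Definition Linf_fun (u : Linf) : T -> R := aqEqMfun_to_fun u.
Coercion Linf_fun : Linf >-> Funclass.

Definition ess_bounded f :=
  measurable_fun [set: T] f /\ finite_norm mu +oo%E f.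

Lemma ae_eq_Lnormy f g : f = g %[ae mu] ->
  ('N[mu]_+oo[EFin \o f] = 'N[mu]_+oo[EFin \o g])%E.
Proof.
move=> fg; rewrite unlock /Lnorm; case: ifPn => // _.
by apply: eq_ess_sup; apply: filterS fg => x /(_ I) /= ->.
Qed.

Section aeclass.
Variables (f : T -> R) (hf : ess_bounded f).

Let mfun_f : {mfun T >-> measurableTypeR R} :=
  @mfun_Sub _ _ T (measurableTypeR R) f (mem_set hf.1).

Definition aeclass : {mfun_ mu, T >-> measurableTypeR R} :=
  \pi_({mfun_ mu, T >-> measurableTypeR R}) mfun_f.

Lemma aeclassE : aqEqMfun_to_fun aeclass = f %[ae mu].
Proof.
have : \pi_({mfun_ mu, T >-> measurableTypeR R}) (repr aeclass) = aeclass.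
  exact: reprK.
by move/eqmodP => /asboolP.
Qed.

Let aeclass_finite : finite_norm mu +oo%E (aqEqMfun_to_fun aeclass).
Proof. by rewrite /finite_norm (ae_eq_Lnormy aeclassE); exact: hf.2. Qed.

Definition Linf_class : Linf :=
  LebesgueSpace.Pack (LebesgueSpace.Class
    (@isFinLebesgue.Build d T R mu +oo%E (leey 1) aeclass aeclass_finite)).

End aeclass.

Lemma Linf_classE f (hf : ess_bounded f) : Linf_class hf = f %[ae mu].
Proof. exact: aeclassE. Qed.

Lemma ess_bounded_Linf (u : Linf) : ess_bounded u.
Proof.
split; last exact: (@Lebesgue_finite _ _ _ _ _ _ u).
exact: (@measurable_funPT _ _ _ _ (repr (u : {mfun_ mu, T >-> measurableTypeR R}))).
Qed.

Lemma Linf_eqP (u v : Linf) : u = v %[ae mu] <-> u = v.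
Proof.
split=> [uv|->]; last exact: ae_eq_refl.
case: u v uv => [u [[pu]]] [v [[pv]]] uv.
have uv' : u = v.
  rewrite -(reprK u) -(reprK v); apply/eqmodP/asboolP; exact: uv.
subst v; congr (LebesgueSpace.Pack (LebesgueSpace.Class _)).
by congr (isFinLebesgue.Axioms_ _); exact: Prop_irrelevance.
Qed.


Lemma ess_boundedP f : ess_bounded f <-> f \in Lfun mu +oo%E.
Proof.
split=> [[mf nf]|/andP[/set_mem mf /set_mem nf]]; last by split.
by apply/andP; split; apply/mem_set.
Qed.

Lemma ess_bounded0 : ess_bounded (cst 0).
Proof.
by apply/ess_boundedP; exact: (Lfun_submod_closed mu (leey 1)).1.
Qed.

Lemma ess_bounded_lin (a : R) f g :
  ess_bounded f -> ess_bounded g -> ess_bounded (a *: f + g).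
Proof.
move=> /ess_boundedP ? /ess_boundedP ?; by apply/ess_boundedP; exact: (Lfun_submod_closed mu (leey 1)).2.
Qed.

(** The class of [f], or the junk value [0] when [f] is not essentially
    bounded. *)
Definition Linf_of f : Linf :=
  if pselect (ess_bounded f) is left hf then Linf_class hf
  else Linf_class ess_bounded0.

Lemma Linf_ofE f : ess_bounded f -> Linf_of f = f %[ae mu].
Proof.
by rewrite /Linf_of => hf; case: pselect => // {}hf; exact: Linf_classE.
Qed.

Lemma Linf_of_eq f g : ess_bounded f -> ess_bounded g -> f = g %[ae mu] ->
  Linf_of f = Linf_of g.
Proof.
move=> hf hg fg; apply/Linf_eqP.
apply: ae_eq_trans (Linf_ofE hf) _; apply: ae_eq_trans fg _.
exact/ae_eq_sym/Linf_ofE.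
Qed.

Let add (u v : Linf) : Linf := Linf_of (fun x => u x + v x).
Let opp (u : Linf) : Linf := Linf_of (fun x => - u x).
Let scale (a : R) (u : Linf) : Linf := Linf_of (fun x => a * u x).
Let zero : Linf := Linf_of (fun=> 0).

Let hyp_add (u v : Linf) : ess_bounded (fun x => u x + v x).
Proof.
rewrite (_ : (fun _ => _) = 1 *: (u : T -> R) + (v : T -> R)).
  exact: ess_bounded_lin (ess_bounded_Linf _) (ess_bounded_Linf _).
by apply/funext => x /=; rewrite scale1r.
Qed.

Let hyp_scale a (u : Linf) : ess_bounded (fun x => a * u x).
Proof.
rewrite (_ : (fun _ => _) = a *: (u : T -> R) + cst 0).
  exact: ess_bounded_lin (ess_bounded_Linf _) ess_bounded0.
by apply/funext => x /=; rewrite -[RHS]/(_ + _) addr0.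
Qed.

Let hyp_opp (u : Linf) : ess_bounded (fun x => - u x).
Proof.
rewrite (_ : (fun _ => _) = (fun x => (-1) * u x)); first exact: hyp_scale.
by apply/funext => x; rewrite mulN1r.
Qed.

Lemma Linf_addE u v : add u v = (fun x => u x + v x) %[ae mu].
Proof. exact: Linf_ofE. Qed.

Lemma Linf_oppE u : opp u = (fun x => - u x) %[ae mu].
Proof. exact: Linf_ofE. Qed.

Lemma Linf_scaleE a u : scale a u = (fun x => a * u x) %[ae mu].
Proof. exact: Linf_ofE. Qed.

Lemma Linf_zeroE : zero = (fun=> 0) %[ae mu].
Proof. exact: Linf_ofE ess_bounded0. Qed.

Let addA : associative add.
Proof.
move=> u v w; apply/Linf_eqP.
apply: filterS3 (Linf_addE u (add v w)) (Linf_addE (add u v) w)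
  (filterI (Linf_addE u v) (Linf_addE v w)) => x e1 e2 [e3 e4] _.
by rewrite e1// e2// e3// e4//; rewrite addrA.
Qed.

Let addC : commutative add.
Proof. by move=> u v; congr Linf_of; apply/funext => x; rewrite addrC. Qed.

Let add0 : left_id zero add.
Proof.
move=> u; apply/Linf_eqP.
apply: filterS2 (Linf_addE zero u) Linf_zeroE => x e1 e2 _.
by rewrite e1// e2// add0r.
Qed.

Let addN : left_inverse zero opp add.
Proof.
move=> u; apply/Linf_eqP.
apply: filterS3 (Linf_addE (opp u) u) Linf_zeroE (Linf_oppE u) => x e1 e2 e3 _.
by rewrite e1// e2// e3// addNr.
Qed.

HB.instance Definition _ := gen_eqMixin Linf.
HB.instance Definition _ := gen_choiceMixin Linf.
HB.instance Definition _ := GRing.isZmodule.Build Linf addA addC add0 addN.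

Let scaleA a b u : scale a (scale b u) = scale (a * b) u.
Proof.
apply/Linf_eqP; apply: filterS3 (Linf_scaleE a (scale b u)) (Linf_scaleE b u)
  (Linf_scaleE (a * b) u) => x e1 e2 e3 _.
by rewrite e1// e2// e3// mulrA.
Qed.

Let scale1 : left_id 1 scale.
Proof.
move=> u; apply/Linf_eqP; apply: filterS (Linf_scaleE 1 u) => x e _.
by rewrite e// mul1r.
Qed.

Let scaleDr : right_distributive scale +%R.
Proof.
move=> a u v; apply/Linf_eqP.
apply: filterS3 (filterI (Linf_scaleE a (u + v)) (Linf_addE u v))
  (Linf_addE (scale a u) (scale a v))
  (filterI (Linf_scaleE a u) (Linf_scaleE a v)) => x [e1 e2] e3 [e4 e5] _.
by rewrite e1// e2// e3// e4// e5// mulrDr.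
Qed.

Let scaleDl u : {morph scale^~ u : a b / a + b}.
Proof.
move=> a b; apply/Linf_eqP.
apply: filterS3 (Linf_scaleE (a + b) u) (Linf_addE (scale a u) (scale b u))
  (filterI (Linf_scaleE a u) (Linf_scaleE b u)) => x e1 e2 [e3 e4] _.
by rewrite e1// e2// e3// e4// mulrDl.
Qed.

HB.instance Definition _ :=
  GRing.Zmodule_isLmodule.Build R Linf scaleA scale1 scaleDr scaleDl.

Let norm (u : Linf) : R := fine ('N[mu]_+oo[EFin \o u])%E.

Let normE (u : Linf) : (norm u)%:E = ('N[mu]_+oo[EFin \o u])%E.
Proof.
rewrite /norm fineK// fin_numElt (lt_le_trans ltNy0) ?Lnorm_ge0//=.
exact: (ess_bounded_Linf u).2.
Qed.

Let ler_normD u v : norm (u + v) <= norm u + norm v.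
Proof.
rewrite -lee_fin EFinD !normE (ae_eq_Lnormy (Linf_addE u v)).
apply: (@eminkowski _ _ _ mu u v +oo%E); last exact: leey.
  exact: (ess_bounded_Linf u).1.
exact: (ess_bounded_Linf v).1.
Qed.

Let normrZ a u : norm (a *: u) = `|a| * norm u.
Proof.
apply/EFin_inj; rewrite EFinM !normE (ae_eq_Lnormy (Linf_scaleE a u)).
have hu : (u : T -> R) \in Lfun mu +oo%E by apply/ess_boundedP/ess_bounded_Linf.
exact: (LnormZ (Lfun_Sub (leey 1) hu) a).
Qed.

Let normr0_eq0 u : norm u = 0 -> u = 0.
Proof.
move=> nu; have nu0 : ('N[mu]_+oo[EFin \o u] = 0)%E by rewrite -normE nu.
have /measurable_EFinP mfu := (ess_bounded_Linf u).1.
have u0 := Lnorm_eq0_eq0 mfu (ltry 0) nu0; apply/Linf_eqP.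
apply: filterS2 u0 Linf_zeroE => x e1 e2 _.
by have [-> ] := e1 I; rewrite e2.
Qed.

HB.instance Definition _ :=
  Lmodule_isNormed.Build R Linf ler_normD normrZ normr0_eq0.

Lemma Linf_normE (u : Linf) : `|u|%:E = ('N[mu]_+oo[EFin \o u])%E.
Proof. exact: normE. Qed.

Lemma Linf_Dfun (u v : Linf) : u + v = (fun x => u x + v x) %[ae mu].
Proof. exact: Linf_addE. Qed.

Lemma Linf_Nfun (u : Linf) : - u = (fun x => - u x) %[ae mu].
Proof. exact: Linf_oppE. Qed.

Lemma Linf_Zfun a (u : Linf) : a *: u = (fun x => a * u x) %[ae mu].
Proof. exact: Linf_scaleE. Qed.

End Linf.

Section banach_calculus.
Context (R : realType).
Implicit Types V W : normedModType R.

Definition opnorm V W (A : V -> W) : \bar R :=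
  ereal_sup [set (`|A v|)%:E | v in [set v : V | `|v| <= 1]].

(** Meant for open [U]; continuity of the derivative is in operator norm. *)
Definition C1_on V W (U : set V) (f : V -> W) : Prop :=
  forall x, U x -> differentiable f x /\
    opnorm (fun v => 'd f y v - 'd f x v) @[y --> x] --> 0%E.

(** C^1 Banach submanifold of [E] modelled on [M] with complement [N]: near each
    of its points, a C^1 diffeomorphism [phi] onto an open set of [N * M]
    straightens [S] to the slice [0 * M]. *)
Definition C1_submanifold (N M E : normedModType R) (S : set E) : Prop :=
  forall p, S p -> exists (U : set E) (V : set (N * M)%type)
      (phi : E -> N * M) (psi : N * M -> E),
    [/\ open U /\ U p, open V, C1_on U phi, C1_on V psi &
        [/\ forall q, U q -> V (phi q) /\ psi (phi q) = q,
            forall z, V z -> U (psi z) /\ phi (psi z) = z &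
            forall q, U q -> (S q <-> (phi q).1 = 0)]].

(** Derivative relative to [I], hence one-sided at an end point of [I]. *)
Definition deriv_within V (I : set R) (u : R -> V) (t : R) (v : V) : Prop :=
  h^-1 *: (u (t + h) - u t) @[h --> within [set h | I (t + h)] 0^'] --> v.

(** Riemann integral of a vector-valued function over [a, b], a <= b: limit of
    the sums over tagged partitions as the mesh goes to 0. *)
Definition is_rint V (f : R -> V) (a b : R) (J : V) : Prop :=
  forall e : R, 0 < e -> exists2 delta : R, 0 < delta &
    forall (n : nat) (p tag : nat -> R), p 0%N = a -> p n = b ->
      (forall i, (i < n)%N ->
        p i <= tag i <= p i.+1 /\ p i.+1 - p i < delta) ->
      `|J - \sum_(i < n) (p i.+1 - p i) *: f (tag i)| < e.

Definition rint V (f : R -> V) (a b : R) : V :=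
  if a <= b then xget 0 (is_rint f a b) else - xget 0 (is_rint f b a).

Definition rint_ninfty V (f : R -> V) (b : R) : V :=
  lim (rint f a b @[a --> -oo]).

(** For [D] the coordinate directions, [Cb D k f] says that [f] is C^k and
    bounded together with its partial derivatives up to order [k]. *)
Fixpoint Cb V (D : set V) (k : nat) (f : V -> R) : Prop :=
  [/\ continuous f,
      exists M, forall x, `|f x| <= M &
      if k is k'.+1 then
        forall e, D e -> (forall x, derivable f x e) /\ Cb D k' ('D_e f)
      else True].

Definition supnorm (X : Type) (f : X -> R) : R := sup (range (fun x => `|f x|)).

End banach_calculus.

Section spaces.
Context (R : realType).

Let itv01 : set (measurableTypeR R) := `[0, 1].

Let measurable_itv01 : measurable itv01.
Proof. exact: measurable_itv. Qed.

Let lebesgue_itv01 : (@lebesgue_measure R itv01 < +oo)%E.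
Proof. by rewrite lebesgue_measure_itv /= lte_fin ltr01 sube0 ltry. Qed.

(** [leb01] lives on the whole line but does not charge the complement of
    [[0, 1]], so that [Linf leb01] is L^oo([0, 1]). *)
Definition leb01 : {finite_measure set (measurableTypeR R) -> \bar R} :=
  mfrestr measurable_itv01 lebesgue_itv01.

Definition leb01sq :
    {measure set (measurableTypeR R * measurableTypeR R) -> \bar R} :=
  (leb01 \x leb01)%E.

Definition Xtheta : Type := Linf leb01.
HB.instance Definition _ := NormedModule.on Xtheta.

Definition Xa : Type := Linf leb01sq.
HB.instance Definition _ := NormedModule.on Xa.

End spaces.

Section system.
Context (R : realType).
Variables (Gamma : R -> R) (H : R * R -> R) (omega : Xtheta R) (chi : R -> R).
Implicit Types (a xi : Xa R) (theta phi : Xtheta R).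

Definition axis1 : R * R := (1, 0).
Definition axis2 : R * R := (0, 1).

Definition d1H : R * R -> R := 'D_axis1 H.
Definition d2H : R * R -> R := 'D_axis2 H.

Definition standing_assumptions : Prop :=
  [/\ Cb [set (1 : R)] 1 Gamma, Cb [set axis1; axis2] 2 H,
      forall x, Gamma (x + 2 * pi) = Gamma x &
      forall x y, H (x + 2 * pi, y) = H (x, y) /\ H (x, y + 2 * pi) = H (x, y)].

(** The arguments of [Linf_of] below are essentially bounded under
    [standing_assumptions] and [cutoff], hence its junk value is not used. *)
Definition h0 theta : Xa R :=
  Linf_of (leb01sq R) (fun p => H (theta p.1, theta p.2)).

Definition Dh0 theta phi : Xa R :=
  Linf_of (leb01sq R) (fun p => d1H (theta p.1, theta p.2) * phi p.1
                              + d2H (theta p.1, theta p.2) * phi p.2).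

Definition calG theta a : Xa R :=
  Linf_of (leb01sq R) (fun p => - a p + H (theta p.1, theta p.2)).

Definition calF theta a : Xtheta R :=
  Linf_of (leb01 R) (fun x => omega x
    + \int[leb01 R]_y (a (x, y) * Gamma (theta y - theta x))).

Definition is_solution (eps t1 : R) (a : R -> Xa R) (theta : R -> Xtheta R) :=
  forall t, `[0, t1]%classic t ->
    deriv_within `[0, t1]%classic a t (eps^-1 *: calG (theta t) (a t)) /\
    deriv_within `[0, t1]%classic theta t (calF (theta t) (a t)).

Definition invariant_set (eps : R) (S : set (Xa R * Xtheta R)) : Prop :=
  forall (t1 : R) (a : R -> Xa R) (theta : R -> Xtheta R), 0 < t1 ->
    is_solution eps t1 a theta -> S (a 0, theta 0) ->
    forall t, `[0, t1]%classic t -> S (a t, theta t).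

Definition M_omega : R := `|omega|.
Definition M_H : R := supnorm H.
Definition M_Gamma : R := supnorm Gamma.
Definition L_Gamma : R := supnorm ('D_1 Gamma).
Definition M_DH : R := Num.max (supnorm d1H) (supnorm d2H).
Definition M_D2H : R :=
  Num.max (Num.max (supnorm ('D_axis1 d1H)) (supnorm ('D_axis2 d1H)))
          (Num.max (supnorm ('D_axis1 d2H)) (supnorm ('D_axis2 d2H))).

Definition C2 (r : R) : R := M_omega + 2 * r * M_Gamma.
Definition C1 (r : R) : R := 2 * M_DH * C2 r.
Definition C3 (r : R) : R :=
  2 * M_DH * M_Gamma + 4 * M_D2H * C2 r
  + 2 * M_DH * (2 * M_Gamma * M_DH + 4 * r * L_Gamma).
Definition C4 (r : R) : R := M_Gamma + 2 * M_Gamma * M_DH + 4 * r * L_Gamma.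

Definition cutoff : Prop :=
  [/\ forall z, chi (- z) = - chi z,
      forall k, Cb [set (1 : R)] k chi,
      forall z, `|z| <= 1 -> chi z = z,
      forall z, `|chi z| <= 2 /\ `|'D_1 chi z| <= 1 &
      exists z0 c c', forall z, (z0 <= z -> chi z = c) /\
                                (z <= - z0 -> chi z = c')].

Definition sigma (r z : R) : R := r * chi (z / r).

Definition calFr (r : R) theta a : Xtheta R :=
  Linf_of (leb01 R) (fun x => omega x
    + \int[leb01 R]_y (sigma r (a (x, y)) * Gamma (theta y - theta x))).

Definition calBr (r : R) xi theta : Xtheta R := calFr r theta (h0 theta + xi).

(** Curves on (-oo, 0] are given by functions on [R], of which only the values
    at nonpositive times matter. *)
Definition wnorm (Y : normedModType R) (eta : R) (u : R -> Y) : \bar R :=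
  ereal_sup [set (expR (- (eta * t)) * `|u t|)%:E | t in `]-oo, (0 : R)]].

Definition Cweighted (Y : normedModType R) (eta : R) (u : R -> Y) : Prop :=
  {within `]-oo, (0 : R)], continuous u} /\ (wnorm eta u < +oo)%E.

(** The total operators [rint] and [rint_ninfty] only matter on the continuous,
    exponentially damped integrands occurring here. *)
Definition LP1 (eps r : R) (xi : R -> Xa R) (theta : R -> Xtheta R) (t : R)
    : Xa R :=
  - rint_ninfty (fun s => expR (- ((t - s) / eps))
                     *: Dh0 (theta s) (calBr r (xi s) (theta s))) t.

Definition LP2 (theta0 : Xtheta R) (r : R)
    (xi : R -> Xa R) (theta : R -> Xtheta R) (t : R) : Xtheta R :=
  theta0 + rint (fun s => calBr r (xi s) (theta s)) 0 t.

Definition LP_fixed_point (eta eps r : R) (theta0 : Xtheta R)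
    (xi : R -> Xa R) (theta : R -> Xtheta R) : Prop :=
  [/\ Cweighted eta xi, Cweighted eta theta &
      forall t, t <= 0 -> LP1 eps r xi theta t = xi t /\
                          LP2 theta0 r xi theta t = theta t].

Definition LP_unique_fixed_point (eta eps r : R) (theta0 : Xtheta R)
    (xi : R -> Xa R) (theta : R -> Xtheta R) : Prop :=
  LP_fixed_point eta eps r theta0 xi theta /\
  forall (xi' : R -> Xa R) (theta' : R -> Xtheta R),
    LP_fixed_point eta eps r theta0 xi' theta' ->
    forall t, t <= 0 -> xi' t = xi t /\ theta' t = theta t.

Definition q_star (r eta eps0 : R) : R :=
  sup [set C3 r * (eps / (1 + eps * eta)) + C4 r / `|eta|
      | eps in (`]0, eps0]%classic : set R)].

Definition admissible (r eta eps0 : R) : Prop :=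
  [/\ eta < 0 /\ 0 < eps0, C4 r / `|eta| < 1 / 2, C1 r * eps0 < r - M_H,
      forall eps, 0 < eps <= eps0 -> 1 / 2 <= 1 + eps * eta &
      q_star r eta eps0 < 1].

End system.

Definition slow_manifold (R : realType) (h : Xtheta R -> Xa R)
  : set (Xa R * Xtheta R) := range (fun theta => (h theta, theta)).

(* Main.v *)
Require Import Defs.
From HB Require Import structures.
From mathcomp Require Import all_boot all_order all_algebra.
From mathcomp Require Import all_classical all_reals all_analysis.
From mathcomp Require Import ess_sup_inf measurable_realfun.
From mathcomp Require Import ring lra.

Set Implicit Arguments.
Unset Strict Implicit.
Unset Printing Implicit Defensive.

Import Order.TTheory GRing.Theory Num.Theory.
Import numFieldNormedType.Exports.

Local Open Scope classical_set_scope.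
Local Open Scope ring_scope.

(** Fixed points of the Lyapunov-Perron operator are solutions of the system itself.
    Put [a = h0 theta + xi] and [lam = - eta > 0]. Variation of constants shows that
    [(xi, theta)] is a fixed point with base point [theta0] exactly when
    [(theta, a)] solves on (-oo, 0] the cut-off system
      [theta' = F_r (theta, a)],   [eps a' = h0 theta - a],   [theta 0 = theta0],
    with both components [O(exp (- lam t))] as [t] goes to -oo
    ([backward_solution_lp], [lp_backward_solution]). The slow manifold is therefore
    the graph of the map [h_eps] sending [theta0] to [a 0]. Only two features of the
    fast equation are used: it is a low-pass filter, which amplifies inputs of growth
    rate [lam] by [1 / (1 - eps lam)], and its memory is of length [eps].

    Existence, uniqueness and regularity all follow from one a priori estimate,
    [backward_estimate]. Feeding a bound [n exp (- lam t)] on the slow component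
    through the filter and then through the slow equation improves the constant [n]
    to [(Q + M P / (1 - eps lam)) n / lam] plus the contributions of the value at
    time 0 and of the forcing, where [Q], [M] are Lipschitz constants of [F_r] and
    [P] is one of [h0]; admissibility of [(eta, eps0)] makes this a contraction
    ([admissible_gap]). Applied to the difference of two backward solutions the
    estimate gives uniqueness, and the Lipschitz constant [P / (1 - eps lam) <= 2 P],
    uniform in [eps]; the same contraction drives the Picard iteration of
    [backward_exists]. Applied to the system linearized along a backward solution it
    gives the candidate for the derivative.

    Differentiability ([slow_map_rem]) is the delicate point, because the distance of
    two backward solutions may grow as [t] goes to -oo, where Taylor remainders are
    not small. As the gap condition is strict, it also holds for a slightly heavier
    weight [lam + nu]; there the distant past is negligible whatever happens in it
    ([weight_absorb]). The remainders of the superposition operators on L^oo are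
    uniform in the base point, hence so is that of [h_eps]: this gives continuity of
    the derivative as well ([uniform_derivative_cont]), and then the chart
    [(a, theta) |-> (a - h_eps theta, theta)] straightens the graph.

    The [O(eps)] bounds come from the short memory of the filter. The defect
    [xi = a - h0 theta] is a filtered signal with input [- eps Dh0 theta']
    ([defect_bound]); for the derivatives, the input of the filter differs from its
    value at time 0 by [O(- t)] up to exponential weights
    ([tangent_map_near_critical]).

    For the forward dynamics, a backward solution stopped at an earlier time is again
    one, so that it stays on the graph; differentiating gives the invariance equation
    [Dh_eps (theta) F_r (theta, h_eps theta) = (h0 theta - h_eps theta) / eps]. The
    graph lies in the region [`|a| <= M_H < r] where the cut-off is inactive. Hence,
    along any solution of the original system, [z = a - h_eps theta] is damped at rate
    [1 / eps] up to a perturbation of size [`|z| / (2 eps)], which gives the attraction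
    at rate [1 / (2 eps)] ([attraction]). Invariance is the case [z 0 = 0], and
    Gronwall's inequality with the integrable forcing [z] compares the phases
    ([forward_close]). *)

(** * Linear identities in a module *)

Section linear_expressions.
Context (R : pzRingType) (V : lmodType R).

(** Module expressions, reified so that an identity between two of them reduces to
    finitely many identities between scalars. *)
Inductive lexp : Type :=
| LAtom of nat | LZero | LAdd of lexp & lexp | LOpp of lexp
| LScale of R & lexp.

Fixpoint leval (env : seq V) (e : lexp) : V :=
  match e with
  | LAtom n => nth 0 env n
  | LZero => 0
  | LAdd a b => leval env a + leval env b
  | LOpp a => - leval env a
  | LScale c a => c *: leval env a
  end.

Fixpoint lcoef (e : lexp) (i : nat) : R :=
  match e with
  | LAtom n => if eqn n i then 1 else 0
  | LZero => 0
  | LAdd a b => lcoef a i + lcoef b i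
  | LOpp a => - lcoef a i
  | LScale c a => c * lcoef a i
  end.

Fixpoint same_coefs (e e' : lexp) (n : nat) : Prop :=
  if n is m.+1 then lcoef e m = lcoef e' m /\ same_coefs e e' m else True.

Lemma leval_coef env e :
  leval env e = \sum_(i < size env) lcoef e i *: nth 0 env i.
Proof.
elim: e => [n||a iha b ihb|a iha|c a iha] /=.
- have [ns|ns] := ltnP n (size env).
    rewrite (bigD1 (Ordinal ns))//= (_ : eqn n n)//; last exact: (eqxx n).
    rewrite scale1r big1 ?addr0// => i; rewrite -val_eqE/= => ni.
    by rewrite (_ : eqn n i = false) ?scale0r//; exact/negbTE/(contra_neq esym ni).
  rewrite nth_default// big1// => i _.
  rewrite (_ : eqn n i = false) ?scale0r//; apply/negbTE.
  by apply/eqP => ni; move: (ltn_ord i); rewrite -ni ltnNge ns.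
- by rewrite big1// => i _; rewrite scale0r.
- by rewrite iha ihb -big_split/=; apply: eq_bigr => i _; rewrite scalerDl.
- by rewrite iha -sumrN; apply: eq_bigr => i _; rewrite scaleNr.
- by rewrite iha scaler_sumr; apply: eq_bigr => i _; rewrite scalerA.
Qed.

Lemma leval_eq env e e' :
  same_coefs e e' (size env) -> leval env e = leval env e'.
Proof.
move=> h; rewrite !leval_coef; apply: eq_bigr => -[i /= ilt] _; congr (_ *: _).
elim: (size env) h ilt => // n ih /= [h1 h2]; rewrite ltnS leq_eqVlt.
by move=> /orP[/eqP->//|]; exact: ih.
Qed.

End linear_expressions.

Ltac lmod_index x env :=
  lazymatch env with
  | x :: _ => constr:(0%N)
  | _ :: ?l => let n := lmod_index x l in constr:(S n)
  end.

Ltac lmod_atoms env t :=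
  lazymatch t with
  | (?x + ?y)%R => let env := lmod_atoms env x in lmod_atoms env y
  | (- ?x)%R => lmod_atoms env x
  | (_ *: ?x)%R => lmod_atoms env x
  | 0%R => env
  | _ => lazymatch env with
         | context [t :: _] => env
         | _ => constr:(t :: env)
         end
  end.

Ltac lmod_reify R env t :=
  lazymatch t with
  | (?x + ?y)%R => let a := lmod_reify R env x in
                   let b := lmod_reify R env y in constr:(LAdd a b)
  | (- ?x)%R => let a := lmod_reify R env x in constr:(LOpp a)
  | (?c *: ?x)%R => let a := lmod_reify R env x in constr:(@LScale R c a)
  | 0%R => constr:(@LZero R)
  | _ => let n := lmod_index t env in constr:(@LAtom R n)
  end.

(** Decides linear identities between vectors, by comparing with [ring] the
    coefficients of both sides on the vectors that they are built from. *)
Ltac lmod R :=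
  lazymatch goal with
  | |- @eq ?T ?x ?y =>
    let env := lmod_atoms (@nil T) x in
    let env := lmod_atoms env y in
    let a := lmod_reify R env x in
    let b := lmod_reify R env y in
    refine (@leval_eq R _ env a b _);
    cbn [same_coefs lcoef eqn size]; repeat split; ring
  end.

(** * Derivatives along subsets of the line *)

Section derivative_along_sets.
Context (R : realType).
Implicit Types V W : normedModType R.

Lemma ler_div_absorb (a x : R) : 0 <= a -> 0 <= x -> a / (x + 1) * x <= a.
Proof.
move=> a0 x0; have x1 : 0 < x + 1 by rewrite ltr_wpDl.
by rewrite mulrAC ler_pdivrMr// ler_wpM2l// lerDl.
Qed.

Definition contd V (I : set R) (u : R -> V) (t : R) : Prop :=
  forall e : R, 0 < e -> exists2 d : R, 0 < d &
    forall s, I s -> `|s - t| < d -> `|u s - u t| <= e.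

(** The difference quotient is cleared of its denominator: this makes sense at the
    end points of an interval, and it is the form in which estimates use it. *)
Definition hasd V (I : set R) (u : R -> V) (t : R) (v : V) : Prop :=
  forall e : R, 0 < e -> exists2 d : R, 0 < d &
    forall s, I s -> `|s - t| < d -> `|u s - u t - (s - t) *: v| <= e * `|s - t|.

Definition frechet V W (f L : V -> W) (x : V) : Prop :=
  forall e : R, 0 < e -> exists2 d : R, 0 < d & forall y, `|y - x| <= d ->
    `|f y - f x - L (y - x)| <= e * `|y - x|.

Lemma contd_cst V I (c : V) t : contd I (cst c : R -> V) t.
Proof. by move=> e e0; exists 1 => // s _ _; rewrite subrr normr0 ltW. Qed.

Definition vanishes (I : set R) (t : R) (phi : R -> R) : Prop :=
  forall e : R, 0 < e -> exists2 d : R, 0 < d &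
    forall s, I s -> `|s - t| < d -> phi s <= e.

Lemma vanishes_contd V I (u : R -> V) t :
  contd I u t -> vanishes I t (fun s => `|u s - u t|).
Proof. by []. Qed.

Lemma vanishesD I t phi psi : vanishes I t phi -> vanishes I t psi ->
  vanishes I t (fun s => phi s + psi s).
Proof.
move=> vphi vpsi e e0; have e2 : 0 < e / 2 by rewrite divr_gt0.
have [d d0 h] := vphi _ e2; have [d' d'0 h'] := vpsi _ e2.
exists (Num.min d d') => [|s Is]; first by rewrite lt_min d0.
by rewrite lt_min => /andP[/(h s Is) + /(h' s Is)]; lra.
Qed.

Lemma vanishesZ I t phi K : 0 <= K -> vanishes I t phi ->
  vanishes I t (fun s => K * phi s).
Proof.
move=> K0 vphi e e0; have K1 : 0 < K + 1 by rewrite ltr_wpDl.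
have [d d0 h] := vphi _ (divr_gt0 e0 K1); exists d => // s Is sd.
apply: le_trans (ler_wpM2l K0 (h s Is sd)) _.
by rewrite mulrC; apply: ler_div_absorb => //; exact: ltW.
Qed.

Lemma contd_by V I (u : R -> V) t phi : vanishes I t phi ->
  (forall s, `|u s - u t| <= phi s) -> contd I u t.
Proof. by move=> vphi up e /vphi[d d0 h]; exists d => // s Is /(h s Is); exact: le_trans. Qed.

Lemma contdD V I (u w : R -> V) t : contd I u t -> contd I w t ->
  contd I (fun s => u s + w s) t.
Proof.
move=> cu cw; apply: contd_by (vanishesD (vanishes_contd cu) (vanishes_contd cw)) _ => s.
by rewrite opprD addrACA; exact: ler_normD.
Qed.

Lemma contd_lip V W I (u : R -> V) (w : R -> W) (K : R) t : 0 <= K ->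
  (forall s, `|w s - w t| <= K * `|u s - u t|) -> contd I u t -> contd I w t.
Proof. by move=> K0 hw /vanishes_contd/(vanishesZ K0)/contd_by; apply. Qed.

Lemma contdM V I (g : R -> R^o) (u : R -> V) t : contd I g t -> contd I u t ->
  contd I (fun s => g s *: u s) t.
Proof.
move=> cg cu e e0; have g1 : 0 <= `|g t| + 1 by rewrite addr_ge0.
have [d1 d10 k1] := cg 1 ltr01.
have [d2 d20 k2] := vanishesD (vanishesZ (normr_ge0 (u t)) (vanishes_contd cg))
  (vanishesZ g1 (vanishes_contd cu)) e0.
exists (Num.min d1 d2) => [|s Is]; first by rewrite lt_min d10.
rewrite lt_min => /andP[/(k1 s Is) s1 /(k2 s Is)]; apply: le_trans.
rewrite (_ : _ - _ = (g s - g t) *: u t + g s *: (u s - u t)); last by lmod R.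
apply: (le_trans (ler_normD _ _)); rewrite 2!(@normrZ _ V) [X in X + _]mulrC lerD2l.
by apply: ler_wpM2r => //; have := lerB_dist (g s) (g t); lra.
Qed.

Lemma contd_sub V (I J : set R) (u : R -> V) t :
  J `<=` I -> contd I u t -> contd J u t.
Proof. by move=> JI cu e /cu[d d0 h]; exists d => // s /JI; exact: h. Qed.

Lemma hasd_sub V (I J : set R) (u : R -> V) t v :
  J `<=` I -> hasd I u t v -> hasd J u t v.
Proof. by move=> JI cu e /cu[d d0 h]; exists d => // s /JI; exact: h. Qed.

Lemma hasd_eq V (I : set R) (u w : R -> V) t v :
  I t -> (forall s, I s -> u s = w s) -> hasd I u t v -> hasd I w t v.
Proof.
move=> It uw cu e /cu[d d0 h]; exists d => // s Is sd.
by rewrite -!uw//; exact: h.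
Qed.

Lemma hasd_cst V I (c : V) t : hasd I (cst c) t 0.
Proof.
move=> e e0; exists 1 => // s _ _ /=.
by rewrite subrr scaler0 subrr normr0 mulr_ge0// ltW.
Qed.

Lemma hasd_id I t : hasd I (id : R -> R^o) t 1.
Proof.
move=> e e0; exists 1 => // s _ _ /=.
by rewrite -[_ *: _]/(_ * _) mulr1 subrr normr0 mulr_ge0// ltW.
Qed.

Lemma hasdD V I (u w : R -> V) t v v' :
  hasd I u t v -> hasd I w t v' -> hasd I (fun s => u s + w s) t (v + v').
Proof.
move=> hu hw e e0.
have e2 : 0 < e / 2 by rewrite divr_gt0.
have [d d0 hd] := hu _ e2; have [d' d'0 hd'] := hw _ e2.
exists (Num.min d d') => [|s Is]; first by rewrite lt_min d0.
rewrite lt_min => /andP[sd sd'].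
rewrite (_ : _ - _ - _ = (u s - u t - (s - t) *: v)
  + (w s - w t - (s - t) *: v')); last first.
  by rewrite scalerDr opprD; rewrite (addrACA (u s)) (addrACA (u s - u t)) -opprD.
apply: (le_trans (ler_normD _ _)).
have := lerD (hd s Is sd) (hd' s Is sd'); lra.
Qed.

Lemma hasdZ V I (u : R -> V) t v (c : R) :
  hasd I u t v -> hasd I (fun s => c *: u s) t (c *: v).
Proof.
move=> hu e e0; have c1 : 0 < `|c| + 1 by rewrite ltr_wpDl.
have [d d0 hd] := hu (e / (`|c| + 1)) (divr_gt0 e0 c1).
exists d => // s Is sd.
rewrite -scalerBr (scalerA _ c) mulrC -scalerA -scalerBr normrZ.
apply: le_trans (ler_wpM2l (normr_ge0 c) (hd s Is sd)) _.
by rewrite mulrA (mulrC `|c|) ler_wpM2r// ler_div_absorb// ltW.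
Qed.

Lemma hasdN V I (u : R -> V) t v :
  hasd I u t v -> hasd I (fun s => - u s) t (- v).
Proof.
move=> /(hasdZ (-1)); rewrite scaleN1r.
by rewrite (_ : (fun s => _) = (fun s => - u s))//; apply/funext => s; rewrite scaleN1r.
Qed.

Lemma hasdB V I (u w : R -> V) t v v' :
  hasd I u t v -> hasd I w t v' -> hasd I (fun s => u s - w s) t (v - v').
Proof. by move=> hu hw; apply: hasdD => //; exact: hasdN. Qed.

Lemma hasd_near V I (u : R -> V) t v : hasd I u t v ->
  exists2 d : R, 0 < d & forall s, I s -> `|s - t| < d ->
    `|u s - u t| <= (`|v| + 1) * `|s - t|.
Proof.
move=> /(_ 1 ltr01)[d d0 h]; exists d => // s Is sd.
rewrite -(subrK ((s - t) *: v) (u s - u t)).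
apply: (le_trans (ler_normD _ _)); rewrite normrZ.
have := h s Is sd; lra.
Qed.

Lemma hasd_contd V I (u : R -> V) t v : hasd I u t v -> contd I u t.
Proof.
move=> /hasd_near[d d0 h] e e0; have c1 : 0 < `|v| + 1 by rewrite ltr_wpDl.
exists (Num.min d (e / (`|v| + 1))) => [|s Is].
  by rewrite lt_min d0/= divr_gt0.
rewrite lt_min => /andP[sd]; rewrite ltr_pdivlMr// => sd'.
by apply: le_trans (h s Is sd) _; rewrite mulrC ltW.
Qed.

Lemma hasdM V I (g : R -> R^o) (u : R -> V) t (g' : R) v :
  hasd I g t g' -> hasd I u t v ->
  hasd I (fun s => g s *: u s) t (g' *: u t + g t *: v).
Proof.
move=> hg hu e e0.
have u1 : 0 < `|u t| + 1 by rewrite ltr_wpDl.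
have v1 : 0 < `|v| + 1 by rewrite ltr_wpDl.
have g1 : 0 < `|g t| + 1 by rewrite ltr_wpDl.
have [d1 d10 h1] := hg _ (divr_gt0 (divr_gt0 e0 (@ltr0n R 3)) u1).
have [d2 d20 h2] := hu _ (divr_gt0 (divr_gt0 e0 (@ltr0n R 3)) g1).
have [d3 d30 h3] := hasd_near hu.
have [d4 d40 h4] := hasd_contd hg (divr_gt0 (divr_gt0 e0 (@ltr0n R 3)) v1).
exists (Num.min (Num.min d1 d2) (Num.min d3 d4)) => [|s Is].
  by rewrite !lt_min d10 d20 d30 d40.
rewrite !lt_min => /andP[/andP[s1 s2] /andP[s3 s4]].
rewrite (_ : _ - _ - _ = (g s - g t - (s - t) * g') *: u t
   + g t *: (u s - u t - (s - t) *: v) + (g s - g t) *: (u s - u t)); last first.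
    by lmod R.
apply: (le_trans (ler_normD _ _)).
apply: (le_trans (lerD (ler_normD _ _) (lexx _))); rewrite !normrZ.
rewrite (_ : e * `|s - t| = e / 3 * `|s - t| + e / 3 * `|s - t| + e / 3 * `|s - t|);
  last by field.
apply: lerD; first apply: lerD.
- have h1' := h1 s Is s1.
  apply: le_trans (ler_wpM2r (normr_ge0 _) h1') _.
  by rewrite mulrAC ler_wpM2r// ler_div_absorb// divr_ge0// ltW.
- apply: le_trans (ler_wpM2l (normr_ge0 _) (h2 s Is s2)) _.
  by rewrite mulrA (mulrC `|g t|) ler_wpM2r// ler_div_absorb// divr_ge0// ltW.
- apply: le_trans (ler_pM (normr_ge0 _) (normr_ge0 _) (h4 s Is s4) (h3 s Is s3)) _.
  by rewrite mulrA divfK ?gt_eqF.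
Qed.

Lemma linear_sub V W (f : V -> W) :
  (forall c x y, f (c *: x + y) = c *: f x + f y) -> forall x y, f (x - y) = f x - f y.
Proof.
move=> lin x y; rewrite (_ : x - y = (-1) *: y + x); last by lmod R.
by rewrite lin; lmod R.
Qed.

Lemma frechet_of_uniform V W (f : V -> W) (f' : V -> V -> W) v :
  (forall e : R, 0 < e -> exists2 d : R, 0 < d & forall v x, `|x| <= d ->
     `|f (v + x) - f v - f' v x| <= e * `|x|) ->
  frechet f (f' v) v.
Proof.
move=> rem e /rem[d d0 h]; exists d => // y yd.
by have := h v (y - v) yd; rewrite subrKC.
Qed.

(** Expanding [f (v + y + x)] around [v] and around [v + y] compares the derivatives
    at these two points, provided the remainder is uniform in the base point. *)
Lemma uniform_derivative_cont V W (f : V -> W) (f' : V -> V -> W) :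
  (forall v c x y, f' v (c *: x + y) = c *: f' v x + f' v y) ->
  (forall e : R, 0 < e -> exists2 d : R, 0 < d & forall v x, `|x| <= d ->
     `|f (v + x) - f v - f' v x| <= e * `|x|) ->
  forall e : R, 0 < e -> exists2 d : R, 0 < d & forall v y, `|y| <= d -> forall x,
    `|f' (v + y) x - f' v x| <= e * `|x|.
Proof.
move=> lin rem e e0; have e4 : 0 < e / 4 by rewrite divr_gt0.
have [d d0 h] := rem _ e4; have d2 : 0 < d / 2 by rewrite divr_gt0.
exists (d / 2) => // v y yd.
have small x : `|x| = d / 2 -> `|f' (v + y) x - f' v x| <= e * `|x|.
  move=> xd; have yx : `|y + x| <= d by apply: (le_trans (ler_normD _ _)); lra.
  have h1 := h v (y + x) yx; have h2 := h v y (ltac:(lra)).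
  have h3 := h (v + y) x (ltac:(lra)).
  rewrite (_ : _ - _ = (f (v + (y + x)) - f v - f' v (y + x)) - (f (v + y) - f v - f' v y)
    - (f (v + y + x) - f (v + y) - f' (v + y) x)); last first.
    have l1 : f' v (y + x) = f' v y + f' v x by have := lin v 1 y x; rewrite !scale1r.
    have a1 : f (v + (y + x)) = f (v + y + x) by rewrite addrA.
    by rewrite a1 l1; lmod R.
  apply: (le_trans (ler_normB _ _)); apply: (le_trans (lerD (ler_normB _ _) (lexx _))).
  have := ler_wpM2l (ltW e4) yx; have := ler_wpM2l (ltW e4) yd.
  by move: h1 h2 h3; rewrite xd; lra.
have f'0 w : f' w 0 = 0 by have := lin w (-1) 0 0; rewrite scaler0 addr0 scaleN1r addNr.
move=> x; have [->|x0] := eqVneq x 0; first by rewrite !f'0 subrr !normr0 mulr0.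
have nx : 0 < `|x| by rewrite normr_gt0.
pose c := d / 2 / `|x|; have c0 : 0 < c by rewrite divr_gt0.
have linZ w : f' w (c *: x) = c *: f' w x by have := lin w c x 0; rewrite !addr0 f'0 addr0.
have cx : c * `|x| = d / 2 by rewrite /c divfK ?gt_eqF.
have nZ (U : normedModType R) (u : U) : `|c *: u| = c * `|u|.
  by rewrite normrZ (gtr0_norm c0).
have := small (c *: x); rewrite !linZ -scalerBr nZ nZ => /(_ cx).
by rewrite mulrCA ler_pM2l.
Qed.

Lemma hasd_comp V W I (u : R -> V) (f L : V -> W) t v K :
  (forall c x y, L (c *: x + y) = c *: L x + L y) ->
  (forall x, `|L x| <= K * `|x|) ->
  frechet f L (u t) ->
  hasd I u t v -> hasd I (f \o u) t (L v).
Proof.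
move=> linL LK df hu e e0.
have v1 : 0 < `|v| + 1 by rewrite ltr_wpDl.
have K1 : 0 < `|K| + 1 by rewrite ltr_wpDl.
have [d1 d10 h1] := df _ (divr_gt0 (divr_gt0 e0 (@ltr0n R 2)) v1).
have [d2 d20 h2] := hu _ (divr_gt0 (divr_gt0 e0 (@ltr0n R 2)) K1).
have [d3 d30 h3] := hasd_near hu.
have [d4 d40 h4] := hasd_contd hu d10.
exists (Num.min d2 (Num.min d3 d4)) => [|s Is].
  by rewrite !lt_min d20 d30 d40.
rewrite !lt_min => /andP[s2 /andP[s3 s4]] /=.
rewrite (_ : _ - _ - _ = (f (u s) - f (u t) - L (u s - u t))
  + L (u s - u t - (s - t) *: v)); last first.
  rewrite (_ : u s - u t - _ = (- (s - t)) *: v + (u s - u t)); last by lmod R.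
  by rewrite linL; lmod R.
apply: (le_trans (ler_normD _ _)).
rewrite (_ : e * `|s - t| = e / 2 * `|s - t| + e / 2 * `|s - t|); last by field.
apply: lerD.
  apply: le_trans (h1 _ (h4 s Is s4)) _.
  apply: le_trans (ler_wpM2l _ (h3 s Is s3)) _.
    by rewrite !divr_ge0 ?(ltW v1) ?(ltW e0).
  by rewrite mulrA divfK ?gt_eqF.
apply: le_trans (LK _) _.
apply: le_trans (_ : _ <= (`|K| + 1) * `|u s - u t - (s - t) *: v|) _.
  by rewrite ler_wpM2r// (le_trans (ler_norm _))// lerDl.
apply: le_trans (ler_wpM2l (ltW K1) (h2 s Is s2)) _.
by rewrite mulrA (mulrC (`|K| + 1)) divfK ?gt_eqF.
Qed.

Lemma hasd_shift V (u : R -> V) (a t : R) v :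
  hasd setT u (t + a) v -> hasd setT (fun s => u (s + a)) t v.
Proof.
move=> hu e /hu[d d0 h]; exists d => // s _ sd.
by have := h (s + a) I; rewrite (_ : s + a - (t + a) = s - t); [apply|ring].
Qed.

Lemma pair_norm_le V W (v : V) (w : W) (B : R) : `|v| <= B -> `|w| <= B -> `|(v, w)| <= B.
Proof. by move=> vB wB; rewrite prod_normE ge_max vB. Qed.

Lemma fst_norm_le V W (q : V * W) : `|q.1| <= `|q|.
Proof. by rewrite [leRHS]prod_normE le_max lexx. Qed.

Lemma snd_norm_le V W (q : V * W) : `|q.2| <= `|q|.
Proof. by rewrite [leRHS]prod_normE le_max lexx orbT. Qed.

Lemma lt_both (d d' : R) : 0 < d -> 0 < d' ->
  exists2 k : R, 0 < k & k < d /\ k < d'.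
Proof.
move=> d0 d'0; have m0 : 0 < Num.min d d' by rewrite lt_min d0.
exists (Num.min d d' / 2); first by rewrite divr_gt0.
by apply/andP; rewrite -lt_min ltr_pdivrMr// mulr_natr mulr2n ltrDl.
Qed.

(** Used at time 0, which a curve on (-oo, 0] approaches from the left only. *)
Lemma hasd_unique_left V (u : R -> V) t v v' :
  hasd `]-oo, t]%classic u t v -> hasd `]-oo, t]%classic u t v' -> v = v'.
Proof.
move=> hu hu'; apply/eqP; rewrite -subr_eq0 -normr_le0.
apply/ler_addgt0Pr => e e0; rewrite add0r.
have e2 : 0 < e / 2 by rewrite divr_gt0.
have [d d0 h] := hu _ e2; have [d' d'0 h'] := hu' _ e2.
have [k k0 [kd kd']] := lt_both d0 d'0.
have It : `]-oo, t]%classic (t - k) by rewrite /= in_itv/= gerBl ltW.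
have nk : `|t - k - t| = k by rewrite addrAC subrr add0r normrN gtr0_norm.
have := h _ It; have := h' _ It; rewrite nk => /(_ kd') h1 /(_ kd) h2.
rewrite -(ler_pM2l k0) -[X in X * `|_|](gtr0_norm k0) -normrZ.
rewrite (_ : k *: (v - v') = (u (t - k) - u t - (t - k - t) *: v)
  - (u (t - k) - u t - (t - k - t) *: v')); last by lmod R.
apply: (le_trans (ler_normB _ _)); lra.
Qed.

End derivative_along_sets.

(** * Mean value inequalities *)

Section comparison.
Context (R : realType).
Implicit Types V : normedModType R.

Lemma deriv_within_hasd V (I : set R) (u : R -> V) t v :
  deriv_within I u t v -> hasd I u t v.
Proof.
move=> /cvgrPdist_le du e e0; have := du _ e0.
rewrite -[X in X -> _]/(nbhs _ _).
move=> /nbhs_ballP[d /= d0 h]; exists d => // s Is sd.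
have [->|st] := eqVneq s t.
  by rewrite !subrr scale0r subr0 !normr0 mulr0.
have st0 : s - t != 0 by rewrite subr_eq0.
have := h (s - t); rewrite /ball/= sub0r normrN => /(_ sd st0).
rewrite subrKC => /(_ Is) h1.
rewrite (_ : _ - _ = (s - t) *: ((s - t)^-1 *: (u s - u t) - v)); last first.
  by rewrite scalerBr scalerA mulfV// scale1r.
by rewrite normrZ mulrC ler_wpM2r// distrC.
Qed.

Lemma is_derive_hasd V (u : R -> V) (t : R) v I :
  is_derive t (1 : R) u v -> hasd I u t v.
Proof.
move=> [du dv]; apply: (@hasd_sub _ _ setT) => //.
apply: deriv_within_hasd; rewrite /deriv_within.
have : derivable u t 1 by [].
rewrite /derivable => /cvg_ex[l cl]; have lv : l = v.
  by rewrite -dv; apply/esym/cvg_lim.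
rewrite -lv => A /cl /= [d d0 h]; exists d => // s sd st _.
have := h s sd st; rewrite /preimage /mkset.
by rewrite (_ : s%:A = s) 1?(addrC s)// -[LHS]/(_ * _) mulr1.
Qed.

(** Real induction: the supremum of the times up to which [phi] is nonnegative is
    attained by continuity, and [step] pushes it further unless it is [b]. *)
Lemma nonneg_propagates (phi : R -> R) (a b : R) :
  (forall t, a <= t <= b -> contd `[a, b]%classic (phi : R -> R^o) t) ->
  0 <= phi a ->
  (forall t, a <= t < b -> 0 <= phi t -> exists2 d : R, 0 < d &
     forall s, t < s < t + d -> s <= b -> 0 <= phi s) ->
  forall t, a <= t <= b -> 0 <= phi t.
Proof.
move=> cphi phia step t1 /andP[at1 t1b]; rewrite leNgt; apply/negP => phit1.
pose S := [set s | a <= s <= t1 /\ forall q, a <= q <= s -> 0 <= phi q].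
have Sa : S a by split=> [|q]; [rewrite lexx | rewrite -eq_le => /eqP<-].
have Sub : has_ubound S by exists t1 => s [/andP[_]].
have supS : has_sup S by split => //; exists a.
have ac : a <= sup S by exact: ub_le_sup.
have ct : sup S <= t1 by apply: ge_sup => [|s [/andP[_]]//]; exists a.
have below q : a <= q < sup S -> 0 <= phi q.
  move=> /andP[aq qc].
  have [s [_ hs] qs] := @sup_adherent _ S (sup S - q) (ltac:(by rewrite subr_gt0)) supS.
  by apply: hs; rewrite aq ltW//; move: qs; rewrite opprB addrC subrK.
have phic : 0 <= phi (sup S).
  have [<-//|/eqP nac] := eqVneq a (sup S).
  have {}ac : a < sup S by rewrite lt_neqAle ac andbT; apply/eqP.
  apply/ler_addgt0Pr => e e0.
  have [d d0 h] := cphi (sup S) (ltac:(by rewrite (ltW ac) (le_trans ct t1b))) e e0.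
  have [k k0 [kd ka]] : exists2 k, 0 < k & k < d /\ a <= sup S - k.
    exists (Num.min (d / 2) (sup S - a)); first by rewrite lt_min divr_gt0// subr_gt0.
    split; first by rewrite gt_min ltr_pdivrMr// mulr_natr mulr2n ltrDl d0.
    by rewrite lerBrDl -lerBrDr ge_min lexx orbT.
  have := h (sup S - k); rewrite /= in_itv/= ka/= (_ : sup S - k <= b); last first.
    by rewrite lerBlDr (le_trans ct)// (le_trans t1b)// lerDl ltW.
  rewrite (_ : sup S - k - sup S = - k); last by ring.
  rewrite normrN gtr0_norm// => /(_ isT kd) hk.
  have h2 := below (sup S - k) (ltac:(by rewrite ka gtrBl k0)).
  by rewrite ler_norml in hk; lra.
have ct' : sup S < t1.
  rewrite lt_neqAle ct andbT; apply/eqP => ce; move: phit1.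
  by rewrite -ce ltNge phic.
have [d d0 h] := step (sup S) (ltac:(by rewrite ac (lt_le_trans ct'))) phic.
pose s := Num.min (sup S + d / 2) t1.
have cs : sup S < s by rewrite lt_min ct' ltrDl divr_gt0.
have sd : s < sup S + d.
  by rewrite gt_min ltrD2l ltr_pdivrMr// mulr_natr mulr2n ltrDl d0.
have : S s.
  split=> [|q /andP[aq qs]]; first by rewrite (le_trans ac (ltW cs))/= ge_min lexx orbT.
  have [qc|] := ltP q (sup S); first by apply: below; rewrite aq.
  rewrite le_eqVlt => /orP[/eqP<-//|cq].
  apply: h; first by rewrite cq (le_lt_trans qs).
  by rewrite (le_trans qs)// ge_min t1b orbT.
by move=> /(ub_le_sup Sub); rewrite leNgt cs.
Qed.

Lemma contd_minus_norm V (I : set R) (g : R -> R) (u : R -> V) t :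
  contd I (g : R -> R^o) t -> contd I u t ->
  contd I ((fun s => g s - `|u s|) : R -> R^o) t.
Proof.
move=> cg cu; apply: contd_by (vanishesD (vanishes_contd cg) (vanishes_contd cu)) _ => s.
rewrite (_ : _ - _ - _ = (g s - g t) - (`|u s| - `|u t|)); last by ring.
apply: (le_trans (ler_normB _ _)); rewrite lerD2l; exact: ler_dist_dist.
Qed.

(** Nonnegativity of [g s - g a + e (s - a) - `|u s - u a|] propagates to the right.
    Only quotients from the right enter, so that [u] may be piecewise smooth. *)
Lemma mean_value V (u : R -> V) (g : R -> R) (a b : R) : a <= b ->
  (forall t, a <= t <= b -> contd `[a, b]%classic u t) ->
  (forall t, a <= t <= b -> contd `[a, b]%classic (g : R -> R^o) t) ->
  (forall t e, a <= t < b -> 0 < e -> exists2 d : R, 0 < d &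
     forall s, t < s < t + d -> s <= b ->
       `|u s - u t| <= g s - g t + e * (s - t)) ->
  `|u b - u a| <= g b - g a.
Proof.
move=> ab cu cg step; apply/ler_addgt0Pr => e e0.
pose e' := e / (b - a + 1).
have ba1 : 0 < b - a + 1 by rewrite ltr_wpDl// subr_ge0.
have e'0 : 0 < e' by rewrite divr_gt0.
pose phi s := g s - g a + e' * (s - a) - `|u s - u a|.
suff /(_ b) : forall t, a <= t <= b -> 0 <= phi t.
  rewrite lexx ab => /(_ isT); rewrite /phi subr_ge0 => h; apply: (le_trans h).
  rewrite lerD2l; apply: ler_div_absorb; rewrite ?subr_ge0//; exact: ltW.
apply: nonneg_propagates.
- move=> t tab; apply: contd_minus_norm.
  + have ce : contd `[a, b]%classic ((fun s => e' * (s - a)) : R -> R^o) t.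
      apply: (@contd_lip _ R^o R^o _ id _ e') (hasd_contd (hasd_id _ _)); first exact: ltW.
      by move=> s; rewrite -mulrBr normrM gtr0_norm// opprB addrA subrK.
    have := contdD (cg t tab) ce; apply: (@contd_lip _ R^o R^o _ _ _ 1) => // s.
    by rewrite mul1r le_eqVlt; apply/orP; left; apply/eqP; congr `|_|; ring.
  + move=> e1 e10; have [d d0 h] := cu t tab _ e10; exists d => // s Is sd.
    by rewrite (_ : _ - _ - _ = u s - u t); [exact: h | lmod R].
- by rewrite /phi !subrr mulr0 normr0 addr0 subr0.
- move=> t tab; rewrite /phi => h0; have [d d0 h] := step t e' tab e'0.
  exists d => // s std sb; have := h s std sb.
  have := ler_distD (u t) (u s) (u a); lra.
Qed.

Lemma mean_value_hasd V (u u' : R -> V) (g g' : R -> R) (a b : R) : a <= b ->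
  (forall t, a <= t <= b -> hasd `[a, b]%classic u t (u' t)) ->
  (forall t, a <= t <= b -> hasd `[a, b]%classic (g : R -> R^o) t (g' t)) ->
  (forall t, a <= t <= b -> `|u' t| <= g' t) ->
  `|u b - u a| <= g b - g a.
Proof.
move=> ab du dg ug; apply: mean_value => //.
- by move=> t tab; exact: hasd_contd (du t tab).
- by move=> t tab; exact: hasd_contd (dg t tab).
move=> t e /andP[at_ tb] e0; have tab : a <= t <= b by rewrite at_ ltW.
have e2 : 0 < e / 2 by rewrite divr_gt0.
have [d d0 h] := du t tab _ e2; have [d' d'0 h'] := dg t tab _ e2.
exists (Num.min d d') => [|s]; first by rewrite lt_min d0.
move=> /andP[ts]; rewrite -ltrBlDl lt_min => /andP[sd sd'] sb.
have Is : `[a, b]%classic s by rewrite /= in_itv/= sb (le_trans at_ (ltW ts)).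
have st : `|s - t| = s - t by rewrite gtr0_norm// subr_gt0.
have := h s Is; have := h' s Is; rewrite st => /(_ sd') h1 /(_ sd) h2.
rewrite -(subrK ((s - t) *: u' t) (u s - u t)).
apply: (le_trans (ler_normD _ _)); rewrite normrZ st.
have st0 : 0 <= s - t by rewrite subr_ge0 ltW.
have h3 := ler_wpM2l st0 (ug t tab).
move: h1; rewrite ler_norml => /andP[h1 _]; rewrite -[_ *: _]/(_ * _) in h1.
lra.
Qed.

End comparison.

(** * Gronwall's inequality *)

Section gronwall.
Context (R : realType).
Implicit Types V : normedModType R.

Lemma is_derive_expRM (c t : R) :
  is_derive t (1 : R) (fun s => expR (c * s)) (c * expR (c * t)).
Proof.
have -> : (fun s => expR (c * s)) = expR \o ( *%R c) by [].
by apply: is_derive_eq; rewrite -[c%:A]/(c * 1) mulr1 mulrC.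
Qed.

Lemma hasd_expRM (I : set R) (c t : R) :
  hasd I ((fun s => expR (c * s)) : R -> R^o) t (c * expR (c * t)).
Proof. exact/is_derive_hasd/is_derive_expRM. Qed.

Lemma hasdZl (I : set R) (g : R -> R) t g' (c : R) :
  hasd I (g : R -> R^o) t g' -> hasd I ((fun s => c * g s) : R -> R^o) t (c * g').
Proof. by move=> h; exact: (@hasdZ R R^o I g t g' c h). Qed.

(** Adding [e * exp ((K + 1) t)] to the supersolution [g] makes its differential
    inequality strict, after which a first crossing time is impossible. *)
Lemma gronwall V (u u' : R -> V) (g g' m : R -> R) (K a b : R) : 0 <= K ->
  (forall t, a <= t <= b -> hasd `[a, b]%classic u t (u' t)) ->
  (forall t, a <= t <= b -> hasd `[a, b]%classic (g : R -> R^o) t (g' t)) ->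
  (forall t, a <= t <= b -> `|u' t| <= K * `|u t| + m t) ->
  (forall t, a <= t <= b -> K * g t + m t <= g' t) ->
  `|u a| <= g a ->
  forall t, a <= t <= b -> `|u t| <= g t.
Proof.
move=> K0 du dg ud gd ua t tab; apply/ler_addgt0Pr => e0 e00.
pose E s : R := expR ((K + 1) * s).
have E0 s : 0 < E s by exact: expR_gt0.
have [e e_gt0 ->] : exists2 e : R, 0 < e & e0 = e * E t.
  by exists (e0 / E t); rewrite ?divr_gt0// divfK ?gt_eqF.
rewrite -subr_ge0.
have dG s : a <= s <= b -> hasd `[a, b]%classic ((fun s => g s + e * E s) : R -> R^o) s
    (g' s + e * ((K + 1) * E s)).
  move=> sab; apply: (@hasdD _ R^o) (dg s sab) _.
  exact/hasdZl/hasd_expRM.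
apply: (@nonneg_propagates _ (fun s => g s + e * E s - `|u s|) a b) tab.
- move=> s sab; apply: contd_minus_norm; [exact: hasd_contd (dG s sab)|].
  exact: hasd_contd (du s sab).
- by rewrite subr_ge0 (le_trans ua)// lerDl mulr_ge0// ltW.
move=> s /andP[as_ sb]; rewrite subr_ge0 => us.
have sab : a <= s <= b by rewrite as_ ltW.
pose eta := e * E s / 3; have eta0 : 0 < eta by rewrite divr_gt0// mulr_gt0.
have [d d0 h] := du s sab _ eta0; have [d' d'0 h'] := dG s sab _ eta0.
have [k k0 [kd kd']] := lt_both d0 d'0; exists k => // r.
rewrite -ltrBlDl => /andP[sr rk] rb.
have Ir : `[a, b]%classic r by rewrite /= in_itv/= rb (le_trans as_ (ltW sr)).
have rs : `|r - s| = r - s by rewrite gtr0_norm// subr_gt0.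
have rs0 : 0 < r - s by rewrite subr_gt0.
have := h r Ir; have := h' r Ir; rewrite rs.
move=> /(_ (lt_trans rk kd')); rewrite ler_norml => /andP[h1 _] /(_ (lt_trans rk kd)) h2.
rewrite -[_ *: _]/(_ * _) in h1.
have h3 : `|u r| <= `|u s| + (`|u' s| + eta) * (r - s).
  rewrite [u r](_ : _ = u s + ((u r - u s - (r - s) *: u' s) + (r - s) *: u' s));
    last by lmod R.
  apply: (le_trans (ler_normD _ _)); rewrite lerD2l.
  by apply: (le_trans (ler_normD _ _)); rewrite normrZ rs; lra.
rewrite subr_ge0; apply: le_trans h3 _.
have h4 : `|u' s| <= g' s + e * ((K + 1) * E s) - 3 * eta.
  rewrite /eta; have := ud s sab; have := gd s sab.
  have := ler_wpM2l K0 us; lra.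
have h5 : (`|u' s| + eta) * (r - s) <=
    (g' s + e * ((K + 1) * E s) - 2 * eta) * (r - s).
  by apply: ler_wpM2r; [exact: ltW|move: h4; set G' := g' s + _; lra].
have h6 : 0 < eta * (r - s) by rewrite mulr_gt0.
move: h1 h5 us h6.
set G' := g' s + _; lra.
Qed.

End gronwall.

(** * Primitives of continuous curves *)

(** Stated with sequences because the limits taken below are those of Picard
    iterates, Riemann sums and values at times going to -oo. *)
Definition seq_complete (R : realType) (V : normedModType R) : Prop :=
  forall u : nat -> V,
    (forall e : R, 0 < e -> exists N, forall m n, (N <= m)%N -> (N <= n)%N ->
       `|u m - u n| <= e) ->
    exists l : V, forall e : R, 0 < e -> exists N, forall n, (N <= n)%N ->
      `|u n - l| <= e.

Section primitives.
Context (R : realType).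
Implicit Types V : normedModType R.

Lemma near_unif_cont V (f : R -> V) (a b : R) : (forall t, contd setT f t) ->
  forall e : R, 0 < e -> exists2 d : R, 0 < d &
    forall t, a <= t <= b -> forall s, `|s - t| <= d -> `|f s - f t| <= e.
Proof.
move=> cf e e0.
have /compact_near_coveringP := @segment_compact R a b.
pose P (d t : R) := forall s, `|s - t| <= d -> `|f s - f t| <= e.
move=> /(_ R (0^'+) P _)[].
  move=> t _; have [d d0 h] := cf t _ (divr_gt0 e0 (@ltr0n R 2)).
  exists (ball t (d / 2), ball 0 (d / 2)) => /=.
    split; first by apply: nbhsx_ballx; rewrite divr_gt0.
    by exists (d / 2) => //=; rewrite divr_gt0.
  move=> [s k] /= [st kd] q qs.
  move: st kd; rewrite /ball/= sub0r normrN => st kd.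
  have kd' := le_lt_trans (ler_norm k) kd.
  rewrite distrC in st.
  have h1 := h s I (ltac:(lra)).
  have h2 := h q I (ltac:(apply: le_lt_trans (ler_distD s _ _) _; lra)).
  apply: le_trans (ler_distD (f t) _ _) _; rewrite (distrC (f t)); lra.
move=> d /= d0 h; exists (d / 2); first by rewrite divr_gt0.
move=> t tab; apply: (h (d / 2)) => //=; last by rewrite divr_gt0.
by rewrite /ball_/= sub0r normrN gtr0_norm ?divr_gt0// ltr_pdivrMr// mulr_natr mulr2n ltrDl.
Qed.

Section segment.
Variables (V : normedModType R) (f : R -> V) (a b : R).
Hypotheses (ab : a < b) (cf : forall t, contd setT f t).

Let x (n i : nat) : R := a + (b - a) / n.+1%:R * i%:R.

(** The primitive of the step function taking the value [f (x n i)] from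
    [x n i] to [x n i.+1]. *)
Let F (n : nat) (t : R) : V :=
  \sum_(i < n.+1) (Num.min t (x n i.+1) - Num.min t (x n i)) *: f (x n i).

Let xS n i : x n i.+1 = x n i + (b - a) / n.+1%:R.
Proof. by rewrite /x -(addn1 i) natrD mulrDr mulr1 addrA. Qed.

Let h0 n : 0 < (b - a) / n.+1%:R.
Proof. by rewrite divr_gt0// subr_gt0. Qed.

Let F_slope n (d e s t : R) :
  (forall s, a <= s <= b -> forall q, `|q - s| <= d -> `|f q - f s| <= e) ->
  (b - a) / n.+1%:R <= d -> a <= s -> s <= t -> t <= b -> t - s <= d ->
  `|F n t - F n s - (t - s) *: f s| <= e * (t - s).
Proof.
move=> ucf nd as_ st tb tsd.
pose c i := (Num.min t (x n i.+1) - Num.min t (x n i))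
  - (Num.min s (x n i.+1) - Num.min s (x n i)).
have cE i : c i = (Num.min t (x n i.+1) - Num.min s (x n i.+1))
  - (Num.min t (x n i) - Num.min s (x n i)) by rewrite /c; ring.
have csum : \sum_(i < n.+1) c i = t - s.
  under eq_bigr do rewrite cE.
  rewrite -(big_mkord xpredT (fun i => (Num.min t (x n i.+1) - Num.min s (x n i.+1))
    - (Num.min t (x n i) - Num.min s (x n i)))).
  rewrite (telescope_sumr (fun i => Num.min t (x n i) - Num.min s (x n i)))//.
  have -> : x n n.+1 = b by rewrite /x divfK ?pnatr_eq0// addrC subrK.
  have -> : x n 0 = a by rewrite /x mulr0 addr0.
  rewrite (min_l tb) (min_l (le_trans st tb)) (min_r as_) (min_r (le_trans as_ st)).
  by rewrite subrr subr0.
have c0 i : 0 <= c i.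
  rewrite cE subr_ge0; have := h0 n; rewrite xS; move: ((b - a) / _) => h hpos.
  rewrite /Order.min; case: ifPn; case: ifPn; case: ifPn; case: ifPn;
    rewrite -?leNgt; lra.
have cf0 i : c i != 0 -> `|x n i - s| <= d.
  move=> ci; have : x n i < t /\ s < x n i.+1.
    split; rewrite ltNge; apply: contra ci => xi; rewrite cE.
      have xi' : t <= x n i.+1 by rewrite xS (le_trans xi)// lerDl ltW.
      rewrite (min_l xi) (min_l (le_trans st xi)) (min_l xi').
      by rewrite (min_l (le_trans st xi')) subrr.
    have xi' : x n i <= s by rewrite (le_trans _ xi)// xS lerDl ltW.
    rewrite (min_r xi) (min_r (le_trans xi st)) (min_r xi').
    by rewrite (min_r (le_trans xi' st)) !subrr.
  rewrite xS => -[xt xs]; move: nd xt xs tsd; move: ((b - a) / _) => h.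
  rewrite ler_norml; lra.
rewrite (_ : _ - _ = \sum_(i < n.+1) c i *: (f (x n i) - f s)); last first.
  under [RHS]eq_bigr do rewrite scalerBr.
  rewrite big_split/= sumrN -scaler_suml csum; congr (_ - _).
  by rewrite /F -sumrB; apply: eq_bigr => i _; rewrite -scalerBl.
apply: (le_trans (ler_norm_sum _ _ _)).
rewrite -csum mulr_sumr; apply: ler_sum => i _; rewrite normrZ ger0_norm// mulrC.
have [->|/cf0 ci] := eqVneq (c i) 0; first by rewrite !mulr0.
by rewrite ler_wpM2r// ucf// as_ (le_trans st).
Qed.

Let F_cont n t : contd `[a, b]%classic (F n) t.
Proof.
pose C := \sum_(i < n.+1) 2 * `|f (x n i)|.
have FC s : `|F n s - F n t| <= C * `|s - t|.
  rewrite /F -sumrB (le_trans (ler_norm_sum _ _ _))// mulr_suml.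
  apply: ler_sum => i _; rewrite -scalerBl normrZ mulrAC ler_wpM2r//.
  have m y : `|Num.min s y - Num.min t y| <= `|s - t|.
    rewrite ler_norml; have := ler_norm (s - t); have := ler_norm (t - s).
    rewrite (distrC t) /Order.min; case: ifPn; case: ifPn; rewrite -?leNgt; lra.
  have := m (x n i); have := m (x n i.+1).
  rewrite (_ : forall p q r' s' : R, p - q - (r' - s') = (p - r') - (q - s')); last by move=> *; ring.
  have := ler_normB (Num.min s (x n i.+1) - Num.min t (x n i.+1))
    (Num.min s (x n i) - Num.min t (x n i)); lra.
have C0 : 0 <= C by apply: sumr_ge0 => i _; rewrite mulr_ge0.
by apply: (@contd_lip _ R^o _ _ id _ C) (hasd_contd (hasd_id _ _)).
Qed.

(** The primitives of the step functions interpolating [f] are uniformly Cauchy, by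
    uniform continuity of [f] and the mean value inequality. *)
Lemma primitive_segment : seq_complete V ->
  exists G : R -> V, forall t, a <= t <= b -> hasd `[a, b]%classic G t (f t).
Proof.
move=> cV.
have mesh d : 0 < d -> exists N, forall n, (N <= n)%N -> (b - a) / n.+1%:R <= d.
  move=> d0; exists (Num.trunc ((b - a) / d)) => n nN.
  rewrite ler_pdivrMr// mulrC -ler_pdivrMr// (le_trans (ltW (truncnS_gt _)))//.
  by rewrite ler_nat ltnS.
have cauchyF t : a <= t <= b -> exists l, forall e : R, 0 < e -> exists N, forall n,
    (N <= n)%N -> `|F n t - l| <= e.
  move=> /andP[at_ tb]; apply: cV => e e0.
  pose e' := e / 2 / (b - a + 1).
  have ba1 : 0 < b - a + 1 by rewrite ltr_wpDl// subr_ge0 ltW.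
  have e'0 : 0 < e' by rewrite !divr_gt0.
  have [d d0 ucf] := near_unif_cont a b cf e'0.
  have [N hN] := mesh d d0; exists N => m n mN nN.
  have FA k : F k a = 0.
    rewrite /F big1// => i _.
    have ai j : a <= x k j by rewrite /x lerDl mulr_ge0// ltW.
    by rewrite !min_l// subrr scale0r.
  rewrite (_ : F m t - F n t = (F m t - F n t) - (F m a - F n a)); last first.
    by rewrite !FA subrr subr0.
  have cF k s : a <= s <= t -> contd `[a, t]%classic (F k) s.
    move=> _; apply: contd_sub (F_cont k s) => q /=; rewrite !in_itv/=.
    by move=> /andP[-> /= qt]; rewrite (le_trans qt).
  apply: (@le_trans _ _ (2 * e' * t - 2 * e' * a)).
    apply: (@mean_value _ _ (fun t => F m t - F n t) (fun t => 2 * e' * t)) => //.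
    - move=> s sab.
      apply: contd_by (vanishesD (vanishes_contd (cF m s sab)) (vanishes_contd (cF n s sab))) _ => q.
      rewrite (_ : _ - _ - _ = (F m q - F m s) - (F n q - F n s)); last by lmod R.
      exact: ler_normB.
    - move=> s _ ; apply: hasd_contd; apply: hasdZl; exact: hasd_id.
    move=> s e1 /andP[as_ st] e10; exists d => // q /andP[sq qd] qt.
    have qsd : q - s <= d by rewrite lerBlDl ltW.
    have h1 := F_slope ucf (hN m mN) as_ (ltW sq) (le_trans qt tb) qsd.
    have h2 := F_slope ucf (hN n nN) as_ (ltW sq) (le_trans qt tb) qsd.
    rewrite (_ : _ - _ - _ = (F m q - F m s - (q - s) *: f s)
      - (F n q - F n s - (q - s) *: f s)); last by lmod R.
    apply: (le_trans (ler_normB _ _)).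
    have : 0 <= e1 * (q - s) by rewrite mulr_ge0 ?subr_ge0// ltW.
    lra.
  rewrite -mulrBr /e' [leLHS](_ : _ = e / (b - a + 1) * (t - a)); last by field; lra.
  apply: le_trans (ler_wpM2l _ (_ : _ <= b - a)) _; rewrite ?lerD2r//.
    by rewrite divr_ge0// ltW.
  by apply: ler_div_absorb; [exact: ltW|rewrite subr_ge0 ltW].
have /choice[G hG] : forall t, exists l, a <= t <= b -> forall e : R, 0 < e ->
    exists N, forall n, (N <= n)%N -> `|F n t - l| <= e.
  move=> t; have [/cauchyF[l hl]|] := boolP (a <= t <= b); first by exists l.
  by exists 0.
exists G => t tab e e0.
have e2 : 0 < e / 2 by rewrite divr_gt0.
have [d d0 ucf] := near_unif_cont a b cf e2.
have slope s q : a <= s -> s <= q -> q <= b -> q - s <= d ->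
    `|G q - G s - (q - s) *: f s| <= e / 2 * (q - s).
  move=> as_ sq qb qsd; apply/ler_addgt0Pr => e1 e10.
  have [N1 k1] := hG s (ltac:(by rewrite as_ (le_trans sq))) _ (divr_gt0 e10 (@ltr0n R 2)).
  have [N2 k2] := hG q (ltac:(by rewrite qb (le_trans as_))) _ (divr_gt0 e10 (@ltr0n R 2)).
  have [N3 k3] := mesh d d0; pose n := maxn N1 (maxn N2 N3).
  have := k1 n (leq_maxl _ _).
  have := k2 n (leq_trans (leq_maxl _ _) (leq_maxr _ _)).
  have := F_slope ucf (k3 n (leq_trans (leq_maxr _ _) (leq_maxr _ _))) as_ sq qb qsd.
  move=> p1 p2 p3.
  rewrite (_ : _ - _ - _ = (F n q - F n s - (q - s) *: f s)
    + ((F n s - G s) - (F n q - G q))); last by lmod R.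
  apply: (le_trans (ler_normD _ _)).
  have := ler_normB (F n s - G s) (F n q - G q); lra.
exists d => // s; rewrite /= in_itv/= => /andP[as_ sb] sd.
move: tab => /andP[at_ tb].
have [ts|st] := leP t s.
  rewrite ger0_norm ?subr_ge0//; apply: le_trans (slope t s at_ ts sb _) _.
    by rewrite (le_trans (ler_norm _))// ltW.
  by rewrite ler_wpM2r ?subr_ge0//; lra.
rewrite ltr0_norm ?subr_lt0//.
have sd' : t - s <= d by move: sd; rewrite distrC gtr0_norm ?subr_gt0// => /ltW.
have h1 := slope s t as_ (ltW st) tb sd'.
have h2 := ucf t (ltac:(by rewrite at_)) s (ltW sd).
rewrite (_ : _ - _ - _ = - (G t - G s - (t - s) *: f s) + (- (t - s)) *: (f s - f t));
  last by lmod R.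
apply: (le_trans (ler_normD _ _)); rewrite normrN normrZ normrN gtr0_norm ?subr_gt0//.
have := ler_wpM2l (ltW (_ : 0 < t - s)) h2; rewrite subr_gt0 => /(_ st); lra.
Qed.

End segment.

End primitives.

(** * Riemann integrals of continuous curves *)

Section primitives_line.
Context (R : realType).
Implicit Types V : normedModType R.

Lemma hasd_eq_zero V (u : R -> V) (a b : R) : a <= b ->
  (forall t, a <= t <= b -> hasd `[a, b]%classic u t 0) -> u b = u a.
Proof.
move=> ab du; apply/eqP; rewrite -subr_eq0 -normr_le0.
apply: (@le_trans _ _ (0 - 0)); last by rewrite subrr.
apply: (@mean_value_hasd _ _ u (cst 0) (cst 0) (cst 0)) => // t _.
- exact: hasd_cst.
- by rewrite normr0.
Qed.

Lemma hasd_eq_deriv V (u w f : R -> V) (a b : R) : a <= b ->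
  (forall t, a <= t <= b -> hasd `[a, b]%classic u t (f t)) ->
  (forall t, a <= t <= b -> hasd `[a, b]%classic w t (f t)) ->
  u b - u a = w b - w a.
Proof.
move=> ab du dw.
have : u b - w b = u a - w a.
  apply: (@hasd_eq_zero _ (fun s => u s - w s) a b) => // t tab.
  by rewrite -(subrr (f t)); apply: hasdB; [exact: du|exact: dw].
move=> e; rewrite (_ : u b - u a = (u b - w b) - (u a - w a) + (w b - w a)); last by lmod R.
by rewrite e subrr add0r.
Qed.

Lemma primitive V (f : R -> V) : seq_complete V -> (forall t, contd setT f t) ->
  exists G : R -> V, forall t, hasd setT G t (f t).
Proof.
move=> cV cf.
have /choice[G hG] : forall n : nat, exists G : R -> V,
    forall t, - n.+1%:R <= t <= n.+1%:R ->
      hasd `[- n.+1%:R, n.+1%:R]%classic G t (f t).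
  move=> n; apply: primitive_segment => //.
  by rewrite (@lt_trans _ _ 0)// oppr_lt0.
pose N (t : R) := (Num.trunc `|t|)%N.
have tN t : `|t| < (N t).+1%:R by exact: truncnS_gt.
pose F t := G (N t) t - G (N t) 0.
have dG k a b : - k.+1%:R <= a -> b <= k.+1%:R ->
    forall s, a <= s <= b -> hasd `[a, b]%classic (G k) s (f s).
  move=> ka bk s /andP[as_ sb]; apply: (@hasd_sub _ _ `[- k.+1%:R, k.+1%:R]%classic).
    by move=> q; rewrite /= !in_itv /= => /andP[q1 q2]; apply/andP; split; lra.
  by apply: hG; apply/andP; split; lra.
(* any of the primitives whose interval contains [t] computes [F t] *)
have FE n t : `|t| <= n.+1%:R -> F t = G n t - G n 0.
  move=> tn; have tNt := ltW (tN t); rewrite /F.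
  have n0 (k : nat) : - k.+1%:R <= 0 :> R by rewrite oppr_le0.
  have [t0|t0] := leP 0 t.
    rewrite ger0_norm// in tn tNt.
    by apply: (@hasd_eq_deriv _ _ _ f) => //; apply: dG.
  rewrite ltr0_norm// in tn tNt; apply: oppr_inj; rewrite !opprB.
  apply: (@hasd_eq_deriv _ _ _ f); first exact: ltW.
    by apply: dG; [rewrite lerNl|exact: ler0n].
  by apply: dG; [rewrite lerNl|exact: ler0n].
exists F => t e e0.
have tNt : `|t| < (N t).+1%:R by exact: tN.
have Nt : - (N t).+1%:R <= t <= (N t).+1%:R by rewrite -ler_norml ltW.
have [d d0 h] := hG (N t) t Nt e e0.
exists (Num.min d ((N t).+1%:R - `|t|)) => [|s _]; first by rewrite lt_min d0 subr_gt0.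
rewrite lt_min => /andP[sd sd'].
have sN : `|s| <= (N t).+1%:R.
  by have := ler_distD t s 0; rewrite !subr0; lra.
rewrite (FE _ _ sN) (FE _ _ (ltW tNt)).
rewrite (_ : _ - _ - _ = G (N t) s - G (N t) t - (s - t) *: f t); last by lmod R.
by apply: h => //; rewrite /= in_itv/= -ler_norml.
Qed.

Lemma partition_bounds (p : nat -> R) n : (forall i, (i < n)%N -> p i <= p i.+1) ->
  forall i, (i <= n)%N -> p 0%N <= p i <= p n.
Proof.
move=> hp i ilen; have up j k : (j + k <= n)%N -> p j <= p (j + k)%N.
  elim: k => [|k ih]; first by rewrite addn0.
  rewrite addnS => jk; exact: le_trans (ih (ltnW jk)) (hp _ jk).
by rewrite (up 0%N i)//=; have := up i (n - i)%N; rewrite subnKC//; apply.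
Qed.

Lemma is_rint_ext V (f g : R -> V) (a b : R) J :
  (forall s, a <= s <= b -> f s = g s) -> is_rint f a b J -> is_rint g a b J.
Proof.
move=> fg hf e /hf[d d0 h]; exists d => // n p tag pa pb hp.
have in_ab i : (i <= n)%N -> a <= p i <= b.
  by rewrite -pa -pb; apply: partition_bounds => k /hp[/andP[/le_trans + /[swap]] _]; apply.
rewrite (eq_bigr (fun i : 'I_n => (p i.+1 - p i) *: f (tag i))); first exact: h.
move=> i _; rewrite fg//; have [/andP[h1 h2] _] := hp i (ltn_ord i).
have /andP[ai _] := in_ab i (ltnW (ltn_ord i)); have /andP[_ ib] := in_ab i.+1 (ltn_ord i).
by rewrite (le_trans ai h1) (le_trans h2).
Qed.

Lemma is_rint_unique V (f : R -> V) (a b : R) J J' : a <= b ->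
  is_rint f a b J -> is_rint f a b J' -> J = J'.
Proof.
move=> ab hJ hJ'; apply/eqP; rewrite -subr_eq0 -normr_le0.
apply/ler_addgt0Pr => e e0; rewrite add0r.
have e2 : 0 < e / 2 by rewrite divr_gt0.
have [d d0 h] := hJ _ e2; have [d' d'0 h'] := hJ' _ e2.
have [k k0 [kd kd']] := lt_both d0 d'0.
pose n := Num.trunc ((b - a) / k).
pose p (i : nat) := a + (b - a) / n.+1%:R * i%:R.
have p0 : p 0%N = a by rewrite /p mulr0 addr0.
have pn : p n.+1 = b by rewrite /p divfK ?pnatr_eq0// addrC subrK.
have pS i : p i.+1 - p i = (b - a) / n.+1%:R.
  by rewrite /p -(addn1 i) natrD; ring.
have q0 : 0 <= (b - a) / n.+1%:R by rewrite divr_ge0// subr_ge0.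
have qk : (b - a) / n.+1%:R < k.
  by rewrite ltr_pdivrMr// mulrC -ltr_pdivrMr//; exact: truncnS_gt.
have H dd : k < dd -> forall i, (i < n.+1)%N -> p i <= p i <= p i.+1 /\ p i.+1 - p i < dd.
  by move=> kdd i _; rewrite lexx/= -subr_ge0 pS q0 (lt_trans qk).
have := h n.+1 p p p0 pn (H d kd); have := h' n.+1 p p p0 pn (H d' kd').
move: (\sum_(i < _) _) => S h1 h2.
by rewrite (ltW (le_lt_trans (ler_distD S _ _) _))// (distrC S); lra.
Qed.

(** Each summand is the increment of [G s - s *: f (tag i)] over one cell, whose
    derivative is small by uniform continuity of [f]. *)
Lemma is_rint_primitive V (f G : R -> V) (a b : R) : a <= b ->
  (forall t, contd setT f t) ->
  (forall t, a <= t <= b -> hasd `[a, b]%classic G t (f t)) ->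
  is_rint f a b (G b - G a).
Proof.
move=> ab cf dG e e0.
pose e' := e / 2 / (b - a + 1).
have ba1 : 0 < b - a + 1 by rewrite ltr_wpDl// subr_ge0.
have e'0 : 0 < e' by rewrite !divr_gt0.
have [d d0 ucf] := near_unif_cont a b cf e'0.
exists d => // n p tag pa pb hp.
have in_ab i : (i <= n)%N -> a <= p i <= b.
  by rewrite -pa -pb; apply: partition_bounds => k /hp[/andP[/le_trans + /[swap]] _]; apply.
have -> : G b - G a = \sum_(i < n) (G (p i.+1) - G (p i)).
  rewrite -(big_mkord xpredT (fun i => G (p i.+1) - G (p i))).
  by rewrite (telescope_sumr (fun i => G (p i)))// pa pb.
have -> : e = e / 2 + e / 2 by field.
rewrite -sumrB; apply: (@le_lt_trans _ _ (e / 2)); last by rewrite ltrDl divr_gt0.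
apply: (le_trans (ler_norm_sum _ _ _)).
apply: (@le_trans _ _ (\sum_(i < n) e' * (p i.+1 - p i))); last first.
  rewrite -mulr_sumr -(big_mkord xpredT (fun i => p i.+1 - p i)).
  rewrite telescope_sumr// pa pb; apply: ler_div_absorb; last by rewrite subr_ge0.
  by rewrite divr_ge0// ltW.
apply: ler_sum => i _; have [/andP[h1 h2] h3] := hp i (ltn_ord i).
have {}in_ab s : p i <= s <= p i.+1 -> a <= s <= b.
  have /andP[ai _] := in_ab i (ltnW (ltn_ord i)); have /andP[_ ib] := in_ab i.+1 (ltn_ord i).
  by move=> /andP[s1 s2]; rewrite (le_trans ai s1) (le_trans s2).
rewrite (_ : _ - _ - _ = (G (p i.+1) - p i.+1 *: f (tag i)) - (G (p i) - p i *: f (tag i)));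
  last by lmod R.
rewrite mulrBr.
apply: (@mean_value_hasd _ _ (fun s => G s - s *: f (tag i)) (fun s => f s - f (tag i))
  (fun s => e' * s) (fun=> e' * 1)) => //; first exact: le_trans h2.
- move=> t tp; apply: hasdB.
    apply: hasd_sub (dG t (in_ab t tp)) => q /=; rewrite !in_itv/=; exact: in_ab.
  have := hasdM (@hasd_id R `[p i, p i.+1]%classic t) (@hasd_cst _ _ `[p i, p i.+1]%classic (f (tag i)) t).
  by rewrite scale1r scaler0 addr0.
- by move=> t tp; exact/hasdZl/hasd_id.
move=> t tp; rewrite mulr1; apply: ucf; first by apply: in_ab; rewrite h1.
rewrite ler_norml; move/andP: tp => [t1 t2]; apply/andP; split; lra.
Qed.

(** Only the values of [f] on [[a, b]] matter; [g] is a continuous extension. *)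
Lemma rint_primitive V (f g G : R -> V) (a b : R) : a <= b ->
  (forall s, a <= s <= b -> f s = g s) ->
  (forall t, contd setT g t) ->
  (forall t, a <= t <= b -> hasd `[a, b]%classic G t (g t)) ->
  rint f a b = G b - G a /\ rint f b a = G a - G b.
Proof.
move=> ab fg cg dG.
have H : is_rint f a b (G b - G a).
  apply: (@is_rint_ext _ g) => [s /fg//|]; exact: is_rint_primitive.
have X : xget 0 (is_rint f a b) = G b - G a.
  by case: xgetP => [x _ hx|/(_ (G b - G a))//]; exact: is_rint_unique ab hx H.
split; rewrite /rint; first by rewrite ab.
case: ifPn => [ba|_]; last by rewrite X opprB.
have ? : b = a by apply/le_anti; rewrite ab ba.
subst a; rewrite subrr in H *; case: xgetP => // x _ hx.
exact: is_rint_unique (lexx b) hx H.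
Qed.

End primitives_line.

(** * Exponential weights on the half-line *)

Section exponential_filters.
Context (R : realType).
Implicit Types V W : normedModType R.

Lemma expR_small (al C e : R) : 0 < al -> 0 <= C -> 0 < e ->
  exists2 T : R, 0 <= T & forall t, t <= - T -> C * expR (al * t) <= e.
Proof.
move=> al0 C0 e0; exists (C / (e * al)); first by rewrite divr_ge0// mulr_ge0// ltW.
move=> t tT; rewrite -[al * t]opprK expRN.
rewrite ler_pdivrMr ?expR_gt0//.
apply: le_trans (ler_wpM2l (ltW e0) (expR_ge1Dx _)).
have : C / (e * al) <= - t by lra.
rewrite ler_pdivrMr ?mulr_gt0// => h.
by rewrite mulrDr mulr1 (le_trans h)//; lra.
Qed.

Lemma expr_small (k C e : R) : 0 <= k < 1 -> 0 <= C -> 0 < e ->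
  exists N, forall n, (N <= n)%N -> C * k ^+ n <= e.
Proof.
move=> /andP[k0 k1] C0 e0.
have C1 : 0 < C + 1 by rewrite ltr_wpDl.
have /cvgrPdist_le/(_ _ (divr_gt0 e0 C1)) : (fun n => k ^+ n) @ \oo --> (0 : R).
  by apply: cvg_expr; rewrite ger0_norm.
move=> [N _ h]; exists N => n nN; have := h n nN; rewrite /= sub0r normrN.
move=> /(le_trans (ler_norm _)) => kn; apply: le_trans (ler_wpM2l C0 kn) _.
by rewrite mulrC; apply: ler_div_absorb => //; exact: ltW.
Qed.

(** The primitive that vanishes at -oo, normalized by subtracting the limit of an
    arbitrary one. *)
Lemma primitive_ninfty V (f : R -> V) (al B : R) : seq_complete V ->
  0 < al -> 0 <= B -> (forall t, contd setT f t) ->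
  (forall t, t <= 0 -> `|f t| <= B * expR (al * t)) ->
  exists G : R -> V, (forall t, hasd setT G t (f t)) /\
    forall t, t <= 0 -> `|G t| <= B / al * expR (al * t).
Proof.
move=> cV al0 B0 cf fB; have [G0 dG0] := primitive cV cf.
have Bal : 0 <= B / al by rewrite divr_ge0// ltW.
have G0B s t : s <= t -> t <= 0 -> `|G0 t - G0 s| <= B / al * expR (al * t).
  move=> st t0; apply: (@le_trans _ _ (B / al * expR (al * t) - B / al * expR (al * s))).
    apply: (@mean_value_hasd _ _ G0 f (fun t => B / al * expR (al * t))
      (fun t => B / al * (al * expR (al * t)))) => // q /andP[sq qt].
    - exact: hasd_sub (dG0 q).
    - exact/hasdZl/hasd_expRM.
    - by rewrite mulrA divfK ?gt_eqF// fB// (le_trans qt).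
  by rewrite gerBl mulr_ge0// expR_ge0.
have [l hl] : exists l : V, forall e : R, 0 < e -> exists N, forall n, (N <= n)%N ->
    `|G0 (- n%:R) - l| <= e.
  apply: (cV (fun n => G0 (- n%:R))) => e e0.
  have [T T0 hT] := expR_small al0 Bal e0; exists (Num.trunc T).+1.
  have hN n : (Num.trunc T < n)%N -> - n%:R <= - T.
    move=> nN; rewrite lerN2 (le_trans (ltW (truncnS_gt _)))// ler_nat//.
  suff {}H m n : (m <= n)%N -> (Num.trunc T < m)%N -> `|G0 (- n%:R) - G0 (- m%:R)| <= e.
    move=> m n mN nN; have [mn|/ltnW nm] := leqP m n; last exact: H.
    by rewrite distrC; exact: H.
  move=> mn mN; rewrite distrC; apply: le_trans (hT _ (hN _ mN)).
  by apply: G0B; rewrite ?lerN2 ?ler_nat// oppr_le0.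
exists (fun t => G0 t - l); split=> [t|t t0].
  by rewrite -[f t]subr0; apply: hasdB => //; exact: hasd_cst.
apply/ler_addgt0Pr => e e0; have [N hN] := hl e e0.
pose n := maxn N (Num.trunc (- t)).+1.
have nt : - n%:R <= t.
  rewrite lerNl (le_trans (ltW (truncnS_gt _)))// ler_nat.
  exact: leq_maxr.
apply: le_trans (ler_distD (G0 (- n%:R)) _ _) _.
by rewrite lerD// ?G0B// hN// leq_maxl.
Qed.

Variables (eps : R).
Hypothesis eps0 : 0 < eps.

(** The linear fast equation [eps a' = f - a] is a low-pass filter. An input growing
    like [exp (- lam t)] backwards in time is amplified by [1 / (1 - eps lam)],
    the mass of the kernel [eps^-1 exp (- s / eps)] against [exp (lam s)]. *)
Lemma filter_exists W (f : R -> W) (lam B : R) : seq_complete W ->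
  eps * lam < 1 -> 0 <= B -> (forall t, contd setT f t) ->
  (forall t, t <= 0 -> `|f t| <= B * expR (- lam * t)) ->
  exists a : R -> W, (forall t, hasd setT a t (eps^-1 *: (f t - a t))) /\
    forall t, t <= 0 -> `|a t| <= B / (1 - eps * lam) * expR (- lam * t).
Proof.
move=> cW el B0 cf fB.
pose k := eps^-1 - lam.
have ek : eps * k = 1 - eps * lam by rewrite /k mulrBr mulfV ?gt_eqF.
have k0 : 0 < k by rewrite -(pmulr_rgt0 _ eps0) ek subr_gt0.
have [||G [dG GB]] := @primitive_ninfty W (fun s => (eps^-1 * expR (eps^-1 * s)) *: f s)
    k (eps^-1 * B) cW k0 (ltac:(by rewrite mulr_ge0// invr_ge0 ltW)).
- by move=> t; apply: contdM => //; apply: hasd_contd; apply: hasdZl; exact: hasd_expRM.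
- move=> t t0; rewrite normrZ ger0_norm; last by rewrite mulr_ge0 ?expR_ge0// invr_ge0 ltW.
  rewrite /k mulrDl expRD -!mulrA; apply: ler_wpM2l; first by rewrite invr_ge0 ltW.
  by rewrite [leRHS]mulrCA; apply: ler_wpM2l; [exact: expR_ge0|exact: fB].
exists (fun t => expR (- eps^-1 * t) *: G t); split=> [t|t t0].
  have := hasdM (@hasd_expRM _ setT (- eps^-1) t) (dG t).
  congr (hasd _ _ _ _).
  rewrite (_ : expR (- eps^-1 * t) *: ((eps^-1 * expR (eps^-1 * t)) *: f t) = eps^-1 *: f t).
    by lmod R.
  rewrite scalerA mulrCA -expRD -mulrDl addNr mul0r expR0 mulr1//.
rewrite normrZ ger0_norm ?expR_ge0//.
apply: le_trans (ler_wpM2l (expR_ge0 _) (GB t t0)) _.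
rewrite mulrCA -expRD -mulrDl (_ : - eps^-1 + k = - lam); last by rewrite /k; ring.
rewrite ler_wpM2r ?expR_ge0// -ek invfM; move: (eps^-1) (k^-1) => x y.
by rewrite mulrCA mulrA.
Qed.

(** The a priori growth [lam'] may exceed the rate [lam] of the conclusion: any
    growth slower than [exp (- t / eps)] excludes the homogeneous solution. *)
Lemma filter_bound W (a f : R -> W) (lam lam' B C : R) :
  eps * lam < 1 -> eps * lam' < 1 -> 0 <= B ->
  (forall t, t <= 0 -> hasd setT a t (eps^-1 *: (f t - a t))) ->
  (forall t, t <= 0 -> `|f t| <= B * expR (- lam * t)) ->
  (forall t, t <= 0 -> `|a t| <= C * expR (- lam' * t)) ->
  forall t, t <= 0 -> `|a t| <= B / (1 - eps * lam) * expR (- lam * t).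
Proof.
move=> el el' B0 da fB aC t t0.
pose k := eps^-1 - lam.
have ek : eps * k = 1 - eps * lam by rewrite /k mulrBr mulfV ?gt_eqF.
have k0 : 0 < k by rewrite -(pmulr_rgt0 _ eps0) ek subr_gt0.
pose k' := eps^-1 - lam'.
have k'0 : 0 < k'.
  by rewrite -(pmulr_rgt0 _ eps0) /k' mulrBr mulfV ?gt_eqF// subr_gt0.
have C0 : 0 <= C.
  by have := aC 0 (lexx 0); rewrite mulr0 expR0 mulr1; exact: le_trans.
have Bk0 : 0 <= B / (eps * k) by rewrite divr_ge0// mulr_ge0 ?ltW.
pose w s := expR (eps^-1 * s) *: a s.
have wB s : s <= 0 -> `|w s| <= C * expR (k' * s).
  move=> s0; rewrite /w normrZ ger0_norm ?expR_ge0//.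
  apply: le_trans (ler_wpM2l (expR_ge0 _) (aC s s0)) _.
  by rewrite mulrCA -expRD -mulrDl.
have wt : `|w t| <= B / (eps * k) * expR (k * t).
  apply/ler_addgt0Pr => e e0; have [T T0 hT] := expR_small k'0 C0 e0.
  pose s := Num.min t (- T).
  have st : s <= t by rewrite ge_min lexx.
  have sT : s <= - T by rewrite ge_min lexx orbT.
  have ws : `|w s| <= e by rewrite (le_trans (wB s (le_trans st t0)))// hT.
  have : `|w t - w s| <= B / (eps * k) * expR (k * t) - B / (eps * k) * expR (k * s).
    apply: (@mean_value_hasd _ _ w (fun q => (eps^-1 * expR (eps^-1 * q)) *: f q)
     (fun t => B / (eps * k) * expR (k * t)) (fun t => B / (eps * k) * (k * expR (k * t)))) => // q /andP[sq qt].
    - apply: (@hasd_sub _ _ setT) => //.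
      have := hasdM (@hasd_expRM _ setT (eps^-1) q) (da q (le_trans qt t0)).
      by congr (hasd _ _ _ _); lmod R.
    - exact/hasdZl/hasd_expRM.
    - rewrite normrZ ger0_norm; last by rewrite mulr_ge0 ?expR_ge0// invr_ge0 ltW.
      apply: le_trans (ler_wpM2l _ (fB q (le_trans qt t0))) _.
        by rewrite mulr_ge0 ?expR_ge0// invr_ge0 ltW.
      rewrite -mulrA mulrCA -mulrA [X in _ * (_ * X)]mulrC.
      rewrite -[X in X * (eps^-1 * _)]mulr1 mulrCA.
      rewrite [leLHS](_ : _ = B * (eps^-1 * (expR (eps^-1 * q) * expR (- lam * q)))); last by ring.
      rewrite -expRD -mulrDl -/k [leRHS](_ : _ = B * (eps^-1 * expR (k * q)))//.
      by field; rewrite !gt_eqF.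
  have : 0 <= B / (eps * k) * expR (k * s) by rewrite mulr_ge0// expR_ge0.
  have := lerB_dist (w t) (w s); lra.
have -> : a t = expR (- eps^-1 * t) *: w t.
  by rewrite /w scalerA -expRD -mulrDl addNr mul0r expR0 scale1r.
rewrite normrZ ger0_norm ?expR_ge0//.
apply: le_trans (ler_wpM2l (expR_ge0 _) wt) _.
by rewrite mulrCA -expRD -mulrDl ek (_ : - eps^-1 + k = - lam)//; rewrite /k; ring.
Qed.

Lemma growth_bound V (u u' : R -> V) (lam B : R) : 0 < lam ->
  (forall t, t <= 0 -> hasd setT u t (u' t)) ->
  (forall t, t <= 0 -> `|u' t| <= B * expR (- lam * t)) ->
  forall t, t <= 0 -> `|u t - u 0| <= B / lam * (expR (- lam * t) - 1).
Proof.
move=> lam0 du uB t t0.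
have : `|u 0 - u t| <= - (B / lam) * expR (- lam * 0) - - (B / lam) * expR (- lam * t).
  apply: (@mean_value_hasd _ _ u u' (fun q => - (B / lam) * expR (- lam * q))
    (fun q => - (B / lam) * (- lam * expR (- lam * q)))) => // q /andP[tq q0].
  - exact: hasd_sub (du q q0).
  - exact/hasdZl/hasd_expRM.
  - rewrite mulrA mulrNN divfK ?gt_eqF//; exact: uB.
rewrite mulr0 expR0 distrC; move/le_trans; apply.
by rewrite le_eqVlt; apply/orP; left; apply/eqP; ring.
Qed.

End exponential_filters.

(** * Backward solutions of fast-slow systems *)

Lemma contd_min0 (R : realType) (U : normedModType R) (u : R -> U) t :
  contd setT u (Num.min t 0) -> contd setT (fun s => u (Num.min s 0)) t.
Proof.
have min_dist s : `|Num.min s 0 - Num.min t 0| <= `|s - t|.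
  rewrite ler_norml; have := ler_norm (s - t); have := ler_norm (t - s).
  rewrite (distrC t) /Order.min; case: ifPn; case: ifPn; rewrite -?leNgt; lra.
move=> cu e e0; have [d d0 h] := cu e e0; exists d => // s _ sd.
by apply: h => //; exact: le_lt_trans (min_dist _) sd.
Qed.

Section backward_solutions.
Context (R : realType).
Variables (V W : normedModType R).
Variables (eps lam Q M P : R).
Hypotheses (eps0 : 0 < eps) (lam0 : 0 < lam) (el : eps * lam < 1).
Hypotheses (Q0 : 0 <= Q) (M0 : 0 <= M) (P0 : 0 <= P).
Hypothesis gap : Q + M * P / (1 - eps * lam) < lam.

Let E (t : R) : R := expR (- lam * t).

Let E_ge0 t : 0 <= E t. Proof. exact: expR_ge0. Qed.

Let E_ge1 t : t <= 0 -> 1 <= E t.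
Proof.
move=> t0; rewrite -expR0 ler_expR mulNr oppr_ge0 pmulr_rle0//.
Qed.

Let rate : R := Q + M * P / (1 - eps * lam).

Let el0 : 0 < 1 - eps * lam. Proof. by rewrite subr_gt0. Qed.

Let rate0 : 0 <= rate.
Proof. by rewrite addr_ge0// divr_ge0 ?mulr_ge0// ltW. Qed.

(** The estimate behind the whole construction. A bound [n exp (- lam t)] on [D] gives
    one on [a] through the fast filter; integrating the slow equation then returns
    the bound [max `|D 0| ((rate * n + c) / lam)] on [D]. As [rate < lam], the least
    admissible [n] is at most [N]. The factor in front of [`|D 0|] is exactly 1. *)
Lemma backward_estimate (D D' : R -> V) (a g : R -> W) (C Er : R) : 0 <= Er ->
  (forall t, t <= 0 -> hasd setT D t (D' t)) ->
  (forall t, t <= 0 -> hasd setT a t (eps^-1 *: (g t - a t))) ->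
  (forall t, t <= 0 -> `|D' t| <= Q * `|D t| + M * `|a t| + Er * E t) ->
  (forall t, t <= 0 -> `|g t| <= P * `|D t| + Er * E t) ->
  (forall t, t <= 0 -> `|D t| <= C * E t) ->
  (forall t, t <= 0 -> `|a t| <= C * E t) ->
  let N := Num.max `|D 0| ((1 + M / (1 - eps * lam)) * Er / (lam - rate)) in
  forall t, t <= 0 -> `|D t| <= N * E t /\
    `|a t| <= (P * N + Er) / (1 - eps * lam) * E t.
Proof.
move=> Er0 dD da DB gB DC aC N.
have abound n : 0 <= n -> (forall t, t <= 0 -> `|D t| <= n * E t) ->
    forall t, t <= 0 -> `|a t| <= (P * n + Er) / (1 - eps * lam) * E t.
  move=> n0 Dn t t0; apply: (@filter_bound _ _ eps0 _ a g lam lam _ C) => //.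
    by rewrite addr_ge0// mulr_ge0.
  move=> s s0; apply: le_trans (gB s s0) _.
  by rewrite mulrDl lerD2r -mulrA ler_wpM2l// Dn.
have N0 : 0 <= N by rewrite le_max normr_ge0.
suff DN : forall t, t <= 0 -> `|D t| <= N * E t.
  by move=> t t0; split; [exact: DN|exact: abound].
pose c := (1 + M / (1 - eps * lam)) * Er.
have c0 : 0 <= c by rewrite mulr_ge0// addr_ge0// divr_ge0// ltW.
have improve n : 0 <= n -> (forall t, t <= 0 -> `|D t| <= n * E t) ->
    forall t, t <= 0 -> `|D t| <= Num.max `|D 0| ((rate * n + c) / lam) * E t.
  move=> n0 Dn t t0.
  have D'B s : s <= 0 -> `|D' s| <= (rate * n + c) * E s.
    move=> s0; apply: le_trans (DB s s0) _.
    have h1 := ler_wpM2l Q0 (Dn s s0).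
    have h2 := ler_wpM2l M0 (abound n n0 Dn s s0).
    apply: (@le_trans _ _ (Q * (n * E s) + M * ((P * n + Er) / (1 - eps * lam) * E s) + Er * E s)).
      by rewrite lerD2r lerD.
    rewrite le_eqVlt; apply/orP; left; apply/eqP.
    by rewrite /c /rate; field; rewrite gt_eqF.
  have := growth_bound lam0 dD D'B t0.
  set m := (_ + _) / lam => h.
  have m0 : 0 <= m.
    by apply: divr_ge0; [apply: addr_ge0 => //; exact: mulr_ge0|exact: ltW].
  have D0m : `|D 0| <= Num.max `|D 0| m by rewrite le_max lexx.
  have mm : m <= Num.max `|D 0| m by rewrite le_max lexx orbT.
  have := lerB_dist (D t) (D 0); move: h mm D0m; set x := Num.max _ _ => h mm D0m h1.
  have := ler_wpM2r (_ : 0 <= E t - 1) mm; rewrite subr_ge0 => /(_ (E_ge1 t0)).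
  by move: h; rewrite -/(E t); lra.
(* the set of admissible constants is stable under [improve] and has a least element *)
pose S := [set n : R | 0 <= n /\ forall t, t <= 0 -> `|D t| <= n * E t].
have C0 : 0 <= C.
  by have := DC 0 (lexx 0); rewrite /E mulr0 expR0 mulr1; exact: le_trans.
have SC : S C by [].
have infS : has_inf S by split; [exists C|exists 0 => n []].
have Sinf : S (inf S).
  split; first by apply: lb_le_inf; [exists C|move=> n []].
  move=> t t0; apply/ler_addgt0Pr => e e_gt0.
  have [n [n0 hn] nS] := inf_adherent (divr_gt0 e_gt0 (expR_gt0 (- lam * t))) infS.
  apply: le_trans (hn t t0) _.
  have := ler_wpM2r (E_ge0 t) (ltW nS).
  by rewrite mulrDl divfK// gt_eqF ?expR_gt0.
have [i0 iD] := Sinf.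
have : inf S <= Num.max `|D 0| ((rate * inf S + c) / lam).
  apply: ge_inf; first by exists 0 => n [].
  split; last exact: improve.
  by rewrite le_max normr_ge0.
rewrite le_max => /orP iN.
have {}iN : inf S <= N.
  rewrite /N le_max; case: iN => [->//|]; rewrite ler_pdivlMr// => h.
  apply/orP; right; rewrite ler_pdivlMr ?subr_gt0//; rewrite -/c; lra.
move=> t t0; apply: le_trans (iD t t0) _; exact: ler_wpM2r.
Qed.

Section existence.
Hypotheses (cV : seq_complete V) (cW : seq_complete W).
Variables (F : R -> V -> W -> V) (f : R -> V -> W) (Cg : R).
Hypothesis F_lip : forall t v w v' w',
  `|F t v w - F t v' w'| <= Q * `|v - v'| + M * `|w - w'|.
Hypothesis f_lip : forall t v v', `|f t v - f t v'| <= P * `|v - v'|.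
Hypothesis F_cont : forall v w t, contd setT (fun s => F s v w) t.
Hypothesis f_cont : forall v t, contd setT (fun s => f s v) t.
Hypothesis F_growth : forall t, t <= 0 -> `|F t 0 0| <= Cg * E t.
Hypothesis f_growth : forall t, t <= 0 -> `|f t 0| <= Cg * E t.

Let cl (t : R) : R := Num.min t 0.

Let cl0 t : cl t <= 0. Proof. by rewrite ge_min lexx orbT. Qed.

Let clE t : t <= 0 -> cl t = t. Proof. exact: min_l. Qed.

Let good (U : normedModType R) (u : R -> U) : Prop :=
  (forall t, contd setT u t) /\
  exists2 C, 0 <= C & forall t, t <= 0 -> `|u t| <= C * E t.

Let contd_F (th : R -> V) (a : R -> W) t : contd setT th t -> contd setT a t ->
  contd setT (fun s => F s (th s) (a s)) t.
Proof.
move=> /vanishes_contd/(vanishesZ Q0) cth /vanishes_contd/(vanishesZ M0) ca.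
apply: contd_by (vanishesD (vanishesD cth ca) (vanishes_contd (@F_cont (th t) (a t) t))) _ => s.
by apply: le_trans (ler_distD (F s (th t) (a t)) _ _) _; rewrite lerD2r.
Qed.

Let contd_f (th : R -> V) t : contd setT th t ->
  contd setT (fun s => f s (th s)) t.
Proof.
move=> /vanishes_contd/(vanishesZ P0) cth.
apply: contd_by (vanishesD cth (vanishes_contd (@f_cont (th t) t))) _ => s.
by apply: le_trans (ler_distD (f s (th t)) _ _) _; rewrite lerD2r.
Qed.

(** One Picard step: the fast component is first solved exactly along the given slow
    curve, then the slow equation is integrated. Time is clamped at 0, so that the
    curves are defined on the whole line. *)
Let stepA (th : R -> V) (a : R -> W) : Prop :=
  forall t, hasd setT a t (eps^-1 *: (f (cl t) (th (cl t)) - a t)).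

Let stepT (v0 : V) (th : R -> V) (a : R -> W) (th' : R -> V) : Prop :=
  th' 0 = v0 /\ forall t, hasd setT th' t (F (cl t) (th (cl t)) (a (cl t))).

Let Cg0 : 0 <= Cg.
Proof.
have := F_growth (lexx 0); rewrite /E mulr0 expR0 mulr1; exact: le_trans.
Qed.

Let good_hasd (U : normedModType R) (u u' : R -> U) (B : R) : 0 <= B ->
  (forall t, hasd setT u t (u' t)) ->
  (forall t, t <= 0 -> `|u' t| <= B * E t) -> good u.
Proof.
move=> B0 du uB; split=> [t|]; first exact: hasd_contd (du t).
have Bl : 0 <= B / lam by rewrite divr_ge0// ltW.
exists (`|u 0| + B / lam) => [|t t0]; first by rewrite addr_ge0.
have := growth_bound lam0 (fun t _ => du t) uB t0.
have := lerB_dist (u t) (u 0).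
have := ler_wpM2l (normr_ge0 (u 0)) (E_ge1 t0).
rewrite -/(E t); lra.
Qed.

Let step_exists (v0 : V) (th : R -> V) : exists p : (R -> W) * (R -> V), good th ->
  [/\ good p.1, good p.2, stepA th p.1 & stepT v0 th p.1 p.2].
Proof.
have [[cth [C C0 thC]]|ng] := pselect (good th); last by exists (cst 0, cst 0).
have B0 : 0 <= P * C + Cg by rewrite addr_ge0 ?mulr_ge0.
have [||a [da aB]] := @filter_exists _ _ eps0 W (fun s => f (cl s) (th (cl s))) lam
  (P * C + Cg) cW el B0.
- by move=> t; apply: (@contd_min0 _ _ (fun s => f s (th s))); exact: contd_f.
- move=> t t0; rewrite clE//.
  have := f_lip t (th t) 0; rewrite subr0 => h1.
  have := lerB_dist (f t (th t)) (f t 0); have := f_growth t0.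
  have := ler_wpM2l P0 (thC t t0); rewrite -/(E t); lra.
have ga : good a.
  split=> [t|]; first exact: hasd_contd (da t).
  by exists ((P * C + Cg) / (1 - eps * lam)) => //; rewrite divr_ge0// ltW.
have [_ [Ca Ca0 aC]] := ga.
have cF t : contd setT (fun s => F (cl s) (th (cl s)) (a (cl s))) t.
  apply: (@contd_min0 _ _ (fun s => F s (th s) (a s))); apply: contd_F => //.
  exact: hasd_contd (da _).
have [G dG] := primitive cV cF.
have dG' t : hasd setT (fun s => v0 + (G s - G 0)) t (F (cl t) (th (cl t)) (a (cl t))).
  rewrite -[F _ _ _]add0r; apply: hasdD; first exact: hasd_cst.
  by rewrite -[F _ _ _]subr0; apply: hasdB => //; exact: hasd_cst.
exists (a, fun s => v0 + (G s - G 0)) => _; split=> //=.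
- apply: (@good_hasd _ _ _ (Q * C + M * Ca + Cg)) dG' _.
    by rewrite !addr_ge0 ?mulr_ge0.
  move=> t t0; rewrite clE//.
  have := F_lip t (th t) (a t) 0 0; rewrite !subr0 => h1.
  have := lerB_dist (F t (th t) (a t)) (F t 0 0); have := F_growth t0.
  have := ler_wpM2l Q0 (thC t t0); have := ler_wpM2l M0 (aC t t0); lra.
- by split=> //; rewrite subrr addr0.
Qed.

Let step_contracts (v0 : V) th1 th2 a1 a2 th1' th2' n :
  good a1 -> good a2 -> stepA th1 a1 -> stepA th2 a2 ->
  stepT v0 th1 a1 th1' -> stepT v0 th2 a2 th2' -> 0 <= n ->
  (forall t, t <= 0 -> `|th1 t - th2 t| <= n * E t) ->
  forall t, t <= 0 -> `|th1' t - th2' t| <= rate / lam * n * E t.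
Proof.
move=> [_ [C1 C10 a1C]] [_ [C2 C20 a2C]] A1 A2 [T10 T1] [T20 T2] n0 thn.
have Pn0 : 0 <= P * n by rewrite mulr_ge0.
have aB t : t <= 0 -> `|a1 t - a2 t| <= P * n / (1 - eps * lam) * E t.
  apply: (@filter_bound _ _ eps0 _ (fun t => a1 t - a2 t)
    (fun t => f t (th1 t) - f t (th2 t)) lam lam _ (C1 + C2)) => // s s0.
  - have := hasdB (A1 s) (A2 s); rewrite clE//.
    by congr (hasd _ _ _ _); lmod R.
  - apply: le_trans (f_lip _ _ _) _; rewrite -mulrA; apply: ler_wpM2l => //.
    exact: thn.
  - apply: (le_trans (ler_normB _ _)); have := a1C s s0; have := a2C s s0.
    rewrite /E; lra.
have DB s : s <= 0 -> `|F s (th1 s) (a1 s) - F s (th2 s) (a2 s)| <= rate * n * E s.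
  move=> s0; apply: (le_trans (F_lip _ _ _ _ _)).
  apply: (le_trans (lerD (ler_wpM2l Q0 (thn s s0)) (ler_wpM2l M0 (aB s s0)))).
  by rewrite /rate le_eqVlt; apply/orP; left; apply/eqP; field; rewrite gt_eqF.
move=> t t0.
have := growth_bound (u := fun s => th1' s - th2' s) lam0 _ DB t0.
rewrite T10 T20 subrr subr0 => h.
apply: le_trans (h _) _ => [s s0|].
  by have := hasdB (T1 s) (T2 s); rewrite !clE.
rewrite (mulrAC rate); apply: ler_wpM2l; last by rewrite gerBl.
by rewrite mulr_ge0// divr_ge0// ltW.
Qed.

(** Picard iteration in the weighted norm; one step contracts by [rate / lam]. *)
Lemma backward_exists (v0 : V) : exists (th : R -> V) (a : R -> W),
  [/\ th 0 = v0,
      forall t, t <= 0 -> hasd setT th t (F t (th t) (a t)),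
      forall t, t <= 0 -> hasd setT a t (eps^-1 *: (f t (th t) - a t)),
      exists2 C, 0 <= C & forall t, t <= 0 -> `|th t| <= C * E t &
      exists2 C, 0 <= C & forall t, t <= 0 -> `|a t| <= C * E t].
Proof.
have /choice[S hS] := step_exists v0.
pose u n := iter n (fun th => (S th).2) (cst v0 : R -> V).
have gu n : good (u n).
  elim: n => [|n ih]; last by have [] := hS _ ih.
  split=> [t e e0|]; first by exists 1 => // s _ _; rewrite subrr normr0 ltW.
  by exists `|v0| => // t t0 /=; rewrite ler_peMr// E_ge1.
pose k := rate / lam.
have k01 : 0 <= k < 1 by rewrite divr_ge0 ?(ltW lam0)//= ltr_pdivrMr// mul1r.
have [k0 k1] := andP k01; have k1' : 0 < 1 - k by rewrite subr_gt0.
have [C C0 hC] : exists2 C, 0 <= C & forall t, t <= 0 -> `|u 1%N t - u 0%N t| <= C * E t.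
  have [_ [C C0 hC]] := gu 0%N; have [_ [C' C'0 hC']] := gu 1%N.
  exists (C' + C) => [|t t0]; first by rewrite addr_ge0.
  apply: (le_trans (ler_normB _ _)); have := hC t t0; have := hC' t t0; lra.
have consec n t : t <= 0 -> `|u n.+1 t - u n t| <= k ^+ n * C * E t.
  elim: n t => [|n ih] t t0; first by rewrite expr0 mul1r hC.
  have [ga1 gt1 A1 T1] := hS _ (gu n.+1); have [ga2 gt2 A2 T2] := hS _ (gu n).
  have kC : 0 <= k ^+ n * C by apply: mulr_ge0 => //; exact: exprn_ge0.
  have := step_contracts ga1 ga2 A1 A2 T1 T2 kC ih t0.
  by rewrite exprS -!mulrA.
pose D := C / (1 - k); have D0 : 0 <= D by rewrite divr_ge0// ltW.
have far n m t : t <= 0 -> `|u (n + m)%N t - u n t| <= D * k ^+ n * (1 - k ^+ m) * E t.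
  move=> t0; elim: m => [|m ih].
    by rewrite addn0 subrr normr0 expr0 subrr mulr0 mul0r.
  rewrite addnS; apply: le_trans (ler_distD (u (n + m)%N t) _ _) _.
  have h1 := consec (n + m)%N t t0.
  apply: le_trans (lerD h1 ih) _.
  have -> : C = D * (1 - k) by rewrite /D divfK ?gt_eqF.
  by rewrite le_eqVlt; apply/orP; left; apply/eqP; rewrite exprD exprS; ring.
have far' n m t : t <= 0 -> (n <= m)%N -> `|u m t - u n t| <= D * k ^+ n * E t.
  move=> t0 /subnKC <-; apply: le_trans (far n _ t t0) _.
  apply: ler_wpM2r => //; apply: ler_piMr; last by rewrite gerBl exprn_ge0.
  by apply: mulr_ge0 => //; exact: exprn_ge0.
have /choice[l hl] : forall t, exists l, t <= 0 -> forall e : R, 0 < e -> exists N, forall n,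
    (N <= n)%N -> `|u n t - l| <= e.
  move=> t; have [t0|] := boolP (t <= 0); last by exists 0.
  have [|l hl] := cV (u := fun n => u n t); last by exists l.
  move=> e e0; have DE0 : 0 <= D * E t by exact: mulr_ge0.
  have [N hN] := expr_small k01 DE0 e0; exists N.
  suff H m n : (m <= n)%N -> (N <= m)%N -> `|u m t - u n t| <= e.
    move=> m n mN nN; have [mn|/ltnW nm] := leqP m n; first exact: H.
    by rewrite distrC; exact: H.
  move=> mn mN; rewrite distrC; apply: le_trans (far' m n t t0 mn) _.
  by rewrite mulrAC hN.
pose th t := l (cl t).
have thu n t : t <= 0 -> `|th t - u n t| <= D * k ^+ n * E t.
  move=> t0; rewrite /th clE//; apply/ler_addgt0Pr => e e0.
  have [N hN] := hl t t0 e e0.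
  apply: le_trans (ler_distD (u (maxn n N) t) _ _) _; rewrite addrC.
  apply: lerD; first by apply: far' => //; exact: leq_maxl.
  by rewrite distrC hN// leq_maxr.
have gth : good th.
  split=> [t e e0|]; last first.
    have [_ [B B0 hB]] := gu 0%N; exists (D + B) => [|t t0]; first by rewrite addr_ge0.
    have := thu 0%N t t0; rewrite expr0 mulr1; have := hB t t0.
    have := lerB_dist (th t) (u 0%N t); lra.
  pose X := expR (lam * (`|t| + 1)).
  have EX s : `|s - t| < 1 -> E (cl s) <= X.
    move=> st; rewrite /E /X ler_expR mulNr -mulrN ler_pM2l//.
    have := normr_ge0 t; have := ler_norm (t - s); have := ler_norm (- t).
    rewrite normrN (distrC t) /cl /Order.min; case: ifPn; rewrite -?leNgt; lra.
  have DX0 : 0 <= D * X by apply: mulr_ge0 => //; exact: expR_ge0.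
  have e3 : 0 < e / 3 by rewrite divr_gt0.
  have [N hN] := expr_small k01 DX0 e3.
  have close s : `|s - t| < 1 -> `|th s - u N (cl s)| <= e / 3.
    move=> st; have := thu N (cl s) (cl0 s); rewrite {1}/th clE//.
    move/le_trans; apply; apply: le_trans (hN N (leqnn N)).
    rewrite mulrAC; apply: ler_wpM2r; first exact: exprn_ge0.
    by rewrite ler_wpM2l// EX.
  have [cu _] := gu N; have [d d0 hd] := contd_min0 (cu (cl t)) e3.
  exists (Num.min d 1) => [|s Is]; first by rewrite lt_min d0 ltr01.
  rewrite lt_min => /andP[sd s1].
  have h1 := close s s1; have h2 := close t (ltac:(by rewrite subrr normr0)).
  have h3 := hd s Is sd.
  apply: le_trans (ler_distD (u N (cl s)) _ _) _.
  have := ler_distD (u N (cl t)) (u N (cl s)) (th t).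
  rewrite (distrC (u N (cl t)) (th t)); lra.
have [ga gt A T] := hS _ gth.
have fix_ t : t <= 0 -> (S th).2 t = th t.
  move=> t0; apply/eqP; rewrite -subr_eq0 -normr_le0.
  apply/ler_addgt0Pr => e e0; rewrite add0r.
  have DE0 : 0 <= 2 * (D * E t) by apply: mulr_ge0 => //; exact: mulr_ge0.
  have [N hN] := expr_small k01 DE0 e0.
  have [ga2 gt2 A2 T2] := hS _ (gu N).
  have DN0 : 0 <= D * k ^+ N by apply: mulr_ge0 => //; exact: exprn_ge0.
  have h1 := step_contracts ga ga2 A A2 T T2 DN0 (thu N) t0.
  have h2 := thu N.+1 t t0.
  apply: le_trans (ler_distD (u N.+1 t) _ _) _; rewrite (distrC (u _ t)).
  apply: le_trans (lerD h1 h2) _.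
  apply: le_trans (hN N.+1 (leqnSn N)).
  by rewrite le_eqVlt; apply/orP; left; apply/eqP; rewrite exprS -/k; ring.
exists (S th).2, (S th).1; split.
- by have [] := T.
- by move=> t t0; have [_ /(_ t)] := T; rewrite clE// fix_.
- by move=> t t0; have := A t; rewrite clE// fix_.
- by have [] := gt.
- by have [] := ga.
Qed.

End existence.
End backward_solutions.

(** * The slow map *)

Section slow_map.
Context (R : realType).
Variables (V W : normedModType R).
Variables (h0 : V -> W) (F : V -> W -> V).
Variables (eps lam Q M P MH C2 : R).
Hypotheses (cV : seq_complete V) (cW : seq_complete W).
Hypotheses (eps0 : 0 < eps) (lam0 : 0 < lam) (el : eps * lam < 1).
Hypotheses (Q0 : 0 <= Q) (M0 : 0 <= M) (P0 : 0 <= P).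
Hypothesis gap : Q + M * P / (1 - eps * lam) < lam.
Hypothesis F_lip : forall v w v' w',
  `|F v w - F v' w'| <= Q * `|v - v'| + M * `|w - w'|.
Hypothesis h0_lip : forall v v', `|h0 v - h0 v'| <= P * `|v - v'|.

Let E (t : R) : R := expR (- lam * t).

Let E_ge1 t : t <= 0 -> 1 <= E t.
Proof.
move=> t0; rewrite -expR0 ler_expR mulNr oppr_ge0 pmulr_rle0//.
Qed.

(** For [lam > 0] the weight grows as [t] goes to -oo. *)
Definition exp_growth (U : normedModType R) (u : R -> U) : Prop :=
  exists2 C, 0 <= C & forall t, t <= 0 -> `|u t| <= C * expR (- lam * t).

Definition backward_solution (th : R -> V) (a : R -> W) : Prop :=
  [/\ forall t, t <= 0 -> hasd setT th t (F (th t) (a t)),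
      forall t, t <= 0 -> hasd setT a t (eps^-1 *: (h0 (th t) - a t)),
      exp_growth th & exp_growth a].

Lemma backward_solution_exists v0 : exists th a,
  th 0 = v0 /\ backward_solution th a.
Proof.
have [||||||th [a [h1 h2 h3 h4 h5]]] := @backward_exists _ _ _ eps lam Q M P eps0 lam0 el
  Q0 M0 P0 gap cV cW (fun=> F) (fun=> h0) (`|F 0 0| + `|h0 0|) _ _ _ _ _ _ v0.
- by move=> *; exact: F_lip.
- by move=> *; exact: h0_lip.
- by move=> v w t; exact: contd_cst.
- by move=> v t; exact: contd_cst.
- move=> t t0; have := E_ge1 t0; have := normr_ge0 (F 0 0); have := normr_ge0 (h0 0).
  rewrite /E => x0 y0 z1; apply: (@le_trans _ _ ((`|F 0 0| + `|h0 0|) * 1)); first lra.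
  by rewrite ler_wpM2l// addr_ge0.
- move=> t t0; have := E_ge1 t0; have := normr_ge0 (F 0 0); have := normr_ge0 (h0 0).
  rewrite /E => x0 y0 z1; apply: (@le_trans _ _ ((`|F 0 0| + `|h0 0|) * 1)); first lra.
  by rewrite ler_wpM2l// addr_ge0.
- by exists th, a.
Qed.

Lemma exp_growthB (U : normedModType R) (u w : R -> U) :
  exp_growth u -> exp_growth w -> exp_growth (fun t => u t - w t).
Proof.
move=> [C C0 uC] [D D0 wD]; exists (C + D) => [|t t0]; first exact: addr_ge0.
by rewrite mulrDl (le_trans (ler_normB _ _))// lerD ?uC ?wD.
Qed.

Lemma backward_solution_lip th1 a1 th2 a2 :
  backward_solution th1 a1 -> backward_solution th2 a2 ->
  forall t, t <= 0 ->
    `|th1 t - th2 t| <= `|th1 0 - th2 0| * expR (- lam * t) /\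
    `|a1 t - a2 t| <=
      P / (1 - eps * lam) * `|th1 0 - th2 0| * expR (- lam * t).
Proof.
move=> [dth1 da1 gth1 ga1] [dth2 da2 gth2 ga2].
have [C C0 hC] := exp_growthB gth1 gth2; have [D D0 hD] := exp_growthB ga1 ga2.
have := @backward_estimate _ _ _ eps lam Q M P eps0 lam0 el Q0 M0 P0 gap
  (fun t => th1 t - th2 t) (fun t => F (th1 t) (a1 t) - F (th2 t) (a2 t))
  (fun t => a1 t - a2 t) (fun t => h0 (th1 t) - h0 (th2 t)) (C + D) 0 (lexx 0).
rewrite !(mulr0, mul0r, addr0) max_l//.
move=> h t t0; have [] := h _ _ _ _ _ _ t t0.
- by move=> s s0; apply: hasdB; [exact: dth1|exact: dth2].
- move=> s s0; have := hasdB (da1 s s0) (da2 s s0).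
  by congr (hasd _ _ _ _); lmod R.
- by move=> s s0; rewrite mul0r addr0.
- by move=> s s0; rewrite mul0r addr0.
- move=> s s0; apply: le_trans (hC s s0) _; apply: ler_wpM2r; first exact: expR_ge0.
  by rewrite lerDl.
- move=> s s0; apply: le_trans (hD s s0) _; apply: ler_wpM2r; first exact: expR_ge0.
  by rewrite lerDr.
by move=> h1; rewrite addr0 (mulrAC P).
Qed.

Lemma backward_solution_unique th1 a1 th2 a2 :
  backward_solution th1 a1 -> backward_solution th2 a2 -> th1 0 = th2 0 ->
  forall t, t <= 0 -> th1 t = th2 t /\ a1 t = a2 t.
Proof.
move=> b1 b2 e0 t t0; have := backward_solution_lip b1 b2 t0.
rewrite e0 subrr normr0 mulr0 !mul0r !normr_le0 !subr_eq0.
by move=> [/eqP-> /eqP->].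
Qed.

(** The value of [h] at [v] is where the backward solution through [v] has its fast
    component at time 0; a predicate avoids selecting that solution. *)
Definition slow_map (h : V -> W) : Prop :=
  forall th a, backward_solution th a -> a 0 = h (th 0).

Lemma slow_map_exists : exists h, slow_map h.
Proof.
have /choice[p hp] : forall v0, exists p : (R -> V) * (R -> W),
    p.1 0 = v0 /\ backward_solution p.1 p.2.
  by move=> v0; have [th [a H]] := backward_solution_exists v0; exists (th, a).
exists (fun v => (p v).2 0) => th a b; have [e b'] := hp (th 0).
by have [] := backward_solution_unique b b' (esym e) (lexx 0).
Qed.

Lemma backward_solution_shift th a s : s <= 0 -> backward_solution th a ->
  backward_solution (fun t => th (t + s)) (fun t => a (t + s)).
Proof.
move=> s0 [dth da gth ga].
have ts t : t <= 0 -> t + s <= 0 by move=> t0; lra.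
have gs (U : normedModType R) (u : R -> U) : exp_growth u -> exp_growth (fun t => u (t + s)).
  move=> [C C0 hC]; exists (C * E s) => [|t /ts ts0]; first by rewrite mulr_ge0 ?expR_ge0.
  apply: le_trans (hC _ ts0) _.
  by rewrite /E -mulrA -expRD -mulrDr (addrC s).
split; try exact: gs.
- by move=> t /ts /dth; exact: hasd_shift.
- by move=> t /ts /da; exact: hasd_shift.
Qed.

Variable h : V -> W.
Hypothesis hh : slow_map h.

(** A backward solution stopped earlier is again a backward solution. *)
Lemma slow_map_invariant th a : backward_solution th a ->
  forall s, s <= 0 -> a s = h (th s).
Proof.
by move=> b s s0; have := hh (backward_solution_shift s0 b); rewrite !add0r.
Qed.

Lemma slow_map_lip v v' : `|h v - h v'| <= P / (1 - eps * lam) * `|v - v'|.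
Proof.
have [th1 [a1 [<- b1]]] := backward_solution_exists v.
have [th2 [a2 [<- b2]]] := backward_solution_exists v'.
have [_] := backward_solution_lip b1 b2 (lexx 0).
by rewrite mulr0 expR0 mulr1 (hh b1) (hh b2).
Qed.

Hypothesis h0_bd : forall v, `|h0 v| <= MH.

Lemma fast_bound th a : backward_solution th a ->
  forall t, t <= 0 -> `|a t| <= MH.
Proof.
move=> [_ da _ [C C0 aC]] t t0.
have MH0 : 0 <= MH by apply: le_trans (h0_bd 0).
have := @filter_bound _ _ eps0 _ a (fun t => h0 (th t)) 0 lam MH C _ el MH0 da _ aC t t0.
rewrite mulr0 subr0 divr1 oppr0 mul0r expR0 mulr1; apply=> // s s0.
by rewrite mul0r expR0 mulr1.
Qed.

Lemma slow_map_bound v : `|h v| <= MH.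
Proof.
have [th [a [<- b]]] := backward_solution_exists v.
by rewrite -(hh b); exact: fast_bound b _ (lexx 0).
Qed.

Variable Dh0 : V -> V -> W.
Hypothesis Dh0_lin : forall v c x y, Dh0 v (c *: x + y) = c *: Dh0 v x + Dh0 v y.
Hypothesis Dh0_bd : forall v x, `|Dh0 v x| <= P * `|x|.
Hypothesis Dh0_frechet : forall v, frechet h0 (Dh0 v) v.
Hypothesis F_bd : forall v w, `|F v w| <= C2.

Lemma hasd_critical th a t : t <= 0 -> backward_solution th a ->
  hasd setT (fun s => h0 (th s)) t (Dh0 (th t) (F (th t) (a t))).
Proof.
move=> t0 [dth _ _ _].
exact: (hasd_comp (@Dh0_lin (th t)) (@Dh0_bd (th t)) (@Dh0_frechet (th t)) (dth t t0)).
Qed.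

(** The defect [xi = a - h0 theta] satisfies [eps xi' = - eps Dh0 theta' - xi]: it is
    a filtered signal whose input has size [eps]. *)
Lemma defect_bound th a : backward_solution th a ->
  forall t, t <= 0 -> `|a t - h0 (th t)| <= P * C2 * eps.
Proof.
move=> b t t0; have [dth da gth [C C0 aC]] := b.
have MH0 : 0 <= MH by apply: le_trans (h0_bd 0).
have C20 : 0 <= C2 by apply: le_trans (F_bd 0 0).
have B0 : 0 <= P * C2 * eps by rewrite !mulr_ge0// ltW.
have := @filter_bound _ _ eps0 _ (fun t => a t - h0 (th t))
  (fun t => (- eps) *: Dh0 (th t) (F (th t) (a t))) 0 lam (P * C2 * eps) (C + MH)
  _ el B0 _ _ _ t t0.
rewrite mulr0 subr0 divr1 oppr0 mul0r expR0 mulr1; apply=> // s s0.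
- have := hasdB (da s s0) (hasd_critical s0 b).
  congr (hasd _ _ _ _); rewrite !scalerBr !scalerA mulrN mulVf ?gt_eqF//.
  by lmod R.
- rewrite mul0r expR0 mulr1 normrZ normrN gtr0_norm// mulrC ler_pM2r//.
  by rewrite (le_trans (Dh0_bd _ _))// ler_wpM2l.
- rewrite mulrDl; apply: (le_trans (ler_normB _ _)); rewrite lerD ?aC//.
  apply: (@le_trans _ _ (MH * 1)); first by rewrite mulr1.
  by rewrite ler_wpM2l//; exact: E_ge1.
Qed.

Lemma slow_map_near_critical v : `|h v - h0 v| <= P * C2 * eps.
Proof.
have [th [a [<- b]]] := backward_solution_exists v.
by rewrite -(hh b); exact: defect_bound b _ (lexx 0).
Qed.

End slow_map.

(** * The derivative of the slow map *)

Section slow_map_derivative.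
Context (R : realType).
Variables (V W : normedModType R).
Variables (h0 : V -> W) (F : V -> W -> V).
Variables (eps lam nu Q M P C2 Kh : R).
Hypotheses (cV : seq_complete V) (cW : seq_complete W).
Hypotheses (eps0 : 0 < eps) (lam0 : 0 < lam) (el : eps * lam <= 1 / 2).
Hypotheses (Q0 : 0 <= Q) (M0 : 0 <= M) (P0 : 0 <= P) (Kh0 : 0 <= Kh).
Hypothesis gap : Q + M * P / (1 - eps * lam) < lam.
Hypotheses (nu0 : 0 < nu) (el' : eps * (lam + nu) < 1).
Hypothesis gap' : Q + M * P / (1 - eps * (lam + nu)) < lam + nu.
Hypothesis F_lip : forall v w v' w',
  `|F v w - F v' w'| <= Q * `|v - v'| + M * `|w - w'|.
Hypothesis h0_lip : forall v v', `|h0 v - h0 v'| <= P * `|v - v'|.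
Hypothesis F_bd : forall v w, `|F v w| <= C2.

Variables (Dh0 : V -> V -> W) (DF : V -> W -> V -> W -> V).
Hypothesis Dh0_lin : forall v c x y, Dh0 v (c *: x + y) = c *: Dh0 v x + Dh0 v y.
Hypothesis Dh0_bd : forall v x, `|Dh0 v x| <= P * `|x|.
Hypothesis Dh0_rem : forall e : R, 0 < e -> exists2 d : R, 0 < d & forall v x, `|x| <= d ->
  `|h0 (v + x) - h0 v - Dh0 v x| <= e * `|x|.
Hypothesis Dh0_lip : forall v v' x, `|Dh0 v x - Dh0 v' x| <= Kh * `|v - v'| * `|x|.
Hypothesis DF_lin : forall v w c x y p q,
  DF v w (c *: x + y) (c *: p + q) = c *: DF v w x p + DF v w y q.
Hypothesis DF_bd : forall v w x p, `|DF v w x p| <= Q * `|x| + M * `|p|.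
Hypothesis DF_rem : forall e : R, 0 < e -> exists2 d : R, 0 < d & forall v w x p,
  `|x| <= d -> `|p| <= d ->
  `|F (v + x) (w + p) - F v w - DF v w x p| <= e * (`|x| + `|p|).
Let E (t : R) : R := expR (- lam * t).

Let E_ge0 t : 0 <= E t. Proof. exact: expR_ge0. Qed.

Let E_ge1 t : t <= 0 -> 1 <= E t.
Proof.
move=> t0; rewrite -expR0 ler_expR mulNr oppr_ge0 pmulr_rle0//.
Qed.

Let el1 : eps * lam < 1. Proof. by apply: le_lt_trans el _; rewrite ltr_pdivrMr// mul1r ltr1n. Qed.

Let L : R := P / (1 - eps * lam).

Let L0 : 0 <= L.
Proof. by rewrite divr_ge0// subr_ge0 ltW. Qed.

Lemma DF_sub v w x p y q : DF v w (x - y) (p - q) = DF v w x p - DF v w y q.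
Proof.
rewrite (_ : x - y = (-1) *: y + x); last by lmod R.
rewrite (_ : p - q = (-1) *: q + p); last by lmod R.
by rewrite DF_lin; lmod R.
Qed.

Let Dh0_sub v := linear_sub (Dh0_lin v).

Let DF_cont (e : R) : 0 < e -> exists2 d : R, 0 < d & forall v w x p,
  `|x| <= d -> `|p| <= d -> forall y q,
  `|DF (v + x) (w + p) y q - DF v w y q| <= e * (`|y| + `|q|).
Proof.
move=> e0; have [|k k0|d d0 h] := @uniform_derivative_cont _ (V * W)%type V
  (fun z => F z.1 z.2) (fun z x => DF z.1 z.2 x.1 x.2) _ _ e e0.
- by move=> [v w] c [x p] [y q]; exact: DF_lin.
- have [d d0 h] := DF_rem (divr_gt0 k0 (@ltr0n R 2)); exists d => // z x xd.
  have h1 := fst_norm_le x; have h2 := snd_norm_le x.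
  apply: le_trans (h z.1 z.2 _ _ (le_trans h1 xd) (le_trans h2 xd)) _.
  by have := ler_wpM2l (ltW k0) (lerD h1 h2); lra.
exists d => // v w x p xd pd y q.
apply: le_trans (h (v, w) (x, p) (pair_norm_le xd pd) (y, q)) _.
by apply: ler_wpM2l; [exact: ltW|apply: pair_norm_le; rewrite ?lerDl ?lerDr].
Qed.

Definition tangent_solution (th : R -> V) (a : R -> W) (v : R -> V) (al : R -> W) :=
  [/\ forall t, t <= 0 -> hasd setT v t (DF (th t) (a t) (v t) (al t)),
      forall t, t <= 0 -> hasd setT al t (eps^-1 *: (Dh0 (th t) (v t) - al t)),
      exp_growth lam v & exp_growth lam al].

Notation bsol := (backward_solution h0 F eps lam).

Lemma tangent_solution_exists th a v0 : bsol th a ->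
  exists v al, v 0 = v0 /\ tangent_solution th a v al.
Proof.
move=> [dth da _ _].
pose thc (t : R) := th (Num.min t 0); pose ac (t : R) := a (Num.min t 0).
have min0 (t : R) : Num.min t 0 <= 0 by rewrite ge_min lexx orbT.
have cth t : contd setT thc t by apply: contd_min0; exact: hasd_contd (dth _ (min0 t)).
have ca t : contd setT ac t by apply: contd_min0; exact: hasd_contd (da _ (min0 t)).
have [||||||v [al [h1 h2 h3 h4 h5]]] := @backward_exists _ _ _ eps lam Q M P eps0 lam0 el1
  Q0 M0 P0 gap cV cW (fun t => DF (thc t) (ac t)) (fun t => Dh0 (thc t)) 0 _ _ _ _ _ _ v0.
- by move=> t v w v' w'; rewrite -DF_sub; exact: DF_bd.
- by move=> t v v'; rewrite -Dh0_sub; exact: Dh0_bd.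
- move=> v w t e e0.
  have vw1 : 0 < `|v| + `|w| + 1 by rewrite ltr_wpDl// addr_ge0.
  have [d d0 hd] := DF_cont (divr_gt0 e0 vw1).
  have [d1 d10 k1] := cth t d d0; have [d2 d20 k2] := ca t d d0.
  exists (Num.min d1 d2) => [|s Is]; first by rewrite lt_min d10.
  rewrite lt_min => /andP[s1 s2].
  have := hd (thc t) (ac t) _ _ (k1 s Is s1) (k2 s Is s2) v w.
  rewrite !subrKC => /le_trans; apply.
  by apply: ler_div_absorb; [exact: ltW|rewrite addr_ge0].
- move=> v t e e0.
  have v1 : 0 < Kh * `|v| + 1 by rewrite ltr_wpDl// mulr_ge0.
  have [d1 d10 k1] := cth t _ (divr_gt0 e0 v1).
  exists d1 => // s Is s1; apply: le_trans (Dh0_lip _ _ _) _.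
  rewrite mulrAC; apply: le_trans (ler_wpM2l _ (k1 s Is s1)) _; first by rewrite mulr_ge0.
  rewrite mulrC; apply: ler_div_absorb; [exact: ltW|by rewrite mulr_ge0].
- move=> t _; have := DF_bd (thc t) (ac t) 0 0.
  by rewrite !normr0 !mulr0 addr0 mul0r.
- by move=> t _; have := Dh0_bd (thc t) 0; rewrite !normr0 !mulr0 mul0r.
exists v, al; split=> //; split=> // t t0.
- by have := h2 t t0; rewrite /thc /ac min_l.
- by have := h3 t t0; rewrite /thc min_l.
Qed.

Lemma tangent_solution_bound th a v al : tangent_solution th a v al ->
  forall t, t <= 0 -> `|v t| <= `|v 0| * E t /\ `|al t| <= L * `|v 0| * E t.
Proof.
move=> [dv dal [C C0 hC] [D D0 hD]].
have := @backward_estimate _ _ _ eps lam Q M P eps0 lam0 el1 Q0 M0 P0 gap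
  v (fun t => DF (th t) (a t) (v t) (al t)) al (fun t => Dh0 (th t) (v t))
  (C + D) 0 (lexx 0).
rewrite !(mulr0, mul0r, addr0) max_l//.
move=> H t t0; have [] := H _ _ _ _ _ _ t t0 => //.
- by move=> s s0; rewrite mul0r addr0.
- by move=> s s0; rewrite mul0r addr0.
- by move=> s s0; apply: le_trans (hC s s0) _; rewrite ler_wpM2r// lerDl.
- by move=> s s0; apply: le_trans (hD s s0) _; rewrite ler_wpM2r// lerDr.
by move=> h1; rewrite addr0 /L (mulrAC P).
Qed.

Lemma exp_growth_lin (U : normedModType R) (u w : R -> U) c :
  exp_growth lam u -> exp_growth lam w -> exp_growth lam (fun t => c *: u t + w t).
Proof.
move=> [C C0 uC] [D D0 wD]; exists (`|c| * C + D) => [|t t0].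
  by rewrite addr_ge0// mulr_ge0.
rewrite mulrDl (le_trans (ler_normD _ _))// lerD ?wD//.
by rewrite normrZ -mulrA ler_wpM2l// uC.
Qed.

Lemma tangent_solution_lin th a c v al v' al' :
  tangent_solution th a v al -> tangent_solution th a v' al' ->
  tangent_solution th a (fun t => c *: v t + v' t) (fun t => c *: al t + al' t).
Proof.
move=> [dv dal gv gal] [dv' dal' gv' gal']; split; try exact: exp_growth_lin.
- move=> t t0; rewrite DF_lin; apply: hasdD; last exact: dv'.
  by apply: hasdZ; exact: dv.
- move=> t t0; have := hasdD (hasdZ c (dal t t0)) (dal' t t0).
  by congr (hasd _ _ _ _); rewrite Dh0_lin; lmod R.
Qed.

Lemma tangent_solution_unique th a th' a' v al v' al' : bsol th a -> bsol th' a' ->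
  tangent_solution th a v al -> tangent_solution th' a' v' al' ->
  th 0 = th' 0 -> v 0 = v' 0 -> al 0 = al' 0.
Proof.
move=> b b' t1 [dv2 dal2 gv2 gal2] th0 v0.
have same := backward_solution_unique eps0 lam0 el1 Q0 M0 P0 gap F_lip h0_lip b b' th0.
have t2 : tangent_solution th a v' al'.
  split=> // t t0; first by have [-> ->] := same t t0; exact: dv2.
  by have [-> _] := same t t0; exact: dal2.
have [_] := tangent_solution_bound (tangent_solution_lin (-1) t1 t2) (lexx 0).
rewrite v0 !scaleN1r (addNr (v' 0)) normr0 mulr0 mul0r normr_le0 addrC subr_eq0.
by move/eqP.
Qed.

Definition tangent_map (h' : V -> V -> W) : Prop := forall th a v al,
  bsol th a -> tangent_solution th a v al -> al 0 = h' (th 0) (v 0).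

Lemma tangent_solution_through v0 x0 : exists th a v al,
  [/\ bsol th a, tangent_solution th a v al, th 0 = v0 & v 0 = x0].
Proof.
have [th [a [th0 b]]] := backward_solution_exists cV cW eps0 lam0 el1 Q0 M0 P0 gap F_lip h0_lip v0.
have [v [al [vx t]]] := tangent_solution_exists x0 b.
by exists th, a, v, al.
Qed.

Lemma tangent_map_exists : exists h', tangent_map h'.
Proof.
have /choice[p hp] : forall q : V * V, exists p : W, exists th a v al,
    [/\ bsol th a, tangent_solution th a v al, th 0 = q.1, v 0 = q.2 & al 0 = p].
  move=> [v0 x0]; have [th [a [v [al [h1 h2 h3 h4]]]]] := tangent_solution_through v0 x0.
  by exists (al 0), th, a, v, al.
exists (fun v0 x0 => p (v0, x0)) => th a v al b t.
have [th' [a' [v' [al' [h1 h2 h3 h4 <-]]]]] := hp (th 0, v 0).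
exact: (tangent_solution_unique b h1 t h2 (esym h3) (esym h4)).
Qed.

Section with_slow_map.
Variables (h : V -> W) (h' : V -> V -> W).
Hypotheses (hh : slow_map h0 F eps lam h) (hh' : tangent_map h').

Lemma tangent_map_lin v c x y : h' v (c *: x + y) = c *: h' v x + h' v y.
Proof.
have [th [a [v1 [al1 [b t1 <- <-]]]]] := tangent_solution_through v x.
have [v2 [al2 [<- t2]]] := tangent_solution_exists y b.
by rewrite -(hh' b t1) -(hh' b t2) -(hh' b (tangent_solution_lin c t1 t2)).
Qed.

Lemma tangent_map_bd v x : `|h' v x| <= L * `|x|.
Proof.
have [th [a [v1 [al1 [b t1 <- <-]]]]] := tangent_solution_through v x.
rewrite -(hh' b t1); have [_] := tangent_solution_bound t1 (lexx 0).
by rewrite /E mulr0 expR0 mulr1.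
Qed.

(** Far in the past the slack [nu] of the weight absorbs any constant; on the
    remaining bounded time interval a small initial difference stays small. *)
Lemma weight_split (K e d : R) : 0 <= K -> 0 < e -> 0 < d ->
  exists2 rho : R, 0 < rho & forall s t : R, 0 <= s <= rho -> t <= 0 ->
    s * E t <= d \/ K <= e * expR (- nu * t).
Proof.
move=> K0 e0 d0; have [T T0 hT] := expR_small nu0 K0 e0.
exists (d * expR (- (lam * T))) => [|s t /andP[s0 sr] t0].
  by rewrite mulr_gt0// expR_gt0.
have [tT|tT] := leP t (- T).
  right; have := hT t tT; rewrite -ler_pdivlMr ?expR_gt0//.
  by rewrite -expRN -mulNr.
left; apply: le_trans (ler_wpM2r (E_ge0 t) sr) _.
rewrite -mulrA ler_piMr//; first exact: ltW.
rewrite /E -expRD expR_le1 -mulrN mulNr -mulrN -mulrDr.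
by rewrite pmulr_rle0//; lra.
Qed.

(** How a remainder that is small for small increments, and merely bounded by [K]
    in general, becomes small in the heavier weight [lam + nu]. *)
Lemma weight_absorb (K e d : R) : 0 <= K -> 0 < e -> 0 < d ->
  exists2 rho : R, 0 < rho & forall s t X Y : R, 0 <= s <= rho -> t <= 0 -> 0 <= Y ->
    (s * E t <= d -> X <= e * Y) -> X <= K * Y ->
    X <= e * expR (- nu * t) * Y.
Proof.
move=> K0 e0 d0; have [rho rho0 hr] := weight_split K0 e0 d0.
exists rho => // s t X Y srho t0 Y0 h1 h2.
have [/h1 XeY|h3] := hr s t srho t0; last first.
  by apply: le_trans h2 _; exact: ler_wpM2r.
apply: le_trans XeY _; apply: ler_wpM2r => //; apply: ler_peMr; first exact: ltW.
by rewrite -expR0 ler_expR mulNr oppr_ge0 pmulr_rle0.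
Qed.

Let lam' := lam + nu.
Let lam'0 : 0 < lam'. Proof. by rewrite addr_gt0. Qed.

Let EE t : expR (- nu * t) * E t = expR (- lam' * t).
Proof. by rewrite /E -expRD -mulrDl /lam' opprD addrC. Qed.

Let Kfin : R := (P * ((1 + M / (1 - eps * lam')) / (lam' - (Q + M * P / (1 - eps * lam')))) + 1)
  / (1 - eps * lam').

Let Kfin0 : 0 <= Kfin.
Proof.
have e1 : 0 <= 1 - eps * lam' by rewrite subr_ge0 ltW.
rewrite divr_ge0// addr_ge0// mulr_ge0// divr_ge0//; last by rewrite subr_ge0 ltW.
by rewrite addr_ge0// divr_ge0.
Qed.

Lemma wider_growth (U : normedModType R) (u : R -> U) : exp_growth lam u ->
  exists2 C, 0 <= C & forall t, t <= 0 -> `|u t| <= C * expR (- lam' * t).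
Proof.
move=> [C C0 uC]; exists C => // t t0; apply: le_trans (uC t t0) _.
rewrite ler_wpM2l// ler_expR !mulNr lerN2.
by rewrite ler_wnM2r// /lam' lerDl ltW.
Qed.

(** A forcing of size [Er] in the heavier weight moves the fast component at time 0
    by at most a constant times [Er]. *)
Lemma forced_estimate (D D' : R -> V) (a g : R -> W) (Er : R) : 0 <= Er ->
  (forall t, t <= 0 -> hasd setT D t (D' t)) ->
  (forall t, t <= 0 -> hasd setT a t (eps^-1 *: (g t - a t))) ->
  (forall t, t <= 0 -> `|D' t| <= Q * `|D t| + M * `|a t| + Er * expR (- lam' * t)) ->
  (forall t, t <= 0 -> `|g t| <= P * `|D t| + Er * expR (- lam' * t)) ->
  exp_growth lam D -> exp_growth lam a -> D 0 = 0 -> `|a 0| <= Kfin * Er.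
Proof.
move=> Er0 dD da DB gB /wider_growth[C C0 hC] /wider_growth[C' C'0 hC'] D0.
have := @backward_estimate _ _ _ eps lam' Q M P eps0 lam'0 el' Q0 M0 P0 gap'
  D D' a g (C + C') Er Er0 dD da DB gB.
rewrite /= D0 normr0 max_r; last first.
  have e1 : 0 <= 1 - eps * lam' by rewrite subr_ge0 ltW.
  have g1 : 0 <= lam' - (Q + M * P / (1 - eps * lam')) by rewrite subr_ge0 ltW.
  apply: divr_ge0 => //; apply: mulr_ge0 => //; apply: addr_ge0 => //.
  exact: divr_ge0.
move=> H; have [] := H _ _ 0 (lexx 0).
- move=> t t0; apply: le_trans (hC t t0) _; rewrite ler_wpM2r ?expR_ge0// lerDl//.
- move=> t t0; apply: le_trans (hC' t t0) _; rewrite ler_wpM2r ?expR_ge0// lerDr//.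
move=> _; rewrite mulr0 expR0 mulr1 => /le_trans; apply.
rewrite le_eqVlt; apply/orP; left; apply/eqP; rewrite /Kfin.
by move: (lam' - _)^-1 => y; move: (1 - eps * lam')^-1 => x; ring.
Qed.

Lemma eps_over (e B : R) : 0 < e -> 0 <= B ->
  exists2 e1 : R, 0 < e1 & B * e1 <= e.
Proof.
move=> e0 B0; exists (e / (B + 1)); first by rewrite divr_gt0// ltr_wpDl.
by rewrite mulrC; apply: ler_div_absorb => //; exact: ltW.
Qed.

Let B := 1 + L.
Let B0 : 0 <= B. Proof. by rewrite addr_ge0. Qed.

(** The difference between an exact increment and the tangent solution solves the
    linearized system with the Taylor remainders of [F] and [h0] as forcing. *)
Lemma slow_map_rem (e : R) : 0 < e -> exists2 d : R, 0 < d & forall v x, `|x| <= d ->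
  `|h (v + x) - h v - h' v x| <= e * `|x|.
Proof.
move=> e0.
have [e1 e10 he1] : exists2 e1 : R, 0 < e1 & Kfin * (e1 * B) <= e.
  have KB0 : 0 <= Kfin * B by rewrite mulr_ge0.
  by have [e1 e10 H] := eps_over e0 KB0; exists e1; rewrite // mulrCA mulrC.
have [d1 d10 hF] := DF_rem e10; have [d2 d20 hH] := Dh0_rem e10.
have K0 : 0 <= 2 * (Q + M) + 2 * P by rewrite addr_ge0// mulr_ge0// addr_ge0.
have d12 : 0 < Num.min d1 d2 by rewrite lt_min d10.
have [rho rho0 absorb] := weight_absorb K0 e10 d12.
exists (rho / (B + 1)); first by rewrite divr_gt0// ltr_wpDl.
move=> v x xd.
suff H y : `|y - v| <= rho / (B + 1) -> `|h y - h v - h' v (y - v)| <= e * `|y - v|.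
  by have := H (v + x); rewrite (_ : v + x - v = x); [exact|lmod R].
move=> yv {x xd}.
have [th0 [a0 [v1 [al1 [b0 t1 thv v1y]]]]] := tangent_solution_through v (y - v).
have [th1 [a1 [th1y b1]]] := backward_solution_exists cV cW eps0 lam0 el1 Q0 M0 P0 gap F_lip h0_lip y.
have lip := backward_solution_lip eps0 lam0 el1 Q0 M0 P0 gap F_lip h0_lip b1 b0.
rewrite th1y thv -/L in lip.
have := hh' b0 t1; rewrite thv v1y => <-.
have := hh b0; rewrite thv => <-; have := hh b1; rewrite th1y => <-.
have [dth0 da0 gth0 ga0] := b0; have [dth1 da1 gth1 ga1] := b1.
have [dv dal gv gal] := t1.
pose dth t := th1 t - th0 t; pose da t := a1 t - a0 t.
have sum_bound t : t <= 0 -> `|dth t| + `|da t| <= B * `|y - v| * E t.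
  by move=> t0; have [h1 h2] := lip t t0; rewrite /B /dth /da /E; lra.
have small : 0 <= B * `|y - v| <= rho.
  rewrite mulr_ge0//=; apply: le_trans (ler_wpM2l B0 yv) _.
  by rewrite mulrC; apply: ler_div_absorb => //; exact: ltW.
(* a remainder that is o(1) for small increments and O(1) in general *)
have key t X : t <= 0 ->
    (`|dth t| <= d1 -> `|dth t| <= d2 -> `|da t| <= d1 -> X <= e1 * (`|dth t| + `|da t|)) ->
    X <= (2 * (Q + M) + 2 * P) * (`|dth t| + `|da t|) ->
    X <= e1 * B * `|y - v| * expR (- lam' * t).
  move=> t0 Xs Xb; have n1 := normr_ge0 (dth t); have n2 := normr_ge0 (da t).
  apply: le_trans (absorb _ t X _ small t0 (addr_ge0 n1 n2) _ Xb) _.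
    by move=> /(le_trans (sum_bound t t0)); rewrite le_min => /andP[s1 s2]; apply: Xs; lra.
  rewrite [leRHS](_ : _ = e1 * expR (- nu * t) * (B * `|y - v| * E t)); last first.
    by rewrite -EE; ring.
  by apply: ler_wpM2l (sum_bound t t0); apply: mulr_ge0; [exact: ltW|exact: expR_ge0].
have cross t := (mulr_ge0 Q0 (normr_ge0 (da t)), mulr_ge0 M0 (normr_ge0 (dth t)),
  mulr_ge0 P0 (normr_ge0 (da t)), mulr_ge0 P0 (normr_ge0 (dth t)),
  mulr_ge0 Q0 (normr_ge0 (dth t)), mulr_ge0 M0 (normr_ge0 (da t))).
have RF t : t <= 0 ->
  `|F (th1 t) (a1 t) - F (th0 t) (a0 t) - DF (th0 t) (a0 t) (dth t) (da t)|
    <= e1 * B * `|y - v| * expR (- lam' * t).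
  move=> t0; apply: key => // [x1 _ x2|].
    have dxy : F (th1 t) (a1 t) = F (th0 t + dth t) (a0 t + da t) by rewrite !subrKC.
    by rewrite dxy; exact: hF.
  apply: (le_trans (ler_normB _ _)); move: (cross t).
  move: (F_lip (th1 t) (a1 t) (th0 t) (a0 t)) (DF_bd (th0 t) (a0 t) (dth t) (da t)).
  by rewrite -/(dth t) -/(da t) => f1 f2 [[[[[? ?] ?] ?] ?] ?]; lra.
have RH t : t <= 0 ->
  `|h0 (th1 t) - h0 (th0 t) - Dh0 (th0 t) (dth t)| <= e1 * B * `|y - v| * expR (- lam' * t).
  move=> t0; apply: key => // [_ x2 _|].
    have dxy : h0 (th1 t) = h0 (th0 t + dth t) by rewrite !subrKC.
    by rewrite dxy; apply: le_trans (hH _ _ x2) _; rewrite ler_pM2l// lerDl.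
  apply: (le_trans (ler_normB _ _)); move: (cross t).
  move: (h0_lip (th1 t) (th0 t)) (Dh0_bd (th0 t) (dth t)).
  by rewrite -/(dth t) => f1 f2 [[[[[? ?] ?] ?] ?] ?]; lra.
have Er0 : 0 <= e1 * B * `|y - v| by rewrite !mulr_ge0// ltW.
have := @forced_estimate (fun t => dth t - v1 t)
  (fun t => F (th1 t) (a1 t) - F (th0 t) (a0 t) - DF (th0 t) (a0 t) (v1 t) (al1 t))
  (fun t => da t - al1 t) (fun t => h0 (th1 t) - h0 (th0 t) - Dh0 (th0 t) (v1 t))
  (e1 * B * `|y - v|) Er0.
move=> H; apply: le_trans (H _ _ _ _ _ _ _) _.
- move=> t t0; apply: hasdB; last exact: dv.
  by apply: hasdB; [exact: dth1|exact: dth0].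
- move=> t t0; have := hasdB (hasdB (da1 t t0) (da0 t t0)) (dal t t0).
  by congr (hasd _ _ _ _); rewrite /da; lmod R.
- move=> t t0.
  rewrite (_ : _ - _ - _ =
    (F (th1 t) (a1 t) - F (th0 t) (a0 t) - DF (th0 t) (a0 t) (dth t) (da t))
    + DF (th0 t) (a0 t) (dth t - v1 t) (da t - al1 t)); last first.
    by rewrite (DF_sub (th0 t) (a0 t) (dth t) (da t) (v1 t)); lmod R.
  apply: (le_trans (ler_normD _ _)); rewrite addrC; apply: lerD; [exact: DF_bd|exact: RF].
- move=> t t0.
  rewrite (_ : _ - _ - _ = (h0 (th1 t) - h0 (th0 t) - Dh0 (th0 t) (dth t))
    + Dh0 (th0 t) (dth t - v1 t)); last by rewrite (Dh0_sub (th0 t) (dth t) (v1 t)); lmod R.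
  apply: (le_trans (ler_normD _ _)); rewrite addrC; apply: lerD; [exact: Dh0_bd|exact: RH].
- by apply: exp_growthB => //; exact: exp_growthB.
- by apply: exp_growthB => //; exact: exp_growthB.
- by rewrite /dth th1y thv v1y subrr.
by rewrite !mulrA in he1 *; apply: ler_wpM2r.
Qed.

(** [al] is the filtered signal [Dh0 (th t) (u t)]. That signal is off its value at
    time 0 by [O(- t)] up to exponential weights, and the filter only remembers a
    time of order [eps]: [nt_le] trades [- t] for [4 eps exp (- t / (4 eps))]. *)
Lemma tangent_map_near_critical v x :
  `|h' v x - Dh0 v x| <= 16 * (Kh * C2 + P * lam) * eps * `|x|.
Proof.
have C20 : 0 <= C2 by apply: le_trans (F_bd 0 0).
have [th [a [u [al [b t1 thv ux]]]]] := tangent_solution_through v x.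
have := hh' b t1; rewrite thv ux => <-.
have [dth da gth ga] := b; have [du dal gu [C C0 hC]] := t1.
have th_near t : t <= 0 -> `|th t - v| <= C2 * - t.
  move=> t0; rewrite -thv distrC.
  rewrite (_ : C2 * - t = C2 * 0 - C2 * t); last by ring.
  apply: (@mean_value_hasd _ _ th (fun t => F (th t) (a t)) (fun t => C2 * t)
    (fun=> C2 * 1)) => // s /andP[ts s0].
  - exact: hasd_sub (dth s s0).
  - exact/hasdZl/hasd_id.
  - by rewrite mulr1.
have u_bound t : t <= 0 -> `|u t| <= `|x| * E t.
  by move=> t0; have [] := tangent_solution_bound t1 t0; rewrite ux.
have u_near t : t <= 0 -> `|u t - x| <= `|x| * (E t - 1).
  move=> t0; rewrite -[in `|u t - x|]ux.
  have H : forall s, s <= 0 -> `|DF (th s) (a s) (u s) (al s)| <= lam * `|x| * expR (- lam * s).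
    move=> s s0; apply: le_trans (DF_bd _ _ _ _) _.
    have [h1 h2] := tangent_solution_bound t1 s0; rewrite ux in h1 h2.
    apply: le_trans (lerD (ler_wpM2l Q0 h1) (ler_wpM2l M0 h2)) _.
    rewrite /E (_ : _ + _ = (Q + M * P / (1 - eps * lam)) * (`|x| * expR (- lam * s))); last first.
      by rewrite /L; ring.
    rewrite -[leRHS]mulrA; apply: ler_wpM2r; last exact: ltW.
    by apply: mulr_ge0 => //; exact: expR_ge0.
  have := growth_bound lam0 du H t0.
  by rewrite -/(E t) (mulrAC lam) mulfV ?gt_eqF// mul1r.
(* the rate [1 / (4 eps)] leaves room below [1 / eps] once [lam <= 1 / (2 eps)] is added *)
have nt_le t : t <= 0 -> - t <= 4 * eps * expR (- (4 * eps)^-1 * t).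
  move=> t0; rewrite mulrC -ler_pdivrMr ?mulr_gt0//.
  by apply: le_trans (expR_ge1Dx _); rewrite [leLHS](_ : _ = - (4 * eps)^-1 * t); [rewrite lerDr|ring].
have E1 t : E t - 1 <= lam * - t * E t.
  have := ler_wpM2r (E_ge0 t) (expR_ge1Dx (lam * t)).
  by rewrite {2}/E -expRD -mulrDl addrN mul0r expR0; lra.
pose lam2 := lam + (4 * eps)^-1.
pose B2 := (Kh * C2 + P * lam) * `|x| * (4 * eps).
have B20 : 0 <= B2.
  apply: mulr_ge0; last by rewrite mulr_ge0// ltW.
  by rewrite mulr_ge0// addr_ge0// mulr_ge0// ltW.
have e2 : eps * lam2 = eps * lam + 1 / 4.
  by rewrite /lam2; field; rewrite gt_eqF.
have fB t : t <= 0 -> `|Dh0 (th t) (u t) - Dh0 v x| <= B2 * expR (- lam2 * t).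
  move=> t0.
  rewrite (_ : _ - _ = (Dh0 (th t) (u t) - Dh0 v (u t)) + Dh0 v (u t - x)); last first.
    by rewrite Dh0_sub; lmod R.
  apply: (le_trans (ler_normD _ _)).
  have nt0 : 0 <= - t by rewrite oppr_ge0.
  have h1 : `|Dh0 (th t) (u t) - Dh0 v (u t)| <= Kh * (C2 * - t) * (`|x| * E t).
    apply: le_trans (Dh0_lip _ _ _) _.
    by apply: ler_pM; rewrite ?mulr_ge0 ?u_bound ?ler_wpM2l ?th_near.
  have h2 : `|Dh0 v (u t - x)| <= P * (`|x| * (lam * - t * E t)).
    apply: le_trans (Dh0_bd _ _) _; apply: ler_wpM2l => //.
    by apply: le_trans (u_near t t0) _; exact: ler_wpM2l.
  apply: le_trans (lerD h1 h2) _.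
  rewrite (_ : _ + _ = (Kh * C2 + P * lam) * `|x| * E t * - t); last by ring.
  have c0 : 0 <= (Kh * C2 + P * lam) * `|x| * E t.
    by rewrite !mulr_ge0// addr_ge0// mulr_ge0// ltW.
  apply: le_trans (ler_wpM2l c0 (nt_le t t0)) _.
  have -> : expR (- lam2 * t) = E t * expR (- (4 * eps)^-1 * t).
    by rewrite /E -expRD -mulrDl -opprD.
  by rewrite /B2 le_eqVlt; apply/orP; left; apply/eqP; ring.
have := @filter_bound _ _ eps0 _ (fun t => al t - Dh0 v x)
  (fun t => Dh0 (th t) (u t) - Dh0 v x) lam2 lam B2 (C + `|Dh0 v x|)
  _ el1 B20 _ fB _ 0 (lexx 0).
rewrite mulr0 expR0 mulr1 e2 => H.
apply: le_trans (H _ _ _) _.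
- by move: (eps * lam) el => p p2; lra.
- move=> t t0; have := hasdB (dal t t0) (@hasd_cst _ _ setT (Dh0 v x) t).
  by congr (hasd _ _ _ _); lmod R.
- move=> t t0; apply: (le_trans (ler_normB _ _)); rewrite mulrDl.
  apply: lerD; first exact: hC.
  by apply: ler_peMr => //; exact: E_ge1.
rewrite ler_pdivrMr; last by move: (eps * lam) el => p p2; lra.
rewrite /B2.
have X0 : 0 <= (Kh * C2 + P * lam) * eps * `|x|.
  by rewrite !mulr_ge0 ?(ltW eps0)// addr_ge0// mulr_ge0// ltW.
move: X0; move: ((Kh * C2 + P * lam)) => k k0.
rewrite [leLHS](_ : _ = 4 * (k * eps * `|x|)); last by ring.
rewrite [leRHS](_ : _ = (k * eps * `|x|) * (16 * (1 - (eps * lam + 1 / 4)))); last by ring.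
by rewrite mulrC; apply: ler_wpM2l => //; move: (eps * lam) el => p p2; lra.
Qed.

End with_slow_map.
End slow_map_derivative.

(** * Attraction towards the slow manifold *)

Section forward_solutions.
Context (R : realType).
Variables (V W : normedModType R).
Variables (h0 : V -> W) (F F0 : V -> W -> V) (h : V -> W) (h' : V -> V -> W).
Variables (eps lam Q M L MH : R).
Hypotheses (eps0 : 0 < eps) (Q0 : 0 <= Q) (M0 : 0 <= M) (L0 : 0 <= L).
Hypothesis small : eps * (L * M) <= 1 / 2.
Hypothesis F_lip : forall v w v' w',
  `|F v w - F v' w'| <= Q * `|v - v'| + M * `|w - w'|.
Hypothesis F0_lip : forall v w w', `|F0 v w - F0 v w'| <= M * `|w - w'|.
Hypothesis F0_F : forall v w, `|w| <= MH -> F0 v w = F v w.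
Hypothesis h_bd : forall v, `|h v| <= MH.
Hypothesis h_lip : forall v v', `|h v - h v'| <= L * `|v - v'|.
Hypothesis h'_lin : forall v c x y, h' v (c *: x + y) = c *: h' v x + h' v y.
Hypothesis h'_bd : forall v x, `|h' v x| <= L * `|x|.
Hypothesis h_frechet : forall v, frechet h (h' v) v.

(** Two expressions of the derivative at time 0 of [a = h \o th]. *)
Lemma invariance_equation th a : slow_map h0 F eps lam h ->
  (forall s, s <= 0 -> a s = h (th s)) ->
  backward_solution h0 F eps lam th a ->
  h' (th 0) (F (th 0) (h (th 0))) = eps^-1 *: (h0 (th 0) - h (th 0)).
Proof.
move=> hh ah [dth da _ _].
have a0 : a 0 = h (th 0) by exact: ah.
apply: (@hasd_unique_left _ _ a 0).
  apply: (@hasd_eq _ _ _ (h \o th)); first by rewrite /= in_itv/=.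
    by move=> s; rewrite /= in_itv/= => s0; rewrite ah.
  rewrite -a0; apply: (hasd_comp (@h'_lin (th 0)) (@h'_bd (th 0)) (@h_frechet (th 0))).
  exact: hasd_sub (dth 0 (lexx 0)).
rewrite -a0; exact: hasd_sub (da 0 (lexx 0)).
Qed.

(** [F0] is the vector field without cut-off; it agrees with [F] on the graph of [h],
    which is all that matters below. *)
Definition forward_solution (t1 : R) (a : R -> W) (th : R -> V) : Prop :=
  forall t, 0 <= t <= t1 ->
    hasd `[0, t1]%classic a t (eps^-1 *: (h0 (th t) - a t)) /\
    hasd `[0, t1]%classic th t (F0 (th t) (a t)).

Hypothesis h_inv : forall v, h' v (F v (h v)) = eps^-1 *: (h0 v - h v).

(** Along any solution [z = a - h th] satisfies, by the invariance equation,
    [z' = - z / eps - h' (F0 (th, a) - F0 (th, h th))], and the last term is at most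
    [L M `|z|], half of the damping. *)
Lemma attraction t1 a th : forward_solution t1 a th ->
  forall t, 0 <= t <= t1 ->
  `|a t - h (th t)| <= expR (- ((2 * eps)^-1 * t)) * `|a 0 - h (th 0)|.
Proof.
move=> sol t tt1.
pose z s := a s - h (th s).
pose w s := expR (eps^-1 * s) *: z s.
have LM0 : 0 <= L * M by rewrite mulr_ge0.
have dw s : 0 <= s <= t1 -> hasd `[0, t1]%classic w s
    (- (expR (eps^-1 * s) *: h' (th s) (F0 (th s) (a s) - F0 (th s) (h (th s))))).
  move=> st; have [da dth] := sol s st.
  have dh := hasd_comp (@h'_lin (th s)) (@h'_bd (th s)) (@h_frechet (th s)) dth.
  have := hasdM (@hasd_expRM _ `[0, t1]%classic eps^-1 s) (hasdB da dh).
  congr (hasd _ _ _ _).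
  rewrite (linear_sub (h'_lin _)) (F0_F _ (h_bd _)) h_inv /=; lmod R.
have w_bd s : 0 <= s <= t1 ->
    `|- (expR (eps^-1 * s) *: h' (th s) (F0 (th s) (a s) - F0 (th s) (h (th s))))|
      <= L * M * `|w s| + 0.
  move=> st; rewrite normrN normrZ /w normrZ addr0 mulrCA.
  apply: ler_wpM2l => //; rewrite -mulrA; apply: le_trans (h'_bd _ _) _.
  by apply: ler_wpM2l.
have := @gronwall _ _ w _ (fun s => `|z 0| * expR (L * M * s))
  (fun s => `|z 0| * (L * M * expR (L * M * s))) (fun=> 0) (L * M) 0 t1 LM0 dw _ w_bd
  _ _ t tt1.
move=> H.
have {}H : `|w t| <= `|z 0| * expR (L * M * t).
  apply: H.
  - by move=> s _; exact/hasdZl/hasd_expRM.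
  - by move=> s _; rewrite addr0 mulrCA.
  - by rewrite /w !mulr0 expR0 scale1r mulr1.
have -> : a t - h (th t) = expR (- eps^-1 * t) *: w t.
  by rewrite /w scalerA -expRD -mulrDl addNr mul0r expR0 scale1r.
rewrite normrZ ger0_norm ?expR_ge0//.
apply: le_trans (ler_wpM2l (expR_ge0 _) H) _.
rewrite mulrCA mulrC ler_wpM2r// -expRD -mulrDl ler_expR -mulNr.
apply: ler_wpM2r; first by case/andP: tt1.
rewrite -(ler_pM2l eps0) mulrDr mulrN mulfV ?gt_eqF//.
rewrite (_ : eps * - (2 * eps)^-1 = - (1 / 2)); last by field; rewrite gt_eqF.
by move: (eps * (L * M)) small => p p2; lra.
Qed.

(** The slow components are driven apart by [z] only, whose integral over time is of
    order [eps]. *)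
Lemma forward_close t1 a th abar thbar : forward_solution t1 a th ->
  forward_solution t1 abar thbar -> thbar 0 = th 0 -> abar 0 = h (th 0) ->
  forall t, 0 <= t <= t1 -> `|th t - thbar t| <=
    2 * M * expR ((Q + M * L) * t) * eps * `|a 0 - h (th 0)|.
Proof.
move=> sol solb e0 b0 t tt1.
have on s : 0 <= s <= t1 -> abar s = h (thbar s).
  move=> st; apply/eqP; rewrite -subr_eq0 -normr_le0.
  apply: le_trans (attraction solb st) _.
  by rewrite e0 b0 subrr normr0 mulr0.
pose K := Q + M * L; have K0 : 0 <= K by rewrite addr_ge0// mulr_ge0.
pose k := (2 * eps)^-1; have k0 : 0 < k by rewrite invr_gt0 mulr_gt0.
pose n := `|a 0 - h (th 0)|; have n0 : 0 <= n by exact: normr_ge0.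
pose c := 2 * M * eps * n.
have c0 : 0 <= c by rewrite !mulr_ge0// ltW.
have ck : c * k = M * n by rewrite /c /k; field; rewrite gt_eqF.
have D_bd s : 0 <= s <= t1 -> `|F0 (th s) (a s) - F0 (thbar s) (abar s)| <=
    K * `|th s - thbar s| + M * n * expR (- k * s).
  move=> st; rewrite (on s st).
  rewrite (_ : _ - _ = (F0 (th s) (a s) - F0 (th s) (h (th s)))
    + (F (th s) (h (th s)) - F (thbar s) (h (thbar s)))); last first.
    by rewrite !(F0_F _ (h_bd _)); lmod R.
  apply: (le_trans (ler_normD _ _)); rewrite addrC; apply: lerD.
    apply: (le_trans (F_lip _ _ _ _)); rewrite mulrDl lerD2l -mulrA.
    by apply: ler_wpM2l.
  apply: (le_trans (F0_lip _ _ _)); rewrite -mulrA; apply: ler_wpM2l => //.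
  by apply: le_trans (attraction sol st) _; rewrite mulrC -mulNr.
have := @gronwall _ _ (fun s => th s - thbar s)
  (fun s => F0 (th s) (a s) - F0 (thbar s) (abar s))
  (* solves [g' = K g + M n exp ((K - k) s)], whose last term dominates the forcing *)
  (fun s => c * (expR (K * s) - expR ((K - k) * s)))
  (fun s => c * (K * expR (K * s) - (K - k) * expR ((K - k) * s)))
  (fun s => M * n * expR (- k * s)) K 0 t1 K0 _ _ D_bd _ _ t tt1.
move=> H; apply: le_trans (H _ _ _ _) _.
- by move=> s st; apply: hasdB; [have [] := sol s st|have [] := solb s st].
- move=> s _; apply: hasdZl.
  by apply: (@hasdB _ R^o); exact: hasd_expRM.
- move=> s /andP[s0 _].
  rewrite (_ : c * (K * expR (K * s) - (K - k) * expR ((K - k) * s)) =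
    K * (c * (expR (K * s) - expR ((K - k) * s))) + c * k * expR ((K - k) * s));
    last by ring.
  rewrite lerD2l ck; apply: ler_wpM2l; first by rewrite mulr_ge0.
  by rewrite ler_expR ler_wpM2r// lerDr.
- by rewrite e0 subrr normr0 !mulr0 expR0 subrr mulr0.
rewrite (_ : 2 * M * expR _ * eps * _ = c * expR (K * t)); last by rewrite /c /n /K; ring.
by apply: ler_wpM2l => //; rewrite gerBl expR_ge0.
Qed.

End forward_solutions.

(** * Essentially bounded functions *)

Section Linf_facts.
Context d (T : measurableType d) (R : realType).
Variable mu : {measure set T -> \bar R}.
Implicit Types (u v : Linf mu) (f : T -> R) (M : R).

Lemma ae_Linf_of f : ess_bounded mu f ->
  \forall x \ae mu, Linf_fun (Linf_of mu f) x = f x.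
Proof. by move=> bf; apply: filterS (Linf_ofE bf) => x; apply. Qed.

Lemma ae_Linf_add u v : \forall x \ae mu, Linf_fun (u + v) x = u x + v x.
Proof. by apply: filterS (Linf_Dfun u v) => x; apply. Qed.

Lemma ae_Linf_opp u : \forall x \ae mu, Linf_fun (- u) x = - u x.
Proof. by apply: filterS (Linf_Nfun u) => x; apply. Qed.

Lemma ae_Linf_scale c u : \forall x \ae mu, Linf_fun (c *: u) x = c * u x.
Proof. by apply: filterS (Linf_Zfun c u) => x; apply. Qed.

Lemma ae_Linf_sub u v : \forall x \ae mu, Linf_fun (u - v) x = u x - v x.
Proof.
by apply: filterS2 (ae_Linf_add u (- v)) (ae_Linf_opp v) => x -> ->.
Qed.

Lemma ae_Linf_lin c u v :
  \forall x \ae mu, Linf_fun (c *: u + v) x = c * u x + v x.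
Proof. by apply: filterS2 (ae_Linf_add (c *: u) v) (ae_Linf_scale c u) => x -> ->. Qed.

Lemma Linf_ext u v : (\forall x \ae mu, u x = v x) -> u = v.
Proof. by move=> uv; apply/Linf_eqP; apply: filterS uv. Qed.

Lemma Linf_ae_le u : \forall x \ae mu, `|u x| <= `|u|.
Proof.
have := Linf_normE u; rewrite unlock /Lnorm; case: ifPn => [mu0 E|].
  have := @ess_sup_ge _ _ _ mu (abse \o (EFin \o u)).
  by rewrite -E; apply: filterS => x /=; rewrite lee_fin.
rewrite -leNgt => mu0 _; exists setT; split => //.
by apply/eqP; rewrite eq_le mu0 measure_ge0.
Qed.

Lemma Linf_norm_le u M : 0 <= M -> (\forall x \ae mu, `|u x| <= M) -> `|u| <= M.
Proof.
move=> M0 uM; rewrite -lee_fin Linf_normE unlock /Lnorm.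
case: ifPn => [mu0|_]; last by rewrite lee_fin.
by apply/ess_supP; apply: filterS uM => x /=; rewrite lee_fin.
Qed.

Lemma ess_bounded_ae f M : measurable_fun [set: T] f ->
  (\forall x \ae mu, `|f x| <= M) -> ess_bounded mu f.
Proof.
move=> mf fM; split => //; rewrite /finite_norm unlock /Lnorm.
case: ifPn => [mu0|_]; last exact: ltry.
apply: le_lt_trans (ltry M); apply/ess_supP.
by apply: filterS fM => x /=; rewrite lee_fin.
Qed.

Lemma Linf_of_norm_le f M : ess_bounded mu f -> 0 <= M ->
  (\forall x \ae mu, `|f x| <= M) -> `|Linf_of mu f| <= M.
Proof.
move=> bf M0 fM; apply: Linf_norm_le => //.
by apply: filterS2 (ae_Linf_of bf) fM => x ->.
Qed.

Lemma Linf_dist_ae u v : \forall x \ae mu, `|u x - v x| <= `|u - v|.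
Proof. by apply: filterS2 (ae_Linf_sub u v) (Linf_ae_le (u - v)) => x ->. Qed.

Lemma Linf_measurable u : measurable_fun [set: T] (u : T -> R).
Proof. exact: (ess_bounded_Linf u).1. Qed.

(** Off one null set the representatives form a uniformly Cauchy sequence. The upper
    limit is used as limit because it is measurable everywhere. *)
Lemma Linf_complete : seq_complete (Linf mu).
Proof.
move=> u cu.
have ae_all : \forall x \ae mu, forall m n, `|u m x - u n x| <= `|u m - u n|.
  by apply/ae_foralln => m; apply/ae_foralln => n; exact: Linf_dist_ae.
pose f x : R := fine (limn_esup (fun n => (u n x)%:E)).
have mf : measurable_fun [set: T] f.
  apply: measurableT_comp => //; apply: measurable_fun_limn_esup => n.
  by apply/measurable_EFinP; exact: Linf_measurable.
have close x : (forall m n, `|u m x - u n x| <= `|u m - u n|) ->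
    forall e, 0 < e -> forall N, (forall m n, (N <= m)%N -> (N <= n)%N -> `|u m - u n| <= e) ->
    forall n, (N <= n)%N -> `|u n x - f x| <= e.
  move=> hx e e0 N hN n nN.
  have cx : cvgn (fun n => u n x).
    apply/cauchy_cvgP/cauchy_ballP => e1 e10.
    have [N1 h1] := cu (e1 / 2) (divr_gt0 e10 (@ltr0n R 2)).
    pose A := [set z | exists2 k, (N1 <= k)%N & z = u k x].
    exists (A, A); first by split; exists N1 => // k /= kN; exists k.
    move=> [_ _] /= [[p pN ->] [q qN ->]]; rewrite /ball/=.
    apply: le_lt_trans (hx p q) _; apply: le_lt_trans (h1 p q pN qN) _.
    by rewrite ltr_pdivrMr// mulr_natr mulr2n ltrDl.
  have fE : f x = limn (fun n => u n x).
    rewrite /f (_ : limn_esup _ = (limn (fun n => u n x))%:E)//.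
    have c2 : (fun n => (u n x)%:E) @ \oo --> (limn (fun n => u n x))%:E.
      by apply: cvg_EFin => //; exact: nearW.
    by have [] := cvg_limn_einf_sup c2.
  apply/ler_addgt0Pr => e1 e10.
  move/cvgrPdist_le : (cx) => /(_ _ e10)[k _ hk].
  have := hk (maxn k N) (leq_maxl _ _); rewrite -fE distrC => h1.
  have := hx n (maxn k N); have := hN n (maxn k N) nN (leq_maxr _ _).
  have := ler_distD (u (maxn k N) x) (u n x) (f x).
  by move: h1 => /=; lra.
have [N1 h1] := cu 1 ltr01.
have bf : ess_bounded mu f.
  apply: (@ess_bounded_ae _ (`|u N1| + 1)) => //.
  apply: filterS2 ae_all (Linf_ae_le (u N1)) => x hx hu.
  have := close x hx 1 ltr01 N1 h1 N1 (leqnn _).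
  have := ler_distD (u N1 x) (f x) 0; rewrite !subr0 (distrC (f x)); lra.
exists (Linf_of mu f) => e e0; have [N hN] := cu e e0; exists N => n nN.
apply: Linf_norm_le; first exact: ltW.
apply: filterS3 (ae_Linf_sub (u n) (Linf_of mu f)) (ae_Linf_of bf) ae_all => x -> -> hx.
exact: (close x hx e e0 N hN).
Qed.

End Linf_facts.

(** * Null sets and integrals on the unit square *)

Section unit_square.
Context (R : realType).

Notation I01 := (leb01 R).
Notation I01sq := (leb01sq R).

Lemma leb01_setT : I01 [set: measurableTypeR R] = 1%E.
Proof.
change (@lebesgue_measure R (setT `&` `[0, 1]%classic) = 1%E).
by rewrite setTI lebesgue_measure_itv /= lte_fin ltr01 oppr0 adde0.
Qed.

Lemma ae_fst (P : measurableTypeR R -> Prop) : (\forall x \ae I01, P x) ->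
  \forall p \ae I01sq, P p.1.
Proof.
move=> [N [mN N0 PN]]; exists (N `*` setT); split.
- exact: measurableX.
- apply: etrans (product_measure1E I01 I01 mN measurableT) _.
  by rewrite [X in (X * _)%E](_ : _ = 0%E)// mul0e.
- by move=> p /= nP; split => //; apply: PN.
Qed.

Lemma ae_snd (P : measurableTypeR R -> Prop) : (\forall x \ae I01, P x) ->
  \forall p \ae I01sq, P p.2.
Proof.
move=> [N [mN N0 PN]]; exists (setT `*` N); split.
- exact: measurableX.
- apply: etrans (product_measure1E I01 I01 measurableT mN) _.
  by rewrite [X in (_ * X)%E](_ : _ = 0%E)// mule0.
- by move=> p /= nP; split => //; apply: PN.
Qed.

Lemma ae_sections (P : measurableTypeR R * measurableTypeR R -> Prop) : (\forall p \ae I01sq, P p) ->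
  \forall x \ae I01, \forall y \ae I01, P (x, y).
Proof.
move=> [N [mN N0 PN]].
have mf : measurable_fun setT (fun x => I01 (xsection N x)).
  exact: measurable_fun_xsection.
have : (\int[I01]_x `|I01 (xsection N x)| = 0)%E.
  by under eq_integral do rewrite gee0_abs//.
move/(ae_eq_integral_abs _ measurableT mf); apply: filterS => x /(_ I) Nx.
exists (xsection N x); split => //; first exact: measurable_xsection.
by move=> y /= nP; rewrite xsectionE /=; apply: PN.
Qed.

Lemma measurable_section_integral (f : measurableTypeR R * measurableTypeR R -> R) :
  measurable_fun [set: measurableTypeR R * measurableTypeR R] f ->
  measurable_fun [set: measurableTypeR R] (fun x => \int[I01]_y f (x, y)).
Proof.
move=> mf; apply: measurableT_comp => //.
have mEf : measurable_fun [set: measurableTypeR R * measurableTypeR R] (EFin \o f) by exact/measurable_EFinP.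
rewrite (_ : (fun x => _) = (fun x : measurableTypeR R => \int[I01]_y ((EFin \o f)^\+ (x, y))
   - \int[I01]_y ((EFin \o f)^\- (x, y)))%E); last first.
  apply/funext => x; rewrite integralE; congr (_ - _)%E.
    by apply: eq_integral => y _; rewrite !funeposE.
  by apply: eq_integral => y _; rewrite !funenegE.
apply: emeasurable_funB.
- exact: (@measurable_fun_fubini_tonelli_F _ _ (measurableTypeR R) (measurableTypeR R)
    R I01 (EFin \o f)^\+%E (measurable_funepos mEf)
    (fun p => funepos_ge0 _ p)).
- exact: (@measurable_fun_fubini_tonelli_F _ _ (measurableTypeR R) (measurableTypeR R)
    R I01 (EFin \o f)^\-%E (measurable_funeneg mEf)
    (fun p => funeneg_ge0 _ p)).
Qed.

Lemma ae_bounded_integrable (g : measurableTypeR R -> R) (M : R) :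
  measurable_fun [set: measurableTypeR R] g -> (\forall y \ae I01, `|g y| <= M) ->
  I01.-integrable setT (EFin \o g).
Proof.
move=> mg gM.
have M0 : 0 <= `|M| by [].
apply/integrableP; split; first exact/measurable_EFinP.
apply: (@le_lt_trans _ _ (\int[I01]_y (`|M|%:E))%E).
  apply: ae_ge0_le_integral => //.
  - by apply: measurableT_comp => //; exact/measurable_EFinP.
  - by apply: filterS gM => y h _ /=; rewrite lee_fin (le_trans h)// ler_norm.
by rewrite integral_cst// [X in (_ * X)%E](_ : _ = 1%E) ?mule1 ?ltry//; exact: leb01_setT.
Qed.

Lemma ae_bounded_Rintegral (g : measurableTypeR R -> R) (M : R) : 0 <= M ->
  measurable_fun [set: measurableTypeR R] g -> (\forall y \ae I01, `|g y| <= M) ->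
  `|\int[I01]_y g y| <= M.
Proof.
move=> M0 mg gM; have ig := ae_bounded_integrable mg gM.
rewrite -lee_fin EFin_normr_Rintegral//.
apply: le_trans (le_abse_integral _ _ _) _ => //; first exact/measurable_EFinP.
apply: (@le_trans _ _ (\int[I01]_y (M%:E))%E).
  apply: ae_ge0_le_integral => //.
  - by apply: measurableT_comp => //; exact/measurable_EFinP.
  - by apply: filterS gM => y h _ /=; rewrite lee_fin.
by rewrite integral_cst// [X in (_ * X)%E](_ : _ = 1%E) ?mule1//; exact: leb01_setT.
Qed.

Lemma ae_eq_Rintegral (g g' : measurableTypeR R -> R) :
  measurable_fun [set: measurableTypeR R] g -> measurable_fun [set: measurableTypeR R] g' ->
  (\forall y \ae I01, g y = g' y) -> \int[I01]_y g y = \int[I01]_y g' y.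
Proof.
move=> mg mg' gg'; congr fine; apply: ae_eq_integral => //.
- exact/measurable_EFinP.
- exact/measurable_EFinP.
- by apply: filterS gg' => y /= -> _.
Qed.

End unit_square.

(** * Superposition operators *)

Section nemytskii.
Context (R : realType).

(** What makes the superposition operator of [g] differentiable on L^oo: there small
    increments are uniformly small almost everywhere, so that a Taylor remainder
    uniform over the plane is enough. Here [(g1, g2)] is the gradient of [g]. *)
Record smooth_kernel (g g1 g2 : R -> R -> R) (B B1 B2 : R) : Prop := SmoothKernel {
  kernel_ge0 : [/\ 0 <= B, 0 <= B1 & 0 <= B2];
  kernel_measurable : forall d (T : measurableType d) (f k : T -> R),
    measurable_fun setT f -> measurable_fun setT k ->
    [/\ measurable_fun setT (fun p => g (f p) (k p)),
        measurable_fun setT (fun p => g1 (f p) (k p)) &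
        measurable_fun setT (fun p => g2 (f p) (k p))];
  kernel_bd : forall z w, `|g z w| <= B;
  kernel_D1 : forall z w, `|g1 z w| <= B1;
  kernel_D2 : forall z w, `|g2 z w| <= B2;
  kernel_lip : forall z w z' w',
    `|g z w - g z' w'| <= B1 * `|z - z'| + B2 * `|w - w'|;
  kernel_rem : forall e : R, 0 < e -> exists2 del : R, 0 < del &
    forall z w q u, `|q| <= del -> `|u| <= del ->
    `|g (z + q) (w + u) - g z w - (g1 z w * q + g2 z w * u)| <= e * (`|q| + `|u|) }.

Context d (T : measurableType d) (mu : {measure set T -> \bar R}).
Implicit Types P S Q U : Linf mu.

Definition nemytskii (g : R -> R -> R) P S : Linf mu :=
  Linf_of mu (fun p => g (P p) (S p)).

Definition Dnemytskii (g1 g2 : R -> R -> R) P S Q U : Linf mu :=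
  Linf_of mu (fun p => g1 (P p) (S p) * Q p + g2 (P p) (S p) * U p).

Variables (g g1 g2 : R -> R -> R) (B B1 B2 : R).
Hypothesis kg : smooth_kernel g g1 g2 B B1 B2.

Let B0 : 0 <= B. Proof. by have [] := kernel_ge0 kg. Qed.
Let B10 : 0 <= B1. Proof. by have [] := kernel_ge0 kg. Qed.
Let B20 : 0 <= B2. Proof. by have [] := kernel_ge0 kg. Qed.

Lemma nemytskii_bounded P S : ess_bounded mu (fun p => g (P p) (S p)).
Proof.
apply: (@ess_bounded_ae _ _ _ _ _ B); last by apply: aeW => p; exact: (kernel_bd kg).
by have [] := kernel_measurable kg (Linf_measurable P) (Linf_measurable S).
Qed.

Lemma Dkernel_le z w q u : `|g1 z w * q + g2 z w * u| <= B1 * `|q| + B2 * `|u|.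
Proof.
apply: (le_trans (ler_normD _ _)); rewrite !normrM; apply: lerD; apply: ler_wpM2r => //.
- exact: (kernel_D1 kg).
- exact: (kernel_D2 kg).
Qed.

Lemma Dnemytskii_ae P S Q U : \forall p \ae mu,
  `|g1 (P p) (S p) * Q p + g2 (P p) (S p) * U p| <= B1 * `|Q| + B2 * `|U|.
Proof.
apply: filterS2 (Linf_ae_le Q) (Linf_ae_le U) => p hQ hU.
by apply: le_trans (Dkernel_le _ _ _ _) _; apply: lerD; exact: ler_wpM2l.
Qed.

Lemma Dnemytskii_bounded P S Q U :
  ess_bounded mu (fun p => g1 (P p) (S p) * Q p + g2 (P p) (S p) * U p).
Proof.
apply: (ess_bounded_ae _ (Dnemytskii_ae P S Q U)).
have [_ m1 m2] := kernel_measurable kg (Linf_measurable P) (Linf_measurable S).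
by apply: measurable_funD; apply: measurable_funM => //; exact: Linf_measurable.
Qed.

Lemma ae_nemytskii P S : \forall p \ae mu, Linf_fun (nemytskii g P S) p = g (P p) (S p).
Proof. exact/ae_Linf_of/nemytskii_bounded. Qed.

Lemma ae_Dnemytskii P S Q U : \forall p \ae mu,
  Linf_fun (Dnemytskii g1 g2 P S Q U) p = g1 (P p) (S p) * Q p + g2 (P p) (S p) * U p.
Proof. exact/ae_Linf_of/Dnemytskii_bounded. Qed.

Lemma nemytskii_norm P S : `|nemytskii g P S| <= B.
Proof.
apply: Linf_of_norm_le => //; first exact: nemytskii_bounded.
by apply: aeW => p; exact: (kernel_bd kg).
Qed.

Lemma Dnemytskii_norm P S Q U : `|Dnemytskii g1 g2 P S Q U| <= B1 * `|Q| + B2 * `|U|.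
Proof.
apply: Linf_of_norm_le; first exact: Dnemytskii_bounded.
  by rewrite addr_ge0// mulr_ge0.
exact: Dnemytskii_ae.
Qed.

Lemma nemytskii_lip P S P' S' :
  `|nemytskii g P S - nemytskii g P' S'| <= B1 * `|P - P'| + B2 * `|S - S'|.
Proof.
apply: Linf_norm_le; first by rewrite addr_ge0// mulr_ge0.
apply: filterS3 (ae_Linf_sub (nemytskii g P S) (nemytskii g P' S'))
  (filterI (ae_nemytskii P S) (ae_nemytskii P' S'))
  (filterI (Linf_dist_ae P P') (Linf_dist_ae S S')) => p -> [-> ->] [h1 h2].
apply: le_trans (kernel_lip kg _ _ _ _) _; apply: lerD; exact: ler_wpM2l.
Qed.

Lemma Dnemytskii_lin P S c Q U Q' U' :
  Dnemytskii g1 g2 P S (c *: Q + Q') (c *: U + U') =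
  c *: Dnemytskii g1 g2 P S Q U + Dnemytskii g1 g2 P S Q' U'.
Proof.
apply: Linf_ext.
apply: filterS3 (ae_Dnemytskii P S (c *: Q + Q') (c *: U + U')) (filterI (ae_Linf_lin c Q Q') (ae_Linf_lin c U U'))
  (filterI (ae_Linf_lin c (Dnemytskii g1 g2 P S Q U) (Dnemytskii g1 g2 P S Q' U'))
    (filterI (ae_Dnemytskii P S Q U) (ae_Dnemytskii P S Q' U'))).
by move=> p -> [-> ->] [-> [-> ->]]; ring.
Qed.

Lemma nemytskii_rem (e : R) : 0 < e -> exists2 del : R, 0 < del &
  forall P S Q U, `|Q| <= del -> `|U| <= del ->
  `|nemytskii g (P + Q) (S + U) - nemytskii g P S - Dnemytskii g1 g2 P S Q U|
    <= e * (`|Q| + `|U|).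
Proof.
move=> e0; have [del del0 h] := kernel_rem kg e0; exists del => // P S Q U Qd Ud.
apply: Linf_norm_le; first by rewrite mulr_ge0 ?addr_ge0// ltW.
apply: filterS3
  (filterI (ae_Linf_sub (nemytskii g (P + Q) (S + U) - nemytskii g P S)
              (Dnemytskii g1 g2 P S Q U))
     (ae_Linf_sub (nemytskii g (P + Q) (S + U)) (nemytskii g P S)))
  (filterI (filterI (ae_nemytskii (P + Q) (S + U)) (ae_nemytskii P S))
     (ae_Dnemytskii P S Q U))
  (filterI (filterI (ae_Linf_add P Q) (ae_Linf_add S U))
     (filterI (Linf_ae_le Q) (Linf_ae_le U))).
move=> p [-> ->] [[-> ->] ->] [[-> ->] [hQ hU]].
apply: le_trans (h _ _ _ _ (le_trans hQ Qd) (le_trans hU Ud)) _.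
by rewrite ler_pM2l// lerD.
Qed.

Lemma Dnemytskii_lip (K : R) : 0 <= K ->
  (forall z w z' w', `|g1 z w - g1 z' w'| <= K * (`|z - z'| + `|w - w'|) /\
     `|g2 z w - g2 z' w'| <= K * (`|z - z'| + `|w - w'|)) ->
  forall P S P' S' X Y,
  `|Dnemytskii g1 g2 P S X Y - Dnemytskii g1 g2 P' S' X Y|
    <= K * (`|P - P'| + `|S - S'|) * (`|X| + `|Y|).
Proof.
move=> K0 h P S P' S' X Y.
apply: Linf_norm_le; first by rewrite !mulr_ge0 ?addr_ge0.
apply: filterS3
  (filterI (ae_Linf_sub (Dnemytskii g1 g2 P S X Y) (Dnemytskii g1 g2 P' S' X Y))
    (filterI (ae_Dnemytskii P S X Y) (ae_Dnemytskii P' S' X Y)))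
  (filterI (Linf_dist_ae P P') (Linf_dist_ae S S'))
  (filterI (Linf_ae_le X) (Linf_ae_le Y)).
move=> p [-> [-> ->]] [hP hS] [hX hY].
have [k1 k2] := h (P p) (S p) (P' p) (S' p).
have kk : K * (`|P p - P' p| + `|S p - S' p|) <= K * (`|P - P'| + `|S - S'|).
  by apply: ler_wpM2l => //; exact: lerD.
rewrite (_ : _ - _ = (g1 (P p) (S p) - g1 (P' p) (S' p)) * X p
  + (g2 (P p) (S p) - g2 (P' p) (S' p)) * Y p); last by ring.
apply: (le_trans (ler_normD _ _)); rewrite !normrM mulrDr.
by apply: lerD; apply: ler_pM => //; [exact: le_trans k1 kk|exact: le_trans k2 kk].
Qed.

End nemytskii.

Section lifts_and_averages.
Context (R : realType).

Notation T := (measurableTypeR R).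
Notation I01 := (leb01 R).
Notation I01sq := (leb01sq R).
Implicit Types (th v : Xtheta R) (a u : Xa R).

Lemma measurable_lift1 th : measurable_fun [set: T * T] (fun p : T * T => th p.1).
Proof. by apply: measurableT_comp => //; exact: Linf_measurable. Qed.

Lemma measurable_lift2 th : measurable_fun [set: T * T] (fun p : T * T => th p.2).
Proof. by apply: measurableT_comp => //; exact: Linf_measurable. Qed.

(** A function of one phase variable becomes a function on the square, which reduces
    all the operators below to superpositions on the square and averages. *)
Definition lift1 th : Xa R := Linf_of I01sq (fun p : T * T => th p.1).
Definition lift2 th : Xa R := Linf_of I01sq (fun p : T * T => th p.2).

Lemma ae_lift1 th : \forall p \ae I01sq, Linf_fun (lift1 th) p = th p.1.
Proof.
apply/ae_Linf_of/(@ess_bounded_ae _ _ _ _ _ `|th|); first exact: measurable_lift1.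
exact: ae_fst (Linf_ae_le th).
Qed.

Lemma ae_lift2 th : \forall p \ae I01sq, Linf_fun (lift2 th) p = th p.2.
Proof.
apply/ae_Linf_of/(@ess_bounded_ae _ _ _ _ _ `|th|); first exact: measurable_lift2.
exact: ae_snd (Linf_ae_le th).
Qed.

Lemma lift1_norm th : `|lift1 th| <= `|th|.
Proof.
apply: Linf_norm_le => //.
by apply: filterS2 (ae_lift1 th) (ae_fst (Linf_ae_le th)) => p ->.
Qed.

Lemma lift2_norm th : `|lift2 th| <= `|th|.
Proof.
apply: Linf_norm_le => //.
by apply: filterS2 (ae_lift2 th) (ae_snd (Linf_ae_le th)) => p ->.
Qed.

Lemma lift1_lin c th v : lift1 (c *: th + v) = c *: lift1 th + lift1 v.
Proof.
apply: Linf_ext.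
apply: filterS3 (filterI (ae_lift1 (c *: th + v)) (ae_fst (ae_Linf_lin c th v)))
  (ae_Linf_lin c (lift1 th) (lift1 v)) (filterI (ae_lift1 th) (ae_lift1 v)).
move=> p [h1 h2] h3 [h4 h5]; apply: etrans h1 _; apply: etrans h2 _; apply: esym.
by apply: etrans h3 _; rewrite h4 h5.
Qed.

Lemma lift2_lin c th v : lift2 (c *: th + v) = c *: lift2 th + lift2 v.
Proof.
apply: Linf_ext.
apply: filterS3 (filterI (ae_lift2 (c *: th + v)) (ae_snd (ae_Linf_lin c th v)))
  (ae_Linf_lin c (lift2 th) (lift2 v)) (filterI (ae_lift2 th) (ae_lift2 v)).
move=> p [h1 h2] h3 [h4 h5]; apply: etrans h1 _; apply: etrans h2 _; apply: esym.
by apply: etrans h3 _; rewrite h4 h5.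
Qed.

Lemma measurable_section (f : T * T -> R) (x : T) :
  measurable_fun [set: T * T] f -> measurable_fun [set: T] (fun y => f (x, y)).
Proof. by move=> mf; apply: measurableT_comp => //; exact: measurable_pair1. Qed.

Definition average (u : Xa R) : Xtheta R :=
  Linf_of I01 (fun x : T => \int[I01]_y Linf_fun u (x, y)).

Lemma average_ae u : \forall x \ae I01, `|\int[I01]_y Linf_fun u (x, y)| <= `|u|.
Proof.
apply: filterS (ae_sections (Linf_ae_le u)) => x hx.
apply: ae_bounded_Rintegral => //.
exact: measurable_section (Linf_measurable u).
Qed.

Lemma average_bounded u : ess_bounded I01 (fun x : T => \int[I01]_y Linf_fun u (x, y)).
Proof.
apply: ess_bounded_ae (average_ae u).
exact: measurable_section_integral (Linf_measurable u).
Qed.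

Lemma ae_average u : \forall x \ae I01,
  Linf_fun (average u) x = \int[I01]_y Linf_fun u (x, y).
Proof. exact/ae_Linf_of/average_bounded. Qed.

Lemma average_norm u : `|average u| <= `|u|.
Proof. by apply: Linf_of_norm_le (average_ae u) => //; exact: average_bounded. Qed.

Lemma average_lin c u u' : average (c *: u + u') = c *: average u + average u'.
Proof.
apply: Linf_ext.
apply: filterS3 (filterI (ae_average (c *: u + u')) (ae_sections (ae_Linf_lin c u u')))
  (filterI (ae_Linf_lin c (average u) (average u')) (filterI (ae_average u) (ae_average u')))
  (filterI (ae_sections (Linf_ae_le u)) (ae_sections (Linf_ae_le u'))).
move=> x [e1 h1] [e2 [e3 e4]] [h2 h3].
apply: etrans e1 _; apply: esym; apply: etrans e2 _; rewrite e3 e4; apply: esym.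
have mu_ := measurable_section x (Linf_measurable u).
have mu' := measurable_section x (Linf_measurable u').
rewrite (@ae_eq_Rintegral _ _ (fun y => c * u (x, y) + u' (x, y)))//.
- have iu := ae_bounded_integrable mu_ h2.
  have icu : I01.-integrable setT (EFin \o (fun y => c * u (x, y))).
    rewrite (_ : _ \o _ = (fun y => c%:E * (EFin \o (fun y => u (x, y))) y)%E); last first.
      by apply/funext.
    exact: integrableZl.
  rewrite RintegralD//; last exact: ae_bounded_integrable mu' h3.
  by rewrite RintegralZl.
- exact: measurable_section (Linf_measurable _).
- by apply: measurable_funD => //; exact: measurable_funM.
Qed.

End lifts_and_averages.

(** * Regularity of the coefficient functions *)

Section calculus_on_lines.
Context (R : realType).

Lemma hasd_line (V : normedModType R) (f : V -> R) (p e : V) t :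
  derivable f (p + t *: e) e ->
  hasd setT ((fun s : R => f (p + s *: e)) : R -> R^o) t ('D_e f (p + t *: e)).
Proof.
move=> df; apply: (@hasd_sub _ _ setT) => //.
apply: deriv_within_hasd; rewrite /deriv_within.
have := df; rewrite /derivable => /cvg_ex[l cl]; have lv : l = 'D_e f (p + t *: e).
  by apply/esym/cvg_lim.
rewrite -lv => A /cl /= [d d0 h]; exists d => // s sd st _.
have := h s sd st; rewrite /preimage /mkset /=.
by rewrite (_ : s *: e + (p + t *: e) = p + (t + s) *: e)//; lmod R.
Qed.

Lemma hasd_derive1 (f : R -> R) t : derivable f t 1 ->
  hasd setT (f : R -> R^o) t ('D_1 f t).
Proof.
move=> df; have := @hasd_line _ f 0 1 t.
have E (s : R) : (0 : R) + s *: (1 : R) = s by rewrite add0r -[_ *: _]/(_ * _) mulr1.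
rewrite E => /(_ df); congr (hasd _ _ _ _).
by apply/funext => s; rewrite E.
Qed.

(** Taylor's formula in mean value form, without a sign condition on [u]. *)
Lemma increment_bound (phi phi' : R -> R) (x u c K : R) :
  (forall s, hasd setT (phi : R -> R^o) s (phi' s)) ->
  (forall s, `|s - x| <= `|u| -> `|phi' s - c| <= K) ->
  `|phi (x + u) - phi x - c * u| <= K * `|u|.
Proof.
move=> dphi hK.
have key a b : a <= b -> (forall s, a <= s <= b -> `|s - x| <= `|u|) ->
    `|(phi b - c * b) - (phi a - c * a)| <= K * b - K * a.
  move=> ab hs.
  apply: (@mean_value_hasd _ R^o (fun s => phi s - c * s) (fun s => phi' s - c * 1)
    (fun s => K * s) (fun=> K * 1)) => // t tab.
  - apply: (@hasd_sub _ _ setT) => //; apply: (@hasdB _ R^o) => //.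
    by apply: hasdZl; exact: hasd_id.
  - by apply: hasdZl; exact: hasd_id.
  - by rewrite !mulr1; apply: hK; exact: hs.
have [u0|u0] := leP 0 u.
  have xu : x <= x + u by rewrite lerDl.
  have := key x (x + u) xu.
  rewrite (_ : _ - _ - _ = phi (x + u) - phi x - c * u); last by ring.
  rewrite -mulrBr (_ : x + u - x = u); last by ring.
  rewrite ger0_norm//; apply => s /andP[s1 s2].
  by rewrite ger0_norm ?subr_ge0//; lra.
have xu : x + u <= x by rewrite gerDl ltW.
have := key (x + u) x xu.
rewrite distrC (_ : _ - _ - _ = phi (x + u) - phi x - c * u); last by ring.
rewrite -mulrBr (_ : x - (x + u) = - u); last by ring.
rewrite ltr0_norm//; apply => s /andP[s1 s2].
by rewrite ler0_norm ?subr_le0//; lra.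
Qed.

Lemma lipschitz_of_derivative (phi phi' : R -> R) (K : R) :
  (forall s, hasd setT (phi : R -> R^o) s (phi' s)) ->
  (forall s, `|phi' s| <= K) ->
  forall z z', `|phi z - phi z'| <= K * `|z - z'|.
Proof.
move=> dphi hK z z'; have := @increment_bound phi phi' z' (z - z') 0 K dphi.
by rewrite mul0r subr0 subrKC; apply => s _; rewrite subr0.
Qed.

Lemma le_maxl (a b c : R) : c <= a -> c <= Num.max a b.
Proof. by move=> ca; rewrite le_max ca. Qed.

Lemma le_maxr (a b c : R) : c <= b -> c <= Num.max a b.
Proof. by move=> cb; rewrite le_max cb orbT. Qed.

Lemma supnorm_ge (X : Type) (f : X -> R) M x : (forall y, `|f y| <= M) ->
  `|f x| <= supnorm f.
Proof.
by move=> fM; apply: ub_le_sup; [exists M => _ [y _ <-]; exact: fM|exists x].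
Qed.

End calculus_on_lines.

Section measurability.
Context (R : realType) d (T : measurableType d).

Let step (n : nat) (x : R) : R := (Num.floor (n.+1%:R * x))%:~R / n.+1%:R.

Let step_near n x : `|step n x - x| <= n.+1%:R^-1.
Proof.
have n0 : 0 < n.+1%:R :> R by [].
have -> : step n x - x = ((Num.floor (n.+1%:R * x))%:~R - n.+1%:R * x) / n.+1%:R.
  by rewrite /step; field; rewrite gt_eqF.
rewrite normrM normfV (gtr0_norm n0) ler_pdivrMr// mulVf ?gt_eqF//.
have := floor_le (n.+1%:R * x); have := floorD1_gt (n.+1%:R * x).
rewrite intrD ler_norml; lra.
Qed.

Lemma continuous_pair_dist (f : R * R -> R) (a b e : R) : continuous f -> 0 < e ->
  exists2 del : R, 0 < del & forall a' b', `|a' - a| < del -> `|b' - b| < del ->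
    `|f (a', b') - f (a, b)| <= e.
Proof.
move=> cf e0; have /cvgrPdist_le/(_ _ e0) := cf (a, b).
move=> /nbhs_ballP[del /= del0 h]; exists del => // a' b' ha hb.
by rewrite distrC; apply: (h (a', b')); split; rewrite /ball /= distrC.
Qed.

(** Rounding the first argument leaves countably many continuous functions of the
    second one; the rounded functions converge pointwise. *)
Lemma measurable_continuous2 (f : R * R -> R) (u v : T -> R) : continuous f ->
  measurable_fun setT u -> measurable_fun setT v ->
  measurable_fun setT (fun x => f (u x, v x)).
Proof.
move=> cf mu mv.
pose code (k : nat) : int := if odd k then Negz k./2 else Posz k./2.
have code_surj z : exists k, code k = z.
  case: z => k; first by exists k.*2; rewrite /code odd_double doubleK.
  by exists k.*2.+1; rewrite /code /= odd_double /= uphalf_double.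
apply: (@measurable_fun_cvg _ _ _ setT (fun n x => f (step n (u x), v x))); last first.
  move=> x _; apply/cvgrPdist_le => e e0.
  have [del del0 h] := continuous_pair_dist (u x) (v x) cf e0.
  exists (Num.trunc del^-1) => // n /= nN.
  rewrite distrC; apply: h; last by rewrite subrr normr0.
  apply: le_lt_trans (step_near _ _) _; rewrite -[ltRHS]invrK ltf_pV2 ?posrE ?invr_gt0//.
  by apply: lt_le_trans (truncnS_gt _) _; rewrite ler_nat ltnS.
move=> n.
pose E k := (fun x => n.+1%:R * u x) @^-1` `[(code k)%:~R, (code k)%:~R + 1[%classic.
have mE k : measurable (E k).
  have mnu : measurable_fun setT (fun x => n.+1%:R * u x).
    by apply: measurable_funM => //; exact: measurable_cst.
  by have := mnu measurableT _ (measurable_itv `[(code k)%:~R, (code k)%:~R + 1[); rewrite setTI.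
have coverE : \bigcup_k E k = setT.
  apply/seteqP; split => // x _; have [k hk] := code_surj (Num.floor (n.+1%:R * u x)).
  exists k => //; rewrite /E /preimage /= in_itv /= hk.
  by rewrite floor_le /=; have := floorD1_gt (n.+1%:R * u x); rewrite intrD.
rewrite -coverE; apply/(measurable_fun_bigcup _ mE) => k.
apply: (@eq_measurable_fun _ _ _ _ _ (fun x => f ((code k)%:~R / n.+1%:R, v x))).
  move=> x; rewrite inE /E /preimage /= in_itv /= => /andP[h1 h2].
  by rewrite /step (@floor_def _ _ (code k))// h1 intrD.
apply: measurable_funTS.
apply: (@measurableT_comp _ _ _ _ _ _ (fun y : R => f ((code k)%:~R / n.+1%:R, y))) => //.
apply: continuous_measurable_fun => y; apply/cvgrPdist_le => e e0.
have [del del0 h] := continuous_pair_dist ((code k)%:~R / n.+1%:R) y cf e0.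
apply/nbhs_ballP; exists del => // z; rewrite /ball /= => yz.
by rewrite distrC; apply: h; [rewrite subrr normr0|rewrite distrC].
Qed.

End measurability.

Section kernels.
Context (R : realType).

(** Compactness of one period. *)
Lemma uniform_cont_periodic (f : R -> R) (per : R) : 0 < per -> continuous f ->
  (forall x, f (x + per) = f x) ->
  forall e : R, 0 < e -> exists2 del : R, 0 < del &
    forall w u, `|u| <= del -> `|f (w + u) - f w| <= e.
Proof.
move=> per0 cf fper e e0.
have cf' t : contd setT (f : R -> R^o) t.
  move=> e1 e10; have /cvgrPdist_le/(_ _ e10)/nbhs_ballP[d /= d0 h] := cf t.
  exists d => // s _ sd; rewrite distrC; apply: h.
  by rewrite /ball /= distrC.
have [del del0 h] := near_unif_cont 0 per cf' e0.
exists del => // w u ud.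
have fn (n : nat) x : f (x + n%:R * per) = f x.
  elim: n x => [|n ih] x; first by rewrite mul0r addr0.
  by rewrite -(addn1 n) natrD mulrDl mul1r addrA fper.
have fz (z : int) x : f (x + z%:~R * per) = f x.
  case: z => n; first exact: fn.
  rewrite NegzE -[in RHS](subrK (n.+1%:R * per) x) fn; congr f.
  by rewrite intrN mulNr.
pose z := Num.floor (w / per).
pose w' := w - z%:~R * per.
have w'E : w = w' + z%:~R * per by rewrite /w' subrK.
have -> : w + u = (w' + u) + z%:~R * per by rewrite {1}w'E addrAC.
have -> : f w = f w' by rewrite {1}w'E fz.
rewrite fz; apply: h; last by rewrite addrAC subrr add0r.
have := floor_le (w / per); have := floorD1_gt (w / per); rewrite -/z intrD.
rewrite ler_pdivlMr// ltr_pdivrMr// mulrDl mul1r /w' => h1 h2.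
by apply/andP; split; lra.
Qed.

Section kernel_of_H.
Variable H : R * R -> R.
Hypothesis cbH : Cb [set @axis1 R; @axis2 R] 2 H.

Let K := M_D2H H.

Lemma hasd_axis1 (f : R * R -> R) x y : (forall p, derivable f p (@axis1 R)) ->
  hasd setT ((fun s => f (s, y)) : R -> R^o) x ('D_(@axis1 R) f (x, y)).
Proof.
move=> df.
have E s : ((0, y) : R * R) + s *: @axis1 R = (s, y).
  by rewrite /axis1; congr pair; rewrite /= ?add0r -?[_ *: _]/(_ * _) ?mulr1// mulr0 addr0.
have := @hasd_line _ _ f (0, y) (@axis1 R) x; rewrite E => /(_ (df _)).
by congr (hasd _ _ _ _); apply/funext => s; rewrite E.
Qed.

Lemma hasd_axis2 (f : R * R -> R) x y : (forall p, derivable f p (@axis2 R)) ->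
  hasd setT ((fun s => f (x, s)) : R -> R^o) y ('D_(@axis2 R) f (x, y)).
Proof.
move=> df.
have E s : ((x, 0) : R * R) + s *: @axis2 R = (x, s).
  by rewrite /axis2; congr pair; rewrite /= ?add0r -?[_ *: _]/(_ * _) ?mulr1// mulr0 addr0.
have := @hasd_line _ _ f (x, 0) (@axis2 R) y; rewrite E => /(_ (df _)).
by congr (hasd _ _ _ _); apply/funext => s; rewrite E.
Qed.

Lemma plane_lipschitz (f : R * R -> R) (B : R) :
  (forall p, derivable f p (@axis1 R)) -> (forall p, derivable f p (@axis2 R)) ->
  (forall p, `|'D_(@axis1 R) f p| <= B) -> (forall p, `|'D_(@axis2 R) f p| <= B) ->
  forall z w z' w', `|f (z, w) - f (z', w')| <= B * `|z - z'| + B * `|w - w'|.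
Proof.
move=> d1 d2 b1 b2 z w z' w'.
apply: le_trans (ler_distD (f (z', w)) _ _) _; apply: lerD.
  apply: (@lipschitz_of_derivative _ (fun s => f (s, w)) (fun s => 'D_(@axis1 R) f (s, w))) => // s.
  exact: hasd_axis1.
apply: (@lipschitz_of_derivative _ (fun s => f (z', s)) (fun s => 'D_(@axis2 R) f (z', s))) => // s.
exact: hasd_axis2.
Qed.

Lemma H_regularity :
  [/\ continuous H, continuous (d1H H), continuous (d2H H),
      (forall p, derivable H p (@axis1 R)) /\ (forall p, derivable H p (@axis2 R)) &
      [/\ forall p, `|H p| <= M_H H, forall p, `|d1H H p| <= M_DH H,
          forall p, `|d2H H p| <= M_DH H,
          forall z w z' w', `|d1H H (z, w) - d1H H (z', w')| <= K * (`|z - z'| + `|w - w'|) &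
          forall z w z' w', `|d2H H (z, w) - d2H H (z', w')| <= K * (`|z - z'| + `|w - w'|)]].
Proof.
have [cH [M HM] dH] := cbH.
have [dH1 [c1 [N1 h1] dd1]] := dH (@axis1 R) (or_introl erefl).
have [dH2 [c2 [N2 h2] dd2]] := dH (@axis2 R) (or_intror erefl).
have [d11 [_ [N11 h11] _]] := dd1 (@axis1 R) (or_introl erefl).
have [d12 [_ [N12 h12] _]] := dd1 (@axis2 R) (or_intror erefl).
have [d21 [_ [N21 h21] _]] := dd2 (@axis1 R) (or_introl erefl).
have [d22 [_ [N22 h22] _]] := dd2 (@axis2 R) (or_intror erefl).
split; [exact: cH|exact: c1|exact: c2|by split|split].
- by move=> p; exact: (@supnorm_ge _ _ H M p HM).
- by move=> p; apply: le_maxl; exact: (@supnorm_ge _ _ (d1H H) N1 p h1).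
- by move=> p; apply: le_maxr; exact: (@supnorm_ge _ _ (d2H H) N2 p h2).
- move=> z w z' w'; rewrite mulrDr.
  apply: (@plane_lipschitz (d1H H) K d11 d12) => p; apply: le_maxl.
  + apply: le_maxl; exact: (@supnorm_ge _ _ ('D_(@axis1 R) (d1H H)) N11 p h11).
  + apply: le_maxr; exact: (@supnorm_ge _ _ ('D_(@axis2 R) (d1H H)) N12 p h12).
- move=> z w z' w'; rewrite mulrDr.
  apply: (@plane_lipschitz (d2H H) K d21 d22) => p; apply: le_maxr.
  + apply: le_maxl; exact: (@supnorm_ge _ _ ('D_(@axis1 R) (d2H H)) N21 p h21).
  + apply: le_maxr; exact: (@supnorm_ge _ _ ('D_(@axis2 R) (d2H H)) N22 p h22).
Qed.

Lemma M_D2H_ge0 : 0 <= K.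
Proof.
have [_ _ _ _ [_ _ _ h _]] := H_regularity.
have := h 1 0 0 0; rewrite !subr0 normr0 addr0 normr1 mulr1; exact: le_trans.
Qed.

(** The remainder is controlled by changing one variable at a time, the partial
    derivatives being Lipschitz. *)
Lemma H_kernel : smooth_kernel (fun z w => H (z, w)) (fun z w => d1H H (z, w))
  (fun z w => d2H H (z, w)) (M_H H) (M_DH H) (M_DH H).
Proof.
have [cH c1 c2 [dH1 dH2] [b0 b1 b2 l1 l2]] := H_regularity.
split=> //.
- by split; [exact: le_trans (b0 (0, 0))|exact: le_trans (b1 (0, 0))|exact: le_trans (b2 (0, 0))].
- by move=> d T f k mf mk; split; exact: measurable_continuous2.
- by move=> z w z' w'; exact: plane_lipschitz.
- move=> e e0; have K0 := M_D2H_ge0.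
  have K20 : 0 <= 2 * K by rewrite mulr_ge0.
  have [del del0 hdel] := eps_over e0 K20; exists del => // z w q u qd ud.
  have qu : K * (`|q| + `|u|) <= e.
    apply: le_trans hdel; rewrite (_ : 2 * K * del = K * (del + del)); last by ring.
    by apply: ler_wpM2l => //; exact: lerD.
  have h1 : `|H (z + q, w + u) - H (z, w + u) - d1H H (z, w) * q| <= e * `|q|.
    apply: (@increment_bound _ (fun s => H (s, w + u)) (fun s => d1H H (s, w + u))).
      by move=> s; exact: hasd_axis1.
    move=> s sz; apply: le_trans (l1 _ _ _ _) _; apply: le_trans qu.
    by apply: ler_wpM2l => //; apply: lerD => //; rewrite addrAC subrr add0r.
  have h2 : `|H (z, w + u) - H (z, w) - d2H H (z, w) * u| <= e * `|u|.
    apply: (@increment_bound _ (fun s => H (z, s)) (fun s => d2H H (z, s))).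
      by move=> s; exact: hasd_axis2.
    move=> s sz; apply: le_trans (l2 _ _ _ _) _; apply: le_trans qu.
    by apply: ler_wpM2l => //; rewrite subrr normr0 add0r (le_trans sz)// lerDr.
  rewrite (_ : _ - _ - _ = (H (z + q, w + u) - H (z, w + u) - d1H H (z, w) * q)
    + (H (z, w + u) - H (z, w) - d2H H (z, w) * u)); last by ring.
  by apply: (le_trans (ler_normD _ _)); rewrite mulrDr lerD.
Qed.

End kernel_of_H.

Section kernel_of_coupling.
Variables (Gamma chi : R -> R) (r : R).
Hypotheses (cbG : Cb [set (1 : R)] 1 Gamma).
Hypothesis perG : forall x, Gamma (x + 2 * pi) = Gamma x.
Hypothesis cut : cutoff chi.
Hypothesis r0 : 0 < r.

Let dG := 'D_1 Gamma.
Let dsigma (z : R) : R := 'D_1 chi (z / r).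

Lemma le_thirds (e x y : R) : 0 < e -> 0 <= x -> 0 <= y ->
  e / 3 * x + e / 3 * x + e / 3 * y <= e * (x + y).
Proof.
move=> e0 x0 y0; have := mulr_ge0 (ltW e0) x0; have := mulr_ge0 (ltW e0) y0; lra.
Qed.

Lemma Gamma_regularity :
  [/\ continuous Gamma, continuous dG,
      forall s, hasd setT (Gamma : R -> R^o) s (dG s),
      (forall s, `|Gamma s| <= M_Gamma Gamma) /\ (forall s, `|dG s| <= L_Gamma Gamma) &
      forall e : R, 0 < e -> exists2 del : R, 0 < del &
        forall w u, `|u| <= del -> `|dG (w + u) - dG w| <= e].
Proof.
have [cG [M hM] /(_ 1 erefl)[dG1 [cdG [N hN] _]]] := cbG.
have hd s : hasd setT (Gamma : R -> R^o) s (dG s) by exact: hasd_derive1.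
split=> //; first by split=> s; [exact: supnorm_ge hM|exact: supnorm_ge hN].
apply: (@uniform_cont_periodic _ (2 * pi)) => //; first by rewrite mulr_gt0 ?pi_gt0.
move=> x; apply: (@hasd_unique_left _ R^o Gamma x).
  apply: (@hasd_sub _ _ setT) => //; have := hasd_shift (hd (x + 2 * pi)).
  by congr (hasd _ _ _ _); apply/funext => s; exact: perG.
exact: hasd_sub (hd x).
Qed.

Lemma sigma_regularity : exists2 K : R, 0 <= K &
  [/\ continuous (sigma chi r), continuous dsigma,
      forall s, hasd setT (sigma chi r : R -> R^o) s (dsigma s) &
      [/\ forall s, `|sigma chi r s| <= 2 * r, forall s, `|dsigma s| <= 1 &
      forall z z', `|dsigma z - dsigma z'| <= K * `|z - z'|]].
Proof.
have [_ cbc _ bc _] := cut.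
have [cc _ /(_ 1 erefl)[dc1 [cdc [N hN] /(_ 1 erefl)[dc2 [_ [N2 hN2] _]]]]] := cbc 2%N.
have cdiv : continuous (fun z : R => z / r).
  exact: mulrr_continuous.
have N20 : 0 <= N2 by apply: le_trans (hN2 0).
exists (N2 / r); first by rewrite divr_ge0// ltW.
have hs s : hasd setT (sigma chi r : R -> R^o) s (dsigma s).
  move=> e e0; have [d d0 h] := hasd_derive1 (dc1 (s / r)) e0.
  exists (d * r) => [|z _ zd]; first by rewrite mulr_gt0.
  have E : z / r - s / r = (z - s) / r by rewrite mulrBl.
  have := h (z / r) I; rewrite E normrM normfV (gtr0_norm r0) ltr_pdivrMr// => /(_ zd).
  rewrite /sigma /dsigma -[_ *: _ in X in X -> _]/(_ * _) -[_ *: _]/(_ * _).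
  rewrite mulrA ler_pdivlMr// -[X in _ * X <= _](gtr0_norm r0) -normrM.
  rewrite (_ : (_ - _ - _) * r = r * chi (z / r) - r * chi (s / r) - (z - s) * 'D_1 chi (s / r))//.
  by field; rewrite gt_eqF.
split; [| |exact: hs|].
- move=> z; apply/cvgrPdist_le => e e0; have [d d0 h] := hasd_contd (hs z) e0.
  apply/nbhs_ballP; exists d => // y; rewrite /ball /= distrC => zy.
  by rewrite distrC; exact: h.
- by move=> z; exact: (continuous_comp (cdiv z) (cdc _)).
split=> [s|s|z z'].
- rewrite /sigma normrM (gtr0_norm r0) mulrC; apply: ler_wpM2r; first exact: ltW.
  by have [] := bc (s / r).
- by have [] := bc (s / r).
apply: le_trans (@lipschitz_of_derivative _ ('D_1 chi) ('D_1 ('D_1 chi)) N2 _ hN2 _ _) _.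
  by move=> s; exact: hasd_derive1.
by rewrite -mulrBl normrM normfV (gtr0_norm r0) -mulrA (mulrC r^-1).
Qed.

(** The derivative of [Gamma] is only uniformly continuous, by periodicity; the
    factor [sigma], which multiplies its remainder, is bounded thanks to the cut-off. *)
Lemma coupling_kernel : smooth_kernel (fun z w => sigma chi r z * Gamma w)
  (fun z w => dsigma z * Gamma w) (fun z w => sigma chi r z * dG w)
  (2 * r * M_Gamma Gamma) (M_Gamma Gamma) (2 * r * L_Gamma Gamma).
Proof.
have [cG cdG hG [bG bdG] uG] := Gamma_regularity.
have [K K0 [cs cds hs [bs bds ls]]] := sigma_regularity.
pose MG := M_Gamma Gamma; pose LG := L_Gamma Gamma.
have MG0 : 0 <= MG by exact: le_trans (bG 0).
have LG0 : 0 <= LG by exact: le_trans (bdG 0).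
have r20 : 0 <= 2 * r by rewrite mulr_ge0// ltW.
have lipG := lipschitz_of_derivative hG bdG.
have lipS := lipschitz_of_derivative hs bds.
move: (sigma chi r) cs hs bs lipS => sg cs hs bs lipS.
have shift (x y : R) : x + y - x = y by rewrite addrAC subrr add0r.
split=> //.
- by split=> //; exact: mulr_ge0.
- move=> d T f k mf mk.
  have c (g : R -> R) : continuous g -> measurable_fun setT (fun p => g (f p)).
    by move=> cg; apply: measurableT_comp => //; exact: continuous_measurable_fun.
  have c' (g : R -> R) : continuous g -> measurable_fun setT (fun p => g (k p)).
    by move=> cg; apply: measurableT_comp => //; exact: continuous_measurable_fun.
  by split; apply: measurable_funM; (exact: c || exact: c').
- by move=> z w; rewrite normrM; exact: ler_pM.
- by move=> z w; rewrite normrM -[leRHS]mul1r; exact: ler_pM.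
- by move=> z w; rewrite normrM; exact: ler_pM.
- move=> z w z' w'.
  rewrite (_ : _ - _ = (sg z - sg z') * Gamma w
    + sg z' * (Gamma w - Gamma w')); last by ring.
  apply: (le_trans (ler_normD _ _)); rewrite !normrM; apply: lerD.
    by rewrite mulrC; apply: ler_pM => //; have := lipS z z'; rewrite mul1r.
  by rewrite -mulrA; apply: ler_pM.
- move=> e e0.
  have e3 : 0 < e / 3 by rewrite divr_gt0.
  have [e1 e10 he1] := eps_over e3 r20; have [d1 d10 h1] := uG e1 e10.
  have [d2 d20 h2] := eps_over e3 LG0.
  have [d3 d30 h3] := eps_over e3 (mulr_ge0 K0 MG0).
  exists (Num.min d1 (Num.min d2 d3)); first by rewrite !lt_min d10 d20.
  move=> z w q u; rewrite !le_min => /andP[q1 /andP[q2 q3]] /andP[u1 /andP[u2 u3]].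
  rewrite (_ : _ - _ - _ = (sg (z + q) - sg z - dsigma z * q) * Gamma (w + u)
    + (dsigma z * q) * (Gamma (w + u) - Gamma w)
    + sg z * (Gamma (w + u) - Gamma w - dG w * u)); last by ring.
  have k1 : `|sg (z + q) - sg z - dsigma z * q| <= K * `|q| * `|q|.
    apply: (@increment_bound _ _ dsigma) => // s sz; apply: le_trans (ls _ _) _.
    exact: ler_wpM2l.
  have k2 : `|Gamma (w + u) - Gamma w| <= LG * `|u| by have := lipG (w + u) w; rewrite shift.
  have k3 : `|Gamma (w + u) - Gamma w - dG w * u| <= e1 * `|u|.
    apply: (@increment_bound _ _ dG) => // s sz.
    by have := h1 w (s - w) (le_trans sz u1); rewrite subrKC.
  have t1 : `|(sg (z + q) - sg z - dsigma z * q) * Gamma (w + u)| <= e / 3 * `|q|.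
    rewrite normrM; apply: le_trans (ler_pM _ _ k1 (bG _)) _ => //.
    rewrite [leLHS](_ : _ = K * MG * `|q| * `|q|); last by rewrite /MG; ring.
    apply: ler_wpM2r => //; apply: le_trans h3; apply: ler_wpM2l => //.
    exact: mulr_ge0.
  have t2 : `|dsigma z * q * (Gamma (w + u) - Gamma w)| <= e / 3 * `|q|.
    rewrite !normrM; apply: le_trans (ler_pM _ _ (ler_pM _ _ (bds z) (lexx `|q|)) k2) _ => //.
    rewrite mul1r mulrC; apply: ler_wpM2r => //; apply: le_trans h2; exact: ler_wpM2l.
  have t3 : `|sg z * (Gamma (w + u) - Gamma w - dG w * u)| <= e / 3 * `|u|.
    rewrite normrM; apply: le_trans (ler_pM _ _ (bs _) k3) _ => //.
    by rewrite mulrA; apply: ler_wpM2r.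
  apply: (le_trans (ler_normD _ _)).
  apply: (le_trans (lerD (ler_normD _ _) (lexx _))).
  by apply: (le_trans (lerD (lerD t1 t2) t3)); exact: le_thirds.
Qed.

Lemma sigma_id z : `|z| <= r -> sigma chi r z = z.
Proof.
move=> zr; have [_ _ id1 _ _] := cut.
have zr1 : `|z / r| <= 1 by rewrite normrM normfV (gtr0_norm r0) ler_pdivrMr// mul1r.
by rewrite /sigma (id1 _ zr1) mulrC divfK// gt_eqF.
Qed.

End kernel_of_coupling.
End kernels.

(** * Lyapunov-Perron fixed points *)

Section lyapunov_perron.
Context (R : realType).
Variables (V W : normedModType R).
Variables (h0 : V -> W) (F : V -> W -> V) (Dh0 : V -> V -> W).
Variables (eps eta Q M P MH C2 Kh : R).
Hypotheses (cV : seq_complete V) (cW : seq_complete W).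
Hypotheses (eps0 : 0 < eps) (eta0 : eta < 0) (el : eps * (- eta) < 1).
Hypotheses (Q0 : 0 <= Q) (M0 : 0 <= M) (P0 : 0 <= P) (Kh0 : 0 <= Kh).
Hypothesis F_lip : forall v w v' w',
  `|F v w - F v' w'| <= Q * `|v - v'| + M * `|w - w'|.
Hypothesis h0_lip : forall v v', `|h0 v - h0 v'| <= P * `|v - v'|.
Hypothesis h0_bd : forall v, `|h0 v| <= MH.
Hypothesis F_bd : forall v w, `|F v w| <= C2.
Hypothesis Dh0_lin : forall v c x y, Dh0 v (c *: x + y) = c *: Dh0 v x + Dh0 v y.
Hypothesis Dh0_bd : forall v x, `|Dh0 v x| <= P * `|x|.
Hypothesis Dh0_frechet : forall v, frechet h0 (Dh0 v) v.
Hypothesis Dh0_lip : forall v v' x, `|Dh0 v x - Dh0 v' x| <= Kh * `|v - v'| * `|x|.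

Let forcing (xi : R -> W) (th : R -> V) (s : R) : V := F (th s) (h0 (th s) + xi s).

Let lp1 (xi : R -> W) (th : R -> V) (t : R) : W :=
  - rint_ninfty (fun s => expR (- ((t - s) / eps)) *: Dh0 (th s) (forcing xi th s)) t.

Let lp2 (v0 : V) (xi : R -> W) (th : R -> V) (t : R) : V :=
  v0 + rint (forcing xi th) 0 t.

Notation bsol := (backward_solution h0 F eps (- eta)).

Let contd_forcing xi th t : contd setT xi t -> contd setT th t ->
  contd setT (forcing xi th) t.
Proof.
move=> cxi cth; have ca := contdD (contd_lip P0 (fun s => h0_lip (th s) (th t)) cth) cxi.
apply: contd_by (vanishesD (vanishesZ Q0 (vanishes_contd cth)) (vanishesZ M0 (vanishes_contd ca))) _.
by move=> s; exact: F_lip.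
Qed.

Let contd_Dforcing xi th t : contd setT xi t -> contd setT th t ->
  contd setT (fun s => Dh0 (th s) (forcing xi th s)) t.
Proof.
move=> cxi cth; have cF := contd_forcing cxi cth.
have C20 : 0 <= C2 by exact: le_trans (F_bd 0 0).
have KC : 0 <= Kh * C2 by rewrite mulr_ge0.
apply: contd_by (vanishesD (vanishesZ KC (vanishes_contd cth)) (vanishesZ P0 (vanishes_contd cF))) _.
move=> s.
rewrite (_ : _ - _ = (Dh0 (th s) (forcing xi th s) - Dh0 (th t) (forcing xi th s))
  + Dh0 (th t) (forcing xi th s - forcing xi th t)); last first.
  by rewrite (linear_sub (Dh0_lin _)); lmod R.
apply: (le_trans (ler_normD _ _)); apply: lerD; last exact: Dh0_bd.
apply: le_trans (Dh0_lip _ _ _) _; rewrite mulrAC; apply: ler_wpM2r => //.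
by apply: ler_wpM2l => //; exact: F_bd.
Qed.

Let contd_exp (U : normedModType R) (u : R -> U) (c b t : R) : contd setT u t ->
  contd setT (fun s => (b * expR (c * s)) *: u s) t.
Proof. by apply: contdM; apply: hasd_contd; apply: hasdZl; exact: hasd_expRM. Qed.

Let minE (s : R) : s <= 0 -> Num.min s 0 = s. Proof. exact: min_l. Qed.

Lemma filter_kernelE (t s : R) : expR (- ((t - s) / eps)) = expR (- eps^-1 * t) * expR (eps^-1 * s).
Proof. by rewrite -expRD; congr expR; ring. Qed.

(** Evaluates the improper integral once the integrand has the primitive [G],
    exponentially small at -oo. *)
Let rint_ninfty_lim (f : R -> W) (t : R) (G : R -> W) (l : W) : t <= 0 ->
  (forall a, a <= t -> rint f a t = l - G a) ->
  (exists2 C, 0 <= C & forall a, a <= 0 -> `|G a| <= C * expR (eps^-1 * a)) ->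
  rint_ninfty f t = l.
Proof.
move=> t0 hf [C C0 GC]; apply: cvg_lim => //; apply/cvgrPdist_le => e e0.
have ie0 : 0 < eps^-1 by rewrite invr_gt0.
have [T T0 hT] := expR_small ie0 C0 e0.
exists (Num.min t (- T)); split; first exact: num_real.
move=> a; rewrite lt_min => /andP[/ltW at_ /ltW aT] /=.
rewrite hf// opprB addrC subrK; apply: le_trans (GC a (le_trans at_ t0)) _.
exact: hT.
Qed.

(** Variation of constants: [exp (t / eps) xi] is up to sign a primitive of the
    integrand, and it vanishes at -oo since [a] and [h0 th] are bounded. *)
Lemma backward_solution_lp th a : bsol th a ->
  let xi := fun t => a t - h0 (th t) in
  forall t, t <= 0 -> lp1 xi th t = xi t /\ lp2 (th 0) xi th t = th t.
Proof.
move=> b xi t t0; have [dth da gth ga] := b.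
have aE s : h0 (th s) + xi s = a s by rewrite /xi subrKC.
have cth s : s <= 0 -> contd setT th s by move=> s0; exact: hasd_contd (dth s s0).
have cxi s : s <= 0 -> contd setT xi s.
  move=> s0; rewrite /xi; apply: contdD; first exact: hasd_contd (da s s0).
  apply: contd_lip P0 _ (cth s s0) => q.
  by rewrite -opprD normrN; exact: h0_lip.
have min0 (s : R) : Num.min s 0 <= 0 by rewrite ge_min lexx orbT.
split; last first.
  rewrite /lp2; have [|||_ ->] := @rint_primitive _ _ (forcing xi th) (fun s => forcing xi th (Num.min s 0)) th t 0 t0.
  - by move=> s /andP[_ s0]; rewrite minE.
  - by move=> s; apply: contd_min0; apply: contd_forcing; [exact: cxi|exact: cth].
  - move=> s /andP[_ s0]; rewrite minE// /forcing aE.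
    exact: hasd_sub (dth s s0).
  by rewrite subrKC.
rewrite /lp1; apply: oppr_inj; rewrite opprK.
pose ez s := expR (eps^-1 * s) *: xi s.
have dxi s : s <= 0 -> hasd setT xi s (- (eps^-1 *: xi s) - Dh0 (th s) (F (th s) (a s))).
  move=> s0; have := hasdB (da s s0) (hasd_critical Dh0_lin Dh0_bd Dh0_frechet s0 b).
  by congr (hasd _ _ _ _); rewrite /xi; lmod R.
have dez s : s <= 0 -> hasd setT ez s (- (expR (eps^-1 * s) *: Dh0 (th s) (forcing xi th s))).
  move=> s0; have := hasdM (@hasd_expRM _ setT eps^-1 s) (dxi s s0).
  by congr (hasd _ _ _ _); rewrite /forcing aE; lmod R.
apply: (@rint_ninfty_lim _ t (fun s => - (expR (- eps^-1 * t) *: ez s))) => //.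
  move=> s st.
  have [] := @rint_primitive _ _
    (fun s => expR (- ((t - s) / eps)) *: Dh0 (th s) (forcing xi th s))
    (fun q => (expR (- eps^-1 * t) * expR (eps^-1 * Num.min q 0)) *:
       Dh0 (th (Num.min q 0)) (forcing xi th (Num.min q 0)))
    (fun q => - (expR (- eps^-1 * t) *: ez q)) s t st.
  - by move=> q /andP[_ qt]; rewrite minE ?(le_trans qt)// filter_kernelE.
  - move=> q; apply: (@contd_min0 _ _ (fun q => (expR (- eps^-1 * t) * expR (eps^-1 * q)) *:
       Dh0 (th q) (forcing xi th q))).
    by apply: contd_exp; apply: contd_Dforcing; [exact: cxi|exact: cth].
  - move=> q /andP[_ qt]; have q0 := le_trans qt t0; rewrite minE//.
    apply: (@hasd_sub _ _ setT) => //.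
    have := hasdN (hasdZ (expR (- eps^-1 * t)) (dez q q0)).
    by congr (hasd _ _ _ _); lmod R.
  move=> -> _; congr (_ - _).
  rewrite /ez scalerA -expRD -mulrDl addNr mul0r expR0 scale1r//.
have MH0 : 0 <= MH by apply: le_trans (h0_bd 0).
exists (expR (- eps^-1 * t) * (MH + MH)); first by rewrite mulr_ge0 ?expR_ge0 ?addr_ge0.
move=> s s0; rewrite normrN normrZ /ez normrZ !ger0_norm ?expR_ge0//.
rewrite -mulrA (mulrC (MH + MH)); apply: ler_wpM2l; first exact: expR_ge0.
apply: ler_wpM2l; first exact: expR_ge0.
apply: (le_trans (ler_normB _ _)); apply: lerD; last exact: h0_bd.
exact: (fast_bound eps0 el h0_bd b s0).
Qed.

(** A fixed point is differentiable because it is given by primitives; these also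
    extend it past time 0, which makes its derivative at 0 two-sided. *)
Lemma lp_backward_solution v0 xi th :
  (forall t, contd setT (fun s => xi (Num.min s 0)) t) ->
  (forall t, contd setT (fun s => th (Num.min s 0)) t) ->
  exp_growth (- eta) xi -> exp_growth (- eta) th ->
  (forall t, t <= 0 -> lp1 xi th t = xi t /\ lp2 v0 xi th t = th t) ->
  exists th' a', [/\ bsol th' a', th' 0 = v0 &
    forall t, t <= 0 -> th t = th' t /\ xi t = a' t - h0 (th' t)].
Proof.
move=> cxi cth gxi gth fixed.
have C20 : 0 <= C2 by apply: le_trans (F_bd 0 0).
have ie0 : 0 < eps^-1 by rewrite invr_gt0.
pose xic s := xi (Num.min s 0); pose thc s := th (Num.min s 0).
have fE s : s <= 0 -> forcing xi th s = forcing xic thc s.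
  by move=> s0; rewrite /forcing /xic /thc minE.
have cB t : contd setT (forcing xic thc) t by exact: contd_forcing.
have [G1 dG1] := primitive cV cB.
pose th' t := v0 + (G1 t - G1 0).
have thE t : t <= 0 -> th t = th' t.
  move=> t0; have [_ <-] := fixed t t0; rewrite /lp2 /th'; congr (_ + _).
  have [|||_ ->//] := @rint_primitive _ _ (forcing xi th) (forcing xic thc) G1 t 0 t0.
  - by move=> s /andP[_]; exact: fE.
  - exact: cB.
  - by move=> s _; exact: hasd_sub (dG1 s).
pose g s := (1 * expR (eps^-1 * s)) *: Dh0 (thc s) (forcing xic thc s).
have cg t : contd setT g t by apply: contd_exp; exact: contd_Dforcing.
have PC0 : 0 <= P * C2 by rewrite mulr_ge0.
have [G2 [dG2 G2B]] := @primitive_ninfty _ _ g eps^-1 (P * C2) cW ie0 PC0 cg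
  (ltac:(move=> s s0; rewrite normrZ mul1r ger0_norm ?expR_ge0// mulrC;
    apply: ler_wpM2r; [exact: expR_ge0|]; apply: le_trans (Dh0_bd _ _) _;
    apply: ler_wpM2l => //; exact: F_bd)).
pose xi' t := - (expR (- eps^-1 * t) *: G2 t).
have xiE t : t <= 0 -> xi t = xi' t.
  move=> t0; have [<- _] := fixed t t0; rewrite /lp1 /xi'; congr (- _).
  apply: (@rint_ninfty_lim _ t (fun s => expR (- eps^-1 * t) *: G2 s)) => //.
    move=> s st.
    have [|||-> _ //] := @rint_primitive _ _
      (fun s => expR (- ((t - s) / eps)) *: Dh0 (th s) (forcing xi th s))
      (fun s => (expR (- eps^-1 * t) * expR (0 * s)) *: g s) (fun s => expR (- eps^-1 * t) *: G2 s) s t st.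
    - move=> q /andP[_ qt]; have q0 := le_trans qt t0.
      by rewrite filter_kernelE /g mul0r expR0 mulr1 mul1r scalerA (fE _ q0) /thc minE.
    - by move=> q; exact: contd_exp.
    - move=> q _; rewrite mul0r expR0 mulr1; apply: hasdZ; exact: hasd_sub (dG2 q).
  have Pe0 : 0 <= P * C2 / eps^-1 by rewrite divr_ge0// ltW.
  exists (expR (- eps^-1 * t) * (P * C2 / eps^-1)); first by rewrite mulr_ge0 ?expR_ge0.
  move=> s s0; rewrite normrZ ger0_norm ?expR_ge0// -[leRHS]mulrA.
  by apply: ler_wpM2l; [exact: expR_ge0|exact: G2B].
have dth' t : hasd setT th' t (forcing xic thc t).
  rewrite -[forcing _ _ _]add0r; apply: hasdD; first exact: hasd_cst.
  by rewrite -[forcing _ _ _]subr0; apply: hasdB => //; exact: hasd_cst.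
have thcE t : t <= 0 -> thc t = th' t by move=> t0; rewrite /thc minE// thE.
have xicE t : t <= 0 -> xic t = xi' t by move=> t0; rewrite /xic minE// xiE.
exists th', (fun t => h0 (th' t) + xi' t); split; last first.
- by move=> t t0; rewrite (thE t t0) (xiE t t0) addrAC subrr add0r.
- by rewrite /th' subrr addr0.
have [C C0 hC] := gth; have [C' C'0 hC'] := gxi.
have MH0 : 0 <= MH by apply: le_trans (h0_bd 0).
split.
- move=> t t0; have := dth' t; congr (hasd _ _ _ _).
  by rewrite /forcing (thcE t t0) (xicE t t0).
- move=> t t0.
  have d1 := hasd_comp (@Dh0_lin (th' t)) (@Dh0_bd (th' t)) (@Dh0_frechet (th' t)) (dth' t).
  have d2 := hasdN (hasdM (@hasd_expRM _ setT (- eps^-1) t) (dG2 t)).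
  have := hasdD d1 d2; congr (hasd _ _ _ _).
  rewrite /g (thcE t t0) mul1r [in X in _ + X]scalerA -expRD -mulrDl addNr mul0r expR0 scale1r.
  rewrite /xi'; lmod R.
- by exists C => // t t0; rewrite -(thE t t0) hC.
exists (MH + C') => [|t t0]; first exact: addr_ge0.
apply: (le_trans (ler_normD _ _)); rewrite mulrDl; apply: lerD; last by rewrite -(xiE t t0) hC'.
apply: (le_trans (h0_bd _)); apply: ler_peMr => //.
rewrite -expR0 ler_expR opprK; rewrite nmulr_rge0//.
Qed.

End lyapunov_perron.

(** * The operators of the adaptive network *)

Section concrete_operators.
Context (R : realType).

Notation T := (measurableTypeR R).
Notation I01 := (leb01 R).
Notation I01sq := (leb01sq R).
Implicit Types (th v x : Xtheta R) (a w p : Xa R).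

Lemma Linf_of_ae d (X : measurableType d) (mu : {measure set X -> \bar R}) (f : X -> R)
    (u : Linf mu) :
  measurable_fun setT f -> (\forall q \ae mu, u q = f q) -> Linf_of mu f = u.
Proof.
move=> mf uf; have bf : ess_bounded mu f.
  apply: (@ess_bounded_ae _ _ _ _ _ `|u|) => //.
  by apply: filterS2 uf (Linf_ae_le u) => q <-.
by apply: Linf_ext; apply: filterS2 (ae_Linf_of bf) uf => q -> ->.
Qed.

(** Both vector fields of the slow equation integrate an explicit kernel over
    sections; this exhibits them as averages of elements of L^oo of the square. *)
Lemma forced_average (om : Xtheta R) (u : Xa R) (k : T * T -> R) :
  measurable_fun [set: T * T] k -> (\forall q \ae I01sq, Linf_fun u q = k q) ->
  Linf_of I01 (fun x : T => om x + \int[I01]_y k (x, y)) = om + average u.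
Proof.
move=> mk uk; apply: Linf_of_ae.
  apply: measurable_funD; first exact: Linf_measurable.
  exact: measurable_section_integral.
apply: filterS3 (ae_Linf_add om (average u)) (ae_average u) (ae_sections uk).
move=> x -> -> h; congr (_ + _); apply: ae_eq_Rintegral h.
- exact: measurable_section (Linf_measurable u).
- exact: measurable_section.
Qed.

Lemma average_sub p w : average (p - w) = average p - average w.
Proof. exact: (linear_sub (@average_lin R)). Qed.

Lemma lift1_add v x : lift1 (v + x) = lift1 v + lift1 x.
Proof. by have := lift1_lin 1 v x; rewrite !scale1r. Qed.

Lemma lift2_add v x : lift2 (v + x) = lift2 v + lift2 x.
Proof. by have := lift2_lin 1 v x; rewrite !scale1r. Qed.

Lemma lift1_dist v x : `|lift1 v - lift1 x| <= `|v - x|.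
Proof. by rewrite -(linear_sub (@lift1_lin R)); exact: lift1_norm. Qed.

Lemma lift2_dist v x : `|lift2 v - lift2 x| <= `|v - x|.
Proof. by rewrite -(linear_sub (@lift2_lin R)); exact: lift2_norm. Qed.

Definition phase_diff v : Xa R := lift2 v - lift1 v.

Lemma phase_diff_lin c v x : phase_diff (c *: v + x) = c *: phase_diff v + phase_diff x.
Proof. rewrite /phase_diff lift1_lin lift2_lin; lmod R. Qed.

Lemma phase_diff_add v x : phase_diff (v + x) = phase_diff v + phase_diff x.
Proof. by have := phase_diff_lin 1 v x; rewrite !scale1r. Qed.

Lemma phase_diff_norm v : `|phase_diff v| <= 2 * `|v|.
Proof.
apply: (le_trans (ler_normB _ _)); have := lift1_norm v; have := lift2_norm v.
by move=> h1 h2; rewrite mulr2n mulrDl mul1r; exact: lerD.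
Qed.

Lemma phase_diff_dist v x : `|phase_diff v - phase_diff x| <= 2 * `|v - x|.
Proof.
by rewrite -(linear_sub phase_diff_lin); exact: phase_diff_norm.
Qed.

Lemma ae_phase_diff v : \forall q \ae I01sq, Linf_fun (phase_diff v) q = v q.2 - v q.1.
Proof.
apply: filterS3 (ae_Linf_sub (lift2 v) (lift1 v)) (ae_lift1 v) (ae_lift2 v).
by move=> q -> -> ->.
Qed.

Section critical_manifold.
Variable H : R * R -> R.
Hypothesis cbH : Cb [set @axis1 R; @axis2 R] 2 H.

Let kH := H_kernel cbH.

Let m0 : 0 <= M_DH H. Proof. by have [] := kernel_ge0 kH. Qed.

Lemma h0E v : h0 H v = nemytskii (fun z t => H (z, t)) (lift1 v) (lift2 v).
Proof.
apply: Linf_of_ae.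
  by have [] := kernel_measurable kH (measurable_lift1 v) (measurable_lift2 v).
apply: filterS3 (ae_nemytskii kH (lift1 v) (lift2 v)) (ae_lift1 v) (ae_lift2 v).
by move=> q -> -> ->.
Qed.

Lemma Dh0E v x : Dh0 H v x = Dnemytskii (fun z t => d1H H (z, t)) (fun z t => d2H H (z, t))
  (lift1 v) (lift2 v) (lift1 x) (lift2 x).
Proof.
apply: Linf_of_ae.
  have [_ m1 m2] := kernel_measurable kH (measurable_lift1 v) (measurable_lift2 v).
  apply: measurable_funD; apply: measurable_funM => //.
    exact: measurable_lift1.
  exact: measurable_lift2.
apply: filterS3 (ae_Dnemytskii kH (lift1 v) (lift2 v) (lift1 x) (lift2 x))
  (filterI (ae_lift1 v) (ae_lift2 v)) (filterI (ae_lift1 x) (ae_lift2 x)).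
by move=> q -> [-> ->] [-> ->].
Qed.

Lemma calGE v w : calG H v w = h0 H v - w.
Proof.
have mHv : measurable_fun setT (fun q : T * T => H (v q.1, v q.2)).
  by have [] := kernel_measurable kH (measurable_lift1 v) (measurable_lift2 v).
apply: Linf_of_ae.
  apply: measurable_funD => //.
  by apply: measurableT_comp => //; exact: Linf_measurable.
rewrite h0E; apply: filterS3 (ae_Linf_sub (nemytskii (fun z t => H (z, t)) (lift1 v) (lift2 v)) w)
  (ae_nemytskii kH (lift1 v) (lift2 v)) (filterI (ae_lift1 v) (ae_lift2 v)).
by move=> q -> -> [-> ->]; rewrite addrC.
Qed.

Lemma critical_bd v : `|h0 H v| <= M_H H.
Proof. by rewrite h0E; exact: nemytskii_norm kH _ _. Qed.

Lemma critical_lip v x : `|h0 H v - h0 H x| <= 2 * M_DH H * `|v - x|.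
Proof.
rewrite !h0E; apply: le_trans (nemytskii_lip kH _ _ _ _) _.
have := ler_wpM2l m0 (lift1_dist v x); have := ler_wpM2l m0 (lift2_dist v x); lra.
Qed.

Lemma Dcritical_lin v c x y : Dh0 H v (c *: x + y) = c *: Dh0 H v x + Dh0 H v y.
Proof. by rewrite !Dh0E lift1_lin lift2_lin; exact: (Dnemytskii_lin kH). Qed.

Lemma Dcritical_bd v x : `|Dh0 H v x| <= 2 * M_DH H * `|x|.
Proof.
rewrite Dh0E; apply: le_trans (Dnemytskii_norm kH _ _ _ _) _.
have := ler_wpM2l m0 (lift1_norm x); have := ler_wpM2l m0 (lift2_norm x); lra.
Qed.

Lemma Dcritical_rem (e : R) : 0 < e -> exists2 d : R, 0 < d & forall v x, `|x| <= d ->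
  `|h0 H (v + x) - h0 H v - Dh0 H v x| <= e * `|x|.
Proof.
move=> e0; have e2 : 0 < e / 2 by rewrite divr_gt0.
have [d d0 h] := nemytskii_rem I01sq kH e2; exists d => // v x xd.
rewrite !h0E Dh0E lift1_add lift2_add.
apply: le_trans (h _ _ _ _ (le_trans (lift1_norm x) xd) (le_trans (lift2_norm x) xd)) _.
rewrite [leRHS](_ : _ = e / 2 * (`|x| + `|x|)); last by field.
apply: ler_wpM2l; first exact: ltW.
exact: lerD (lift1_norm x) (lift2_norm x).
Qed.

Lemma Dcritical_lip v v' x :
  `|Dh0 H v x - Dh0 H v' x| <= 4 * M_D2H H * `|v - v'| * `|x|.
Proof.
have K0 := M_D2H_ge0 cbH; rewrite !Dh0E.
have [_ _ _ _ [_ _ _ l1 l2]] := H_regularity cbH.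
apply: le_trans (Dnemytskii_lip kH K0 _ _ _ _ _ _ _) _; first by move=> *; split.
rewrite [leRHS](_ : _ = M_D2H H * (`|v - v'| + `|v - v'|) * (`|x| + `|x|)); last by ring.
apply: ler_pM; rewrite ?mulr_ge0 ?addr_ge0//; last exact: lerD (lift1_norm x) (lift2_norm x).
by apply: ler_wpM2l => //; exact: lerD (lift1_dist v v') (lift2_dist v v').
Qed.

End critical_manifold.

Lemma measurable_phase v : measurable_fun setT (fun q : T * T => v q.2 - v q.1).
Proof.
by apply: measurable_funB; [exact: measurable_lift2|exact: measurable_lift1].
Qed.

Section uncut_coupling.
Variables (Gamma : R -> R) (omega : Xtheta R).
Hypothesis cbG : Cb [set (1 : R)] 1 Gamma.
Hypothesis perG : forall z, Gamma (z + 2 * pi) = Gamma z.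

Definition coupled v w : Xa R := Linf_of I01sq (fun q => w q * Gamma (v q.2 - v q.1)).

Lemma measurable_coupled v w : measurable_fun setT (fun q => w q * Gamma (v q.2 - v q.1)).
Proof.
have [cG _ _ _ _] := Gamma_regularity cbG perG.
apply: measurable_funM; first exact: Linf_measurable.
by apply: measurableT_comp (measurable_phase v); exact: continuous_measurable_fun.
Qed.

Lemma ae_coupled v w : \forall q \ae I01sq, Linf_fun (coupled v w) q = w q * Gamma (v q.2 - v q.1).
Proof.
have [_ _ _ [bG _] _] := Gamma_regularity cbG perG.
apply: ae_Linf_of; apply: (ess_bounded_ae (M := `|w| * M_Gamma Gamma)).
  exact: measurable_coupled.
by apply: filterS (Linf_ae_le w) => q hq; rewrite normrM ler_pM.
Qed.

Lemma calFE v w : calF Gamma omega v w = omega + average (coupled v w).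
Proof.
apply: (@forced_average omega (coupled v w) (fun q => w q * Gamma (v q.2 - v q.1))).
  exact: measurable_coupled.
exact: ae_coupled.
Qed.

Lemma calF_lip v w w' :
  `|calF Gamma omega v w - calF Gamma omega v w'| <= M_Gamma Gamma * `|w - w'|.
Proof.
have [_ _ _ [bG _] _] := Gamma_regularity cbG perG.
rewrite !calFE opprD addrACA subrr add0r -average_sub.
apply: le_trans (average_norm _) _; apply: Linf_norm_le.
  by rewrite mulr_ge0// (le_trans _ (bG 0)).
apply: filterS3 (ae_Linf_sub (coupled v w) (coupled v w'))
  (filterI (ae_coupled v w) (ae_coupled v w')) (Linf_dist_ae w w').
by move=> q -> [-> ->] hq; rewrite -mulrBl normrM mulrC ler_pM.
Qed.

End uncut_coupling.

Section coupling.
Variables (Gamma chi : R -> R) (omega : Xtheta R) (r : R).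
Hypotheses (cbG : Cb [set (1 : R)] 1 Gamma).
Hypothesis perG : forall z, Gamma (z + 2 * pi) = Gamma z.
Hypothesis cut : cutoff chi.
Hypothesis r0 : 0 < r.

Let e (z t : R) := sigma chi r z * Gamma t.
Let e1 (z w : R) := 'D_1 chi (z / r) * Gamma w.
Let e2 (z w : R) := sigma chi r z * 'D_1 Gamma w.
Let ke : smooth_kernel e e1 e2 (2 * r * M_Gamma Gamma) (M_Gamma Gamma) (2 * r * L_Gamma Gamma)
  := coupling_kernel cbG perG cut r0.

Let MG0 : 0 <= M_Gamma Gamma. Proof. by have [] := kernel_ge0 ke. Qed.
Let LG0 : 0 <= 2 * r * L_Gamma Gamma. Proof. by have [] := kernel_ge0 ke. Qed.

Lemma calFrE v w :
  calFr Gamma omega chi r v w = omega + average (nemytskii e w (phase_diff v)).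
Proof.
apply: (@forced_average omega (nemytskii e w (phase_diff v))
  (fun q => sigma chi r (w q) * Gamma (v q.2 - v q.1))).
  by have [] := kernel_measurable ke (Linf_measurable w) (measurable_phase v).
apply: filterS2 (ae_nemytskii ke w (phase_diff v)) (ae_phase_diff v).
by move=> q -> ->.
Qed.

Lemma calF_calFr v w : `|w| <= r -> calF Gamma omega v w = calFr Gamma omega chi r v w.
Proof.
move=> wr; rewrite (calFE omega cbG perG) calFrE; congr (_ + average _); apply: Linf_ext.
apply: filterS3 (ae_coupled cbG perG v w) (ae_nemytskii ke w (phase_diff v))
  (filterI (ae_phase_diff v) (Linf_ae_le w)) => q -> -> [-> hq].
by rewrite /e (sigma_id cut r0)// (le_trans hq).
Qed.

Lemma calFr_bd v w : `|calFr Gamma omega chi r v w| <= C2 Gamma omega r.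
Proof.
rewrite calFrE; apply: (le_trans (ler_normD _ _)); rewrite lerD2l.
by apply: le_trans (average_norm _) _; exact: nemytskii_norm ke _ _.
Qed.

Lemma calFr_lip v w v' w' :
  `|calFr Gamma omega chi r v w - calFr Gamma omega chi r v' w'|
    <= 4 * r * L_Gamma Gamma * `|v - v'| + M_Gamma Gamma * `|w - w'|.
Proof.
rewrite !calFrE opprD addrACA subrr add0r -average_sub.
apply: le_trans (average_norm _) _; apply: le_trans (nemytskii_lip ke _ _ _ _) _.
have := ler_wpM2l LG0 (phase_diff_dist v v'); lra.
Qed.

Definition DcalFr v w x p : Xtheta R :=
  average (Dnemytskii e1 e2 w (phase_diff v) p (phase_diff x)).

Lemma DcalFr_lin v w c x y p q :
  DcalFr v w (c *: x + y) (c *: p + q) = c *: DcalFr v w x p + DcalFr v w y q.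
Proof. by rewrite /DcalFr phase_diff_lin (Dnemytskii_lin ke) average_lin. Qed.

Lemma DcalFr_bd v w x p :
  `|DcalFr v w x p| <= 4 * r * L_Gamma Gamma * `|x| + M_Gamma Gamma * `|p|.
Proof.
apply: le_trans (average_norm _) _; apply: le_trans (Dnemytskii_norm ke _ _ _ _) _.
have := ler_wpM2l LG0 (phase_diff_norm x); lra.
Qed.

Let half_bd (eps s t : R) : 0 < eps -> 0 <= s -> 0 <= t ->
  eps / 2 * (s + 2 * t) <= eps * (t + s).
Proof. by move=> e0 s0 t0; have := mulr_ge0 (ltW e0) s0; lra. Qed.

Lemma DcalFr_rem (eps : R) : 0 < eps -> exists2 d : R, 0 < d & forall v w x p,
  `|x| <= d -> `|p| <= d ->
  `|calFr Gamma omega chi r (v + x) (w + p) - calFr Gamma omega chi r v w - DcalFr v w x p|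
     <= eps * (`|x| + `|p|).
Proof.
move=> e0; have e20 : 0 < eps / 2 by rewrite divr_gt0.
have [d d0 h] := nemytskii_rem I01sq ke e20.
exists (d / 2) => [|v w x p xd pd]; first by rewrite divr_gt0.
have x2 : 2 * `|x| <= d by lra.
rewrite !calFrE /DcalFr opprD addrACA subrr add0r -!average_sub.
apply: le_trans (average_norm _) _; rewrite phase_diff_add.
apply: le_trans (h _ _ _ _ _ (le_trans (phase_diff_norm x) x2)) _; first by lra.
apply: le_trans (half_bd e0 (normr_ge0 p) (normr_ge0 x)).
by rewrite ler_pM2l// lerD2l phase_diff_norm.
Qed.

End coupling.

End concrete_operators.

(** * Maps and graphs of class C^1 *)

Section frechet_C1.
Context (R : realType).
Implicit Types V W : normedModType R.

Lemma opnorm_le V W (A : V -> W) (K : R) : 0 <= K -> (forall v, `|A v| <= K * `|v|) ->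
  (opnorm A <= K%:E)%E.
Proof.
move=> K0 hA; apply/ereal_supP => _ [v /= v1 <-]; rewrite lee_fin.
by apply: le_trans (hA v) _; rewrite ler_piMr.
Qed.

Lemma opnorm_ge0 V W (A : V -> W) : (0 <= opnorm A)%E.
Proof.
apply: (@le_trans _ _ (`|A 0|%:E)%E); first by rewrite lee_fin.
by apply: ereal_sup_ubound; exists 0 => //=; rewrite normr0.
Qed.

Lemma frechet_diff V W (f L : V -> W) (x : V) (K : R) :
  (forall c v w, L (c *: v + w) = c *: L v + L w) ->
  (forall v, `|L v| <= K * `|v|) -> frechet f L x ->
  differentiable f x /\ ('d f x : V -> W) = L.
Proof.
move=> Llin LK fL.
pose A : {linear V -> W} := HB.pack L (GRing.isLinear.Build R V W _ L Llin).
have cA : continuous A.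
  apply/(linear_bounded_continuous A)/linear_boundedP.
  by near=> k => v; apply: le_trans (LK v) _; apply: ler_wpM2r => //;
    near: k; exact: nbhs_pinfty_ge (num_real K).
have dA : f \o shift x = cst (f x) + A +o_ 0 id.
  apply/eqaddoP => e e0; have [d d0 h] := fL e e0.
  near=> v; rewrite /= !fctE /=.
  have := h (v + x); rewrite addrK opprD addrA; apply.
  by near: v; exact: nbhs0_le.
have dE := diff_unique cA dA.
by split => //; apply/diff_locallyP; rewrite dE.
Unshelve. all: by end_near. Qed.

(** Continuity of the derivative in operator norm costs nothing, as remainders uniform
    in the base point already imply it. *)
Lemma C1_of_uniform V W (f : V -> W) (f' : V -> V -> W) (K : R) (U : set V) :
  (forall x c v w, f' x (c *: v + w) = c *: f' x v + f' x w) ->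
  (forall x v, `|f' x v| <= K * `|v|) ->
  (forall e : R, 0 < e -> exists2 d : R, 0 < d & forall v x, `|x| <= d ->
     `|f (v + x) - f v - f' v x| <= e * `|x|) ->
  C1_on U f.
Proof.
move=> lin bd rem x _.
have dE y := frechet_diff (lin y) (bd y) (frechet_of_uniform y rem).
split; first exact: (dE x).1.
have near_le (e : R) : 0 < e ->
    \forall y \near x, (opnorm (fun v => 'd f y v - 'd f x v)%R <= e%:E)%E.
  move=> e0; have [d d0 h] := uniform_derivative_cont lin rem e0.
  near=> y; rewrite (dE y).2 (dE x).2; apply: opnorm_le; first exact: ltW.
  rewrite -{1}(subrKC x y); apply: h; rewrite distrC; near: y; exact: cvgr_dist_le.
apply/fine_cvgP; split.
  near=> y; rewrite ge0_fin_numE ?opnorm_ge0//.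
  apply: (@le_lt_trans _ _ (1 : R)%:E); last exact: ltry.
  by near: y; exact: near_le.
apply/cvgrPdist_le => e e0; near=> y; rewrite /= sub0r normrN ger0_norm ?fine_ge0 ?opnorm_ge0//.
have h : (opnorm (fun v => 'd f y v - 'd f x v)%R <= e%:E)%E by near: y; exact: near_le.
rewrite -lee_fin fineK// ge0_fin_numE ?opnorm_ge0//.
exact: le_lt_trans h (ltry _).
Unshelve. all: by end_near. Qed.

End frechet_C1.

Section graphs.
Context (R : realType).
Variables (V W : normedModType R) (h : V -> W) (h' : V -> V -> W) (K : R).
Hypothesis K0 : 0 <= K.
Hypothesis h'_lin : forall v c x y, h' v (c *: x + y) = c *: h' v x + h' v y.
Hypothesis h'_bd : forall v x, `|h' v x| <= K * `|x|.
Hypothesis h_rem : forall e : R, 0 < e -> exists2 d : R, 0 < d & forall v x, `|x| <= d ->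
  `|h (v + x) - h v - h' v x| <= e * `|x|.

(** Translation of the fibres by [s * h]; for [s = 1] and [s = -1] these maps are
    mutually inverse, and the second flattens the graph of [h]. *)
Definition shear (s : R) (q : W * V) : W * V := (q.1 + s *: h q.2, q.2).

Lemma shear_C1 (s : R) (U : set (W * V)) : `|s| <= 1 -> C1_on U (shear s).
Proof.
move=> s1.
have sle (w : W) : `|s *: w| <= `|w| by rewrite normrZ ler_piMl.
apply: (@C1_of_uniform _ _ _ _ (fun q x => (x.1 + s *: h' q.2 x.2, x.2)) (1 + K)) => /=.
- move=> q c x y; congr pair; rewrite /= h'_lin; lmod R.
- move=> q x; have x0 := normr_ge0 x; apply: pair_norm_le.
    apply: (le_trans (ler_normD _ _)); rewrite mulrDl mul1r; apply: lerD; first exact: fst_norm_le.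
    apply: le_trans (sle _) _; apply: le_trans (h'_bd _ _) _.
    by apply: ler_wpM2l => //; exact: snd_norm_le.
  by apply: le_trans (snd_norm_le x) _; rewrite ler_peMl// lerDl.
move=> e e0; have [d d0 hd] := h_rem e0; exists d => // q x xd.
rewrite (_ : _ - _ = (s *: (h (q.2 + x.2) - h q.2 - h' q.2 x.2), 0)); last first.
  congr pair; last by change (q.2 + x.2 - q.2 - x.2 = 0); lmod R.
  change (q.1 + x.1 + s *: h (q.2 + x.2) - (q.1 + s *: h q.2)
    - (x.1 + s *: h' q.2 x.2) = s *: (h (q.2 + x.2) - h q.2 - h' q.2 x.2)).
  by lmod R.
apply: pair_norm_le; last by rewrite normr0 mulr_ge0// ltW.
apply: le_trans (sle _) _; apply: le_trans (hd _ _ (le_trans (snd_norm_le x) xd)) _.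
by apply: ler_wpM2l; [exact: ltW|exact: snd_norm_le].
Qed.

Lemma graph_C1_submanifold : C1_submanifold W V (range (fun v => (h v, v))).
Proof.
move=> p _; exists setT, setT, (shear (- 1)), (shear 1).
have n1 : `|- 1 : R| <= 1 by rewrite normrN1.
have p1 : `|1 : R| <= 1 by rewrite normr1.
split; [by split=> //; exact: openT|exact: openT|exact: shear_C1|exact: shear_C1|].
split=> [[w v] _|[w v] _|[w v] _]; rewrite /shear /= ?scale1r ?scaleN1r.
- by rewrite subrK.
- by rewrite addrK.
split=> [[x _ [<- <-]]|/subr0_eq wE]; first by rewrite subrr.
by exists v; rewrite ?wE.
Qed.

End graphs.

Section weighted_curves.
Context (R : realType) (Y : normedModType R).
Implicit Types u : R -> Y.

Lemma Cweighted_contd (eta : R) u : Cweighted eta u ->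
  forall t, contd setT (fun s => u (Num.min s 0)) t.
Proof.
move=> [/subspace_continuousP cu _] t e e0.
have m0 (s : R) : Num.min s 0 <= 0 by rewrite ge_min lexx orbT.
have : `]-oo, (0 : R)]%classic (Num.min t 0) by rewrite /= in_itv /=; exact: m0.
move=> /cu/cvgrPdist_le/(_ _ e0); rewrite near_withinE => /nbhs_ballP[d /= d0 hd].
exists d => // s _ sd; rewrite distrC; apply: hd; last by rewrite /= in_itv /=; exact: m0.
rewrite /ball /= distrC; apply: le_lt_trans sd.
rewrite ler_norml; have := ler_norm (s - t); have := ler_norm (- (s - t)); rewrite normrN.
by rewrite /Num.min; case: ltP => h1; case: ltP => h2 h3 h4; apply/andP; split; lra.
Qed.

Lemma Cweighted_growth (eta : R) u : Cweighted eta u -> exp_growth (- eta) u.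
Proof.
move=> [_ ufin].
have [C hC] : exists C : R, (wnorm eta u <= C%:E)%E.
  by move: ufin; case: (wnorm eta u) => [c _|//|_]; [by exists c|exists 0; exact: leNye].
have h t : t <= 0 -> `|u t| <= C * expR (- - eta * t).
  move=> t0; have : ((expR (- (eta * t)) * `|u t|)%:E <= C%:E)%E.
    by apply: le_trans hC; apply: ereal_sup_ubound; exists t => //=; rewrite in_itv.
  rewrite lee_fin opprK expRN mulrC ler_pdivrMr ?expR_gt0//.
exists C => //; have := h 0 (lexx 0); rewrite mulr0 expR0 mulr1; exact: le_trans.
Qed.

Lemma Cweighted_of (eta : R) u : (forall t, t <= 0 -> contd setT u t) ->
  exp_growth (- eta) u -> Cweighted eta u.
Proof.
move=> cu [C C0 gu]; split.
  apply/subspace_continuousP => t; rewrite /= in_itv /= => t0.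
  apply/cvgrPdist_le => e e0; have [d d0 hd] := cu t t0 e e0.
  rewrite near_withinE; apply/nbhs_ballP; exists d => // s; rewrite /ball /= => ts _.
  by rewrite distrC; apply: hd => //; rewrite distrC.
apply: (@le_lt_trans _ _ C%:E); last exact: ltry.
apply/ereal_supP => y [t]; rewrite /= in_itv /= => t0 <-.
rewrite lee_fin expRN mulrC ler_pdivrMr ?expR_gt0//.
by have := gu t t0; rewrite opprK.
Qed.

Lemma exp_growth_bounded (lam B : R) u : 0 <= lam -> 0 <= B -> (forall t, `|u t| <= B) ->
  exp_growth lam u.
Proof.
move=> lam0 B0 uB; exists B => // t t0; apply: le_trans (uB t) _.
by rewrite ler_peMr// -expR0 ler_expR mulNr oppr_ge0 mulr_ge0_le0.
Qed.

End weighted_curves.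

(** * The slow manifold for one value of the time scale *)

Section slow_manifold_at.
Context (R : realType).
Variables (Gamma : R -> R) (H : R * R -> R) (omega : Xtheta R) (chi : R -> R).
Variables (r eta eps0 : R).
Hypothesis sa : standing_assumptions Gamma H.
Hypothesis cut : cutoff chi.
Hypothesis rM : M_H H < r.
Hypothesis adm : admissible Gamma H omega r eta eps0.

Notation Q := (4 * r * L_Gamma Gamma).
Notation M := (M_Gamma Gamma).
Notation P := (2 * M_DH H).
Notation Fr := (calFr Gamma omega chi r).
Notation DFr := (DcalFr Gamma chi r).

Let cbG : Cb [set (1 : R)] 1 Gamma. Proof. by have [] := sa. Qed.
Let cbH : Cb [set @axis1 R; @axis2 R] 2 H. Proof. by have [] := sa. Qed.
Let perG x : Gamma (x + 2 * pi) = Gamma x. Proof. by have [] := sa. Qed.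

Let r0 : 0 < r.
Proof. by apply: le_lt_trans rM; have [] := kernel_ge0 (H_kernel cbH). Qed.

Let M0 : 0 <= M. Proof. by have [] := kernel_ge0 (coupling_kernel cbG perG cut r0). Qed.

Let Q0 : 0 <= Q.
Proof. by have [_ _] := kernel_ge0 (coupling_kernel cbG perG cut r0); lra. Qed.

Let P0 : 0 <= P. Proof. by have [_ + _] := kernel_ge0 (H_kernel cbH); lra. Qed.

Let Kh0 : 0 <= 4 * M_D2H H. Proof. by have := M_D2H_ge0 cbH; lra. Qed.

Let MP0 : 0 <= M * P. Proof. exact: mulr_ge0. Qed.

Let lam0 : 0 < - eta. Proof. by have [[h _] _ _ _ _] := adm; rewrite oppr_gt0. Qed.

Lemma admissible_gap : M + M * P + Q < - eta / 2.
Proof.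
have [_ h _ _ _] := adm.
move: h; rewrite ltr0_norm -?oppr_gt0// ltr_pdivrMr// /C4 => h; lra.
Qed.

Variable eps : R.
Hypothesis he : 0 < eps <= eps0.

Let e0 : 0 < eps. Proof. by have /andP[] := he. Qed.

Let el : eps * (- eta) <= 1 / 2.
Proof. by have [_ _ _ h _] := adm; have := h eps he; lra. Qed.

Let el1 : eps * (- eta) < 1. Proof. by move: el; lra. Qed.

Let inv_le2 : (1 - eps * (- eta))^-1 <= 2.
Proof.
rewrite -[2]invrK lef_pV2 ?posrE ?invr_gt0//; first by move: el; lra.
by rewrite subr_gt0.
Qed.

Let L : R := P / (1 - eps * (- eta)).

Let L0 : 0 <= L. Proof. by rewrite divr_ge0// ltW// subr_gt0. Qed.

Let L2 : L <= 2 * P.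
Proof. by rewrite /L [leRHS]mulrC; apply: ler_wpM2l. Qed.

Let small : eps * (L * M) <= 1 / 2.
Proof.
have h1 : L * M <= 2 * (M * P) by have := ler_wpM2r M0 L2; lra.
have h2 : L * M <= - eta by have := admissible_gap; have := M0; have := Q0; lra.
exact: le_trans (ler_wpM2l (ltW e0) h2) el.
Qed.

Let gap : Q + M * P / (1 - eps * (- eta)) < - eta.
Proof.
have := ler_wpM2l MP0 inv_le2; have := admissible_gap; have := M0; have := Q0; lra.
Qed.

(** Since the gap condition is strict it survives a slightly faster growth rate;
    the extra room is what absorbs the higher-order terms in the linearization. *)
Lemma wider_gap : exists nu : R, [/\ 0 < nu, eps * (- eta + nu) < 1 &
  Q + M * P / (1 - eps * (- eta + nu)) < - eta + nu].
Proof.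
set g := - eta - (Q + M * P / (1 - eps * (- eta))).
have g0 : 0 < g by rewrite subr_gt0.
pose nu := Num.min (4 * eps)^-1 (g / 2).
have nu0 : 0 < nu by rewrite lt_min invr_gt0 mulr_gt0// divr_gt0.
have en : eps * nu <= 1 / 4.
  have : nu <= (4 * eps)^-1 by rewrite ge_min lexx.
  move=> /(ler_wpM2l (ltW e0)); rewrite [X in _ <= X](_ : _ = 1 / 4)//.
  by field; rewrite gt_eqF.
have ng : nu <= g / 2 by rewrite ge_min lexx orbT.
set D := 1 - eps * (- eta); set D' := 1 - eps * (- eta + nu).
have D'E : D' = D - eps * nu by rewrite /D' /D mulrDr opprD addrA.
have D2 : 1 / 2 <= D by rewrite /D; move: el; lra.
have D'4 : 1 / 4 <= D' by rewrite D'E; lra.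
have D0 : 0 < D by lra.
have D'0 : 0 < D' by lra.
exists nu; split=> //; first by move: D'0; rewrite /D' subr_gt0.
have i1 : D^-1 <= 2 by rewrite -[2]invrK lef_pV2 ?posrE ?invr_gt0//; lra.
have i2 : D'^-1 <= 4 by rewrite -[4]invrK lef_pV2 ?posrE ?invr_gt0//; lra.
(* the cost of [nu] in the amplification of the filter is of second order *)
have step : D'^-1 = D^-1 + eps * nu * (D^-1 * D'^-1).
  by rewrite D'E; field; rewrite -D'E !gt_eqF.
have ii : D^-1 * D'^-1 <= 8.
  by apply: le_trans (ler_pM _ _ i1 i2) _; rewrite ?invr_ge0 ?(ltW D0) ?(ltW D'0)//; lra.
have MPe : M * P * eps <= 1 / 4.
  have h : M * P <= - eta / 2 by have := admissible_gap; have := M0; have := Q0; lra.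
  by have := ler_wpM2l (ltW e0) h; move: el; lra.
have extra : M * P * (eps * nu * (D^-1 * D'^-1)) <= 2 * nu.
  rewrite (_ : _ * _ = (M * P * eps) * (D^-1 * D'^-1) * nu); last by ring.
  apply: ler_wpM2r; first exact: ltW.
  have MPe0 : 0 <= M * P * eps by rewrite mulr_ge0// ltW.
  have DD0 : 0 <= D^-1 * D'^-1 by rewrite mulr_ge0// invr_ge0 ltW.
  by apply: le_trans (ler_pM MPe0 DD0 MPe ii) _; lra.
rewrite step mulrDr; move: ng extra nu0; rewrite /g -/D; lra.
Qed.

Let cV : seq_complete (Xtheta R) := @Linf_complete _ _ _ (leb01 R).
Let cW : seq_complete (Xa R) := @Linf_complete _ _ _ (leb01sq R).

Let F_lip := calFr_lip omega cbG perG cut r0.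
Let h0_lip := critical_lip cbH.
Let F_bd := calFr_bd omega cbG perG cut r0.
Let h0_bd := critical_bd cbH.
Let D_lin := Dcritical_lin cbH.
Let D_bd := Dcritical_bd cbH.
Let D_rem := Dcritical_rem cbH.
Let D_lip := Dcritical_lip cbH.
Let DF_lin := DcalFr_lin cbG perG cut r0.
Let DF_bd := DcalFr_bd cbG perG cut r0.
Let DF_rem := DcalFr_rem omega cbG perG cut r0.

Let D_frechet v : frechet (h0 H) (Dh0 H v) v := frechet_of_uniform v D_rem.

Notation is_slow_map := (slow_map (h0 H) Fr eps (- eta)).
Notation is_tangent_map := (tangent_map (h0 H) Fr eps (- eta) (Dh0 H) DFr).

Lemma slow_manifold_exists : exists h h', is_slow_map h /\ is_tangent_map h'.
Proof.
have [h hh] := slow_map_exists cV cW e0 lam0 el1 Q0 M0 P0 gap F_lip h0_lip.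
have [h' hh'] := tangent_map_exists cV cW e0 lam0 el Q0 M0 P0 Kh0 gap F_lip h0_lip
  D_lin D_bd D_lip DF_lin DF_bd DF_rem.
by exists h, h'.
Qed.

Variables (h : Xtheta R -> Xa R) (h' : Xtheta R -> Xtheta R -> Xa R).
Hypotheses (hh : is_slow_map h) (hh' : is_tangent_map h').

Let h_lipL v v' : `|h v - h v'| <= L * `|v - v'|.
Proof. exact: (slow_map_lip cV cW e0 lam0 el1 Q0 M0 P0 gap F_lip h0_lip hh v v'). Qed.

Lemma slow_manifold_lip v v' : `|h v - h v'| <= 2 * P * `|v - v'|.
Proof. by apply: le_trans (h_lipL v v') _; exact: ler_wpM2r. Qed.

Lemma slow_manifold_near_critical v : `|h v - h0 H v| <= C1 Gamma H omega r * eps.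
Proof.
exact: (slow_map_near_critical cV cW e0 lam0 el1 Q0 M0 P0 gap F_lip h0_lip hh h0_bd
  D_lin D_bd D_frechet F_bd v).
Qed.

Let h_bd v : `|h v| <= M_H H.
Proof. exact: (slow_map_bound cV cW e0 lam0 el1 Q0 M0 P0 gap F_lip h0_lip hh h0_bd v). Qed.

Let h'_lin := tangent_map_lin cV cW e0 lam0 el Q0 M0 P0 Kh0 gap F_lip h0_lip
  D_lin D_bd D_lip DF_lin DF_bd DF_rem hh'.

Let h'_bd := tangent_map_bd cV cW e0 lam0 el Q0 M0 P0 Kh0 gap F_lip h0_lip
  D_lin D_bd D_lip DF_lin DF_bd DF_rem hh'.

Let h_rem (e : R) : 0 < e -> exists2 d : R, 0 < d & forall v x, `|x| <= d ->
  `|h (v + x) - h v - h' v x| <= e * `|x|.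
Proof.
have [nu [nu0 el' gap']] := wider_gap.
exact: (slow_map_rem cV cW e0 lam0 el Q0 M0 P0 Kh0 gap nu0 el' gap' F_lip h0_lip
  D_lin D_bd D_rem D_lip DF_lin DF_bd DF_rem hh hh').
Qed.

Let h_frechet v : frechet h (h' v) v := frechet_of_uniform v h_rem.

Lemma slow_manifold_C1 : C1_on setT h.
Proof. exact: (C1_of_uniform h'_lin h'_bd h_rem). Qed.

Lemma slow_manifold_submanifold : C1_submanifold (Xa R) (Xtheta R) (slow_manifold h).
Proof. exact: (graph_C1_submanifold L0 h'_lin h'_bd h_rem). Qed.

Lemma slow_manifold_D_near_critical v :
  (opnorm (fun x => ('d h v x - Dh0 H v x)%R) <=
    (16 * (4 * M_D2H H * C2 Gamma omega r + P * (- eta)) * eps)%:E)%E.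
Proof.
have C20 : 0 <= C2 Gamma omega r by exact: le_trans (F_bd 0 0).
rewrite (frechet_diff (h'_lin v) (h'_bd v) (h_frechet v)).2; apply: opnorm_le.
  apply: mulr_ge0 (ltW e0); apply: mulr_ge0 => //; apply: addr_ge0.
    exact: mulr_ge0.
  exact: mulr_ge0 P0 (ltW lam0).
exact: (tangent_map_near_critical cV cW e0 lam0 el Q0 M0 P0 Kh0 gap F_lip h0_lip F_bd
  D_lin D_bd D_lip DF_lin DF_bd DF_rem hh').
Qed.

Let h_inv v : h' v (Fr v (h v)) = eps^-1 *: (h0 H v - h v).
Proof.
have [th [a [<- b]]] := backward_solution_exists cV cW e0 lam0 el1 Q0 M0 P0 gap F_lip h0_lip v.
have inv := slow_map_invariant hh b.
exact: (invariance_equation h'_lin h'_bd h_frechet hh inv b).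
Qed.

Let forward t1 a th : is_solution Gamma H omega eps t1 a th ->
  forward_solution (h0 H) (calF Gamma omega) eps t1 a th.
Proof.
move=> sol t t01; have [|da dth] := sol t; first by rewrite /= in_itv.
rewrite (calGE cbH) in da.
by split; exact: deriv_within_hasd.
Qed.

Let F0_lip := calF_lip omega cbG perG.

Let F0_F v w : `|w| <= M_H H -> calF Gamma omega v w = Fr v w.
Proof. by move=> wM; apply: (calF_calFr omega cbG perG cut r0); apply: le_trans wM (ltW rM). Qed.

Lemma slow_manifold_attraction t1 a th : is_solution Gamma H omega eps t1 a th ->
  forall t, 0 <= t <= t1 ->
  `|a t - h (th t)| <= expR (- (1 / 2 * t / eps)) * `|a 0 - h (th 0)|.
Proof.
move=> /forward sol t t01.
have := attraction e0 M0 L0 small F0_lip F0_F h_bd h'_lin h'_bd h_frechet h_inv sol t01.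
congr (_ <= expR (- _) * _); by field; rewrite gt_eqF.
Qed.

(** Attraction with zero initial distance. *)
Lemma slow_manifold_invariant : invariant_set Gamma H omega eps (slow_manifold h).
Proof.
move=> t1 a th t10 sol [v _ [av thv]] t; rewrite /= in_itv /= => t01.
have := slow_manifold_attraction sol t01.
rewrite -av -thv subrr normr0 mulr0 normr_le0 subr_eq0 => /eqP ->.
by exists (th t).
Qed.

Lemma slow_manifold_phase_error t1 a th abar thbar :
  is_solution Gamma H omega eps t1 a th -> is_solution Gamma H omega eps t1 abar thbar ->
  thbar 0 = th 0 -> abar 0 = h (th 0) -> forall t, 0 <= t <= t1 ->
  `|th t - thbar t| <= 2 * M * expR ((Q + M * (2 * P)) * t1) * eps * `|a 0 - h (th 0)|.
Proof.
move=> /forward sol /forward sol' th0 a0 t t01; have /andP[t0 tt1] := t01.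
have := forward_close e0 Q0 M0 L0 small F_lip F0_lip F0_F h_bd h_lipL h'_lin h'_bd h_frechet h_inv
  sol sol' th0 a0 t01.
move=> hle; apply: le_trans hle _; apply: ler_wpM2r => //; apply: ler_wpM2r; first exact: ltW.
apply: ler_wpM2l; first by rewrite mulr_ge0.
rewrite ler_expR; apply: ler_pM => //; first by rewrite addr_ge0// mulr_ge0.
by rewrite lerD2l ler_wpM2l.
Qed.

(** The fixed point based at [v] is the defect [a - h0 theta] of the backward solution
    through [v]; its uniqueness is that of backward solutions. *)
Lemma slow_manifold_lyapunov_perron v :
  exists (xi : R -> Xa R) (th : R -> Xtheta R),
    LP_unique_fixed_point Gamma H omega chi eta eps r v xi th /\ h v = h0 H v + xi 0.
Proof.
have [th [a [thv b]]] := backward_solution_exists cV cW e0 lam0 el1 Q0 M0 P0 gap F_lip h0_lip v.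
exists (fun t => a t - h0 H (th t)), th; split; last first.
  by rewrite -thv subrKC (hh b).
have [dth da gth ga] := b.
have cth t : t <= 0 -> contd setT th t by move=> t0; exact: hasd_contd (dth t t0).
split; first split.
- apply: Cweighted_of => [t t0|].
    apply: contdD; first exact: hasd_contd (da t t0).
    by apply: contd_lip P0 _ (cth t t0) => q; rewrite -opprD normrN; exact: h0_lip.
  apply: exp_growthB => //; apply: (exp_growth_bounded (ltW lam0) (le_trans (normr_ge0 _) (h0_bd 0))).
  by move=> t; exact: h0_bd.
- exact: Cweighted_of.
- move=> t t0; rewrite -{1}thv.
  exact: (backward_solution_lp e0 el1 Q0 M0 P0 Kh0 F_lip h0_lip h0_bd F_bd D_lin D_bd
    D_frechet D_lip b t0).
move=> xi' th' [cxi cth' fixed].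
have eta0 : eta < 0 by rewrite -oppr_gt0.
have [th2 [a2 [b2 th2v same]]] := lp_backward_solution cV cW e0 eta0 Q0 M0 P0 Kh0 F_lip h0_lip
  h0_bd F_bd D_lin D_bd D_frechet D_lip (Cweighted_contd cxi) (Cweighted_contd cth')
  (Cweighted_growth cxi) (Cweighted_growth cth') fixed.
move=> t t0; have [-> ->] := same t t0.
by have [-> ->] := backward_solution_unique e0 lam0 el1 Q0 M0 P0 gap F_lip h0_lip b2 b
  (etrans th2v (esym thv)) t0.
Qed.

End slow_manifold_at.

Theorem theorem4p13 (R : realType) (Gamma : R -> R) (H : R * R -> R)
    (omega : Xtheta R) (chi : R -> R) (r eta eps0 : R) :
  standing_assumptions Gamma H ->
  cutoff chi ->
  M_H H < r ->
  admissible Gamma H omega r eta eps0 ->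
  exists h : R -> Xtheta R -> Xa R,
    (exists L : R, forall eps : R, 0 < eps <= eps0 -> L.-lipschitz (h eps)) /\
    (* (i) *)
    (forall eps : R, 0 < eps <= eps0 ->
      invariant_set Gamma H omega eps (slow_manifold (h eps)) /\
      forall theta0 : Xtheta R,
        exists (xi : R -> Xa R) (theta : R -> Xtheta R),
          LP_unique_fixed_point Gamma H omega chi eta eps r theta0 xi theta /\
          h eps theta0 = h0 H theta0 + xi 0) /\
    (* (ii) *)
    (forall eps : R, 0 < eps <= eps0 -> forall theta : Xtheta R,
      `|h eps theta - h0 H theta| <= C1 Gamma H omega r * eps) /\
    (* (iii) *)
    ((forall eps : R, 0 < eps <= eps0 -> C1_on setT (h eps)) /\
     (exists eps1 CD : R, [/\ 0 < eps1 <= eps0, 0 < CD &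
       forall eps : R, 0 < eps <= eps1 -> forall theta : Xtheta R,
         (opnorm (fun phi => ('d (h eps) theta phi - Dh0 H theta phi)%R)
            <= (CD * eps)%:E)%E]) /\
     (forall eps : R, 0 < eps <= eps0 ->
       C1_submanifold (Xa R) (Xtheta R) (slow_manifold (h eps)))) /\
    (* (iv) *)
    (exists mu : R, 0 < mu /\
      (forall (eps t1 : R) (a : R -> Xa R) (theta : R -> Xtheta R),
         0 < eps <= eps0 -> 0 < t1 ->
         is_solution Gamma H omega eps t1 a theta ->
         forall t : R, 0 <= t <= t1 ->
           `|a t - h eps (theta t)|
             <= expR (- (mu * t / eps)) * `|a 0 - h eps (theta 0)|) /\
      (forall rho t1 : R, 0 < rho -> 0 < t1 ->
         exists C : R, 0 < C /\
         forall (eps : R) (a abar : R -> Xa R) (theta thetabar : R -> Xtheta R),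
           0 < eps <= eps0 ->
           is_solution Gamma H omega eps t1 a theta ->
           `|a 0| <= rho ->
           is_solution Gamma H omega eps t1 abar thetabar ->
           thetabar 0 = theta 0 -> abar 0 = h eps (theta 0) ->
           forall t : R, 0 <= t <= t1 ->
             `|theta t - thetabar t| <= C * eps * `|a 0 - h eps (theta 0)| /\
             `|a t - abar t|
               <= expR (- (mu * t / eps)) * `|a 0 - h eps (theta 0)|
                  + C * eps * `|a 0 - h eps (theta 0)|)).
Proof.
move=> sa cut rM adm.
have [[_ eps0_gt0] _ _ _ _] := adm.
have M0 : 0 <= M_Gamma Gamma.
  have [cbG _ perG _] := sa; have [_ _ _ [bG _] _] := Gamma_regularity cbG perG.
  exact: le_trans (bG 0).
have DH0 : 0 <= M_DH H.
  by have [_ cbH _ _] := sa; have [_ + _] := kernel_ge0 (H_kernel cbH).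
pose good (eps : R) (p : (Xtheta R -> Xa R) * (Xtheta R -> Xtheta R -> Xa R)) :=
  0 < eps <= eps0 ->
  slow_map (h0 H) (calFr Gamma omega chi r) eps (- eta) p.1 /\
  tangent_map (h0 H) (calFr Gamma omega chi r) eps (- eta) (Dh0 H) (DcalFr Gamma chi r) p.2.
have /choice[p hp] : forall eps, exists p, good eps p.
  move=> eps; have [he|nhe] := boolP (0 < eps <= eps0); last first.
    by exists (fun=> 0, fun _ _ => 0) => he; rewrite he in nhe.
  by have [h [h' hhh']] := slow_manifold_exists sa cut rM adm he; exists (h, h').
pose h eps := (p eps).1; exists h.
split; first exists (2 * (2 * M_DH H)) => eps he.
  have [hh _] := hp eps he.
  by move=> [v v'] _; exact: (slow_manifold_lip sa cut rM adm he hh).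
split=> [eps he|].
  have [hh hh'] := hp eps he; split.
    exact: (slow_manifold_invariant sa cut rM adm he hh hh').
  by move=> v; exact: (slow_manifold_lyapunov_perron sa cut rM adm he hh).
split=> [eps he v|].
  by have [hh hh'] := hp eps he; exact: (slow_manifold_near_critical sa cut rM adm he hh).
split.
  split=> [eps he|].
    by have [hh hh'] := hp eps he; exact: (slow_manifold_C1 sa cut rM adm he hh hh').
  split=> [|eps he]; last first.
    by have [hh hh'] := hp eps he; exact: (slow_manifold_submanifold sa cut rM adm he hh hh').
  pose CD := 16 * (4 * M_D2H H * C2 Gamma omega r + 2 * M_DH H * (- eta)).
  exists eps0, (Num.max CD 1); split; first by rewrite eps0_gt0 lexx.
    by rewrite lt_max ltr01 orbT.
  move=> eps he v; have [hh hh'] := hp eps he.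
  apply: le_trans (slow_manifold_D_near_critical sa cut rM adm he hh hh' v) _.
  by rewrite lee_fin; apply: ler_wpM2r; [have /andP[/ltW] := he|rewrite le_max lexx].
exists (1 / 2); split; first by rewrite divr_gt0.
split=> [eps t1 a th he t10 sol t t01|rho t1 _ t10].
  by have [hh hh'] := hp eps he; exact: (slow_manifold_attraction sa cut rM adm he hh hh' sol).
set L := 2 * (2 * M_DH H).
set C0 := 2 * M_Gamma Gamma *
  expR ((4 * r * L_Gamma Gamma + M_Gamma Gamma * (2 * (2 * M_DH H))) * t1).
have C00 : 0 <= C0 by rewrite mulr_ge0 ?expR_ge0// mulr_ge0.
have L0 : 0 <= L by rewrite !mulr_ge0.
have LC0 : 0 <= L * C0 by exact: mulr_ge0.
exists ((1 + L) * C0 + 1); split; first by lra.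
move=> eps a abar th thbar he sol _ sol' th0 a0 t t01.
have [hh hh'] := hp eps he; have /andP[/ltW e0 _] := he.
have phase := slow_manifold_phase_error sa cut rM adm he hh hh' sol sol' th0 a0 t01.
set n := `|a 0 - h eps (th 0)|.
have en0 : 0 <= eps * n by exact: (mulr_ge0 e0 (normr_ge0 _)).
have abarE : abar t = h eps (thbar t).
  have := slow_manifold_attraction sa cut rM adm he hh hh' sol' t01.
  rewrite th0 a0 subrr normr0 mulr0 normr_le0 subr_eq0 => /eqP; exact.
have phase' : `|th t - thbar t| <= C0 * (eps * n) by rewrite mulrA; exact: phase.
split.
  apply: le_trans phase' _; rewrite -mulrA; apply: ler_wpM2r => //; lra.
rewrite abarE (_ : a t - _ = (a t - h eps (th t)) + (h eps (th t) - h eps (thbar t))); last first.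
  by lmod R.
apply: (le_trans (ler_normD _ _)); apply: lerD.
  exact: (slow_manifold_attraction sa cut rM adm he hh hh' sol t01).
apply: le_trans (slow_manifold_lip sa cut rM adm he hh _ _) _.
apply: le_trans (ler_wpM2l L0 phase') _.
have LC : L * C0 <= (1 + L) * C0 + 1 by lra.
by have := ler_wpM2r en0 LC; rewrite !mulrA.
Qed.
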